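(* Let $d>2$ and $n\in\mathbb{N}_0$. Then for $-1\le u\le 1$, $$m_{n,d}(u)=(1-u^2)^{d-\frac32}\,\frac{c_{d-1}}{(d-1)!}\sum_{k=0}^\infty\frac{(d-1)_k}{k!}\,\frac{C_{n+2k}^{d-1}(u)}{C_{n+2k}^{d-1}(1)},$$ where the right-hand side is understood as $0$ when $u=\pm1$, and where $c_{d-1}$ is the normalization constant defined by $$c_{d-1}^{-1}=\int_{-1}^1(1-u^2)^{d-\frac32}\,du=\frac{\Gamma\left(\frac12\right)\Gamma\left(d-\frac12\right)}{(d-1)!}.$$
   Context: $\mathbb{N}_0=\{0,1,2,\dots\}$ and $\mathbb{T}^d=(\mathbb{R}/2\pi\mathbb{Z})^d$. For $\alpha\in\mathbb{Z}^d$, $|\alpha|=|\alpha_1|+\cdots+|\alpha_d|$. $(a)_k=a(a+1)\cdots(a+k-1)$ is the Pochhammer symbol. Divided differences: for pairwise distinct real knots, $[x_0]f=f(x_0)$ and $[x_0,\ldots,x_m]f=\frac{[x_0,\ldots,x_{m-1}]f-[x_1,\ldots,x_m]f}{x_0-x_m}$; they are symmetric in the knots. B-spline: for $m\ge1$ and pairwise distinct $x_0,\ldots,x_m$, $M_m(u|x_0,\ldots,x_m)=[x_0,\ldots,x_m]\left\{\frac{(\cdot-u)_+^{m-1}}{(m-1)!}\right\}$, where $(x)_+^{k}=x^k$ if $x>0$ and $0$ otherwise. Thus $\theta\mapsto M_{d-1}(u|\cos\theta_1,\ldots,\cos\theta_d)$ is defined for almost every $\theta\in\mathbb{T}^d$.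 $E_n(\theta)=\sum_{\alpha\in\mathbb{Z}^d,\,|\alpha|=n}e^{i\alpha\cdot\theta}$, and $N_d(n)=\#\{\alpha\in\mathbb{Z}^d:|\alpha|=n\}=E_n(0)$. $m_{n,d}(u):=\frac{1}{(2\pi)^d}\int_{\mathbb{T}^d}M_{d-1}(u|\cos\theta_1,\ldots,\cos\theta_d)\,\frac{E_n(\theta)}{N_d(n)}\,d\theta$. $C_n^\lambda$ is the Gegenbauer polynomial of degree $n$ normalized by $C_n^\lambda(1)=(2\lambda)_n/n!$, i.e. with generating function $(1-2rt+r^2)^{-\lambda}=\sum_{n\ge0}C_n^\lambda(t)r^n$. *)

(* Defs.v *)
From HB Require Import structures.
From mathcomp Require Import all_boot all_order all_algebra finmap.
From mathcomp Require Import all_classical all_reals all_analysis.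
From mathcomp Require Import complex zify.

Set Implicit Arguments.
Unset Strict Implicit.
Unset Printing Implicit Defensive.

Import Order.TTheory GRing.Theory Num.Theory.
Import numFieldNormedType.Exports.

Local Open Scope classical_set_scope.
Local Open Scope ring_scope.
Local Open Scope complex_scope.

Definition tuple_of_pair (R : realType) n
    (p : measurableTypeR R * n.-tuple (measurableTypeR R)) :
    n.+1.-tuple (measurableTypeR R) :=
  [tuple of p.1 :: p.2].

Section lebesgue_tuple.
Variable R : realType.
Local Notation T := (measurableTypeR R).
Local Open Scope ereal_scope.

Lemma measurable_tuple_of_pair n :
  measurable_fun [set: T * n.-tuple T] (@tuple_of_pair R n).
Proof. exact: measurable_cons. Qed.

Section lebesgue_tuple_succ.
Variables (n : nat) (mu : {sigma_finite_measure set (n.-tuple T) -> \bar R}).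

Definition lebesgue_tuple_succ : set (n.+1.-tuple T) -> \bar R :=
  pushforward (@lebesgue_measure R \x mu) (@tuple_of_pair R n).

Let mtp := @measurable_tuple_of_pair n.

Let succ0 : lebesgue_tuple_succ set0 = 0.
Proof. by rewrite /lebesgue_tuple_succ /pushforward preimage_set0 measure0. Qed.

Let succ_ge0 A : 0 <= lebesgue_tuple_succ A.
Proof. exact: measure_ge0. Qed.

Let succ_sigma_additive : semi_sigma_additive lebesgue_tuple_succ.
Proof.
move=> F mF tF mUF; rewrite /lebesgue_tuple_succ /pushforward preimage_bigcup.
apply: measure_semi_sigma_additive.
- by move=> k; rewrite -[X in measurable X]setTI; exact: mtp.
- apply/trivIsetP => /= i j _ _ ij; rewrite -preimage_setI.
  by move/trivIsetP : tF => /(_ _ _ _ _ ij) ->//; rewrite preimage_set0.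
- by rewrite -preimage_bigcup -[X in measurable X]setTI; exact: mtp.
Qed.

HB.instance Definition _ := isMeasure.Build _ _ _ lebesgue_tuple_succ
  succ0 succ_ge0 succ_sigma_additive.

Let succ_sigma_finite : sigma_finite [set: n.+1.-tuple T] lebesgue_tuple_succ.
Proof.
have /sigma_finiteP[F [TF ndF Foo]] := sigma_finiteT (@lebesgue_measure R).
have /sigma_finiteP[G [TG ndG Goo]] := sigma_finiteT mu.
pose g (t : n.+1.-tuple T) : T * n.-tuple T := (thead t, [tuple of behead t]).
have tK : cancel (@tuple_of_pair R n) g.
  move=> [x t]; rewrite /g /tuple_of_pair/=; congr pair.
  exact: val_inj.
have mg : measurable_fun [set: n.+1.-tuple T] g.
  apply/measurable_fun_pairP; split; last exact: measurable_behead.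
  exact: (measurable_tnth ord0).
exists (fun i => g @^-1` (F i `*` G i)).
  rewrite -preimage_bigcup (_ : \bigcup_i _ = setT) ?preimage_setT//.
  rewrite -subTset => -[x t] _.
  have [i _ Fix] : (\bigcup_i F i) x by rewrite -TF.
  have [j _ Gjt] : (\bigcup_i G i) t by rewrite -TG.
  exists (maxn i j) => //; split => /=.
    by move: x Fix; exact/subsetPset/ndF/leq_maxl.
  by move: t Gjt; exact/subsetPset/ndG/leq_maxr.
move=> i; have [mFi Fioo] := Foo i; have [mGi Gioo] := Goo i; split.
  by rewrite -[X in measurable X]setTI; apply: mg => //; exact: measurableX.
rewrite /lebesgue_tuple_succ /pushforward -comp_preimage.
rewrite (_ : g \o _ = id); last by apply/funext => p /=; rewrite tK.
by rewrite preimage_id product_measure1E// lte_mul_pinfty// ge0_fin_numE.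
Qed.

HB.instance Definition _ := Measure_isSigmaFinite.Build _ _ _
  lebesgue_tuple_succ succ_sigma_finite.

End lebesgue_tuple_succ.

(* Product of n copies of the Lebesgue measure; see lebesgue_tuple_box. *)
Fixpoint lebesgue_tuple (n : nat) :
    {sigma_finite_measure set (n.-tuple T) -> \bar R} :=
  if n is n'.+1 then lebesgue_tuple_succ (lebesgue_tuple n')
  else \d_([tuple] : 0.-tuple T).
End lebesgue_tuple.

Lemma lebesgue_tuple_box (R : realType) n (A : 'I_n -> set (measurableTypeR R)) :
  (forall i, measurable (A i)) ->
  lebesgue_tuple R n [set t | forall i, A i (tnth t i)] =
  (\prod_(i < n) lebesgue_measure (A i))%E.
Proof.
elim: n A => [|n IHn] A mA /=.
  rewrite big_ord0 (_ : [set _ | _] = setT) ?diracT//.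
  by rewrite -subTset => t _ [].
rewrite big_ord_recl -IHn// /lebesgue_tuple_succ /pushforward.
set B := [set t : n.-tuple _ | _].
rewrite (_ : _ @^-1` _ = A ord0 `*` B).
  rewrite product_measure1E//.
  rewrite (_ : B = \bigcap_(i in [set: 'I_n])
      ((fun t => tnth t i) @^-1` A (lift ord0 i))).
    apply: fin_bigcap_measurable => // i _.
    by rewrite -[X in measurable X]setTI; exact: measurable_tnth.
  by apply/seteqP; split => t Bt i => [_|]; exact: Bt.
apply/seteqP; split => -[x t] /=.
  move=> At; split; first exact: (At ord0).
  by move=> i; have := At (lift ord0 i); rewrite tnthS.
move=> [Ax Bt] i; case: (unliftP ord0 i) => [j ->|->]; last exact: Ax.
by rewrite tnthS; exact: Bt.
Qed.

Section complex_integral.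
Local Open Scope ereal_scope.
Context dT (T : measurableType dT) (R : realType).
Variable mu : {measure set T -> \bar R}.

Definition complex_integrable (D : set T) (f : T -> R[i]) : Prop :=
  mu.-integrable D (fun x => (complex.Re (f x))%:E) /\
  mu.-integrable D (fun x => (complex.Im (f x))%:E).

Definition complex_integral (D : set T) (f : T -> R[i]) : R[i] :=
  ((\int[mu]_(x in D) complex.Re (f x)) +i*
   (\int[mu]_(x in D) complex.Im (f x)))%R.
End complex_integral.

Section definitions.
Variable R : realType.
Local Notation T := (measurableTypeR R).

Definition pochhammer (a : R) (k : nat) : R := \prod_(i < k) (a + i%:R).

(* The knots are x 0, ..., x m; meaningful when they are pairwise distinct,
   and a junk value (from division by 0) otherwise. *)
Fixpoint divided_difference (m : nat) (x : nat -> R) (f : R -> R) : R :=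
  if m is m'.+1 then
    (divided_difference m' x f - divided_difference m' (fun i => x i.+1) f)
      / (x 0%N - x m)
  else f (x 0%N).

Definition truncated_power (k : nat) (x : R) : R :=
  if 0 < x then x ^+ k else 0.

Definition bspline (m : nat) (u : R) (x : nat -> R) : R :=
  divided_difference m x (fun t => truncated_power m.-1 (t - u) / (m.-1)`!%:R).

Definition l1_sphere (d n : nat) : set (d.-tuple int) :=
  [set a | (\sum_(i < d) `|tnth a i|)%N = n].
Arguments l1_sphere : clear implicits.

Lemma finite_l1_sphere d n : finite_set (l1_sphere d n).
Proof.
pose I := (d.-tuple 'I_(n.*2.+1))%type.
pose g (t : I) : d.-tuple int := [tuple (tnth t i)%:Z - n%:Z | i < d].
apply: (@sub_finite_set _ _ (range g)); last exact/finite_image/finite_finset.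
move=> a /= an.
have le_an i : (`|tnth a i| <= n)%N by rewrite -an (bigD1 i)//= leq_addr.
exists [tuple inord `|tnth a i + n%:Z| | i < d] => //.
apply: eq_from_tnth => i; rewrite !tnth_mktuple inordK; last first.
  by have := le_an i; lia.
by have := le_an i; lia.
Qed.

Definition expi (t : R) : R[i] := cos t +i* sin t.

Definition l1_exp_sum (d n : nat) (theta : d.-tuple T) : R[i] :=
  \sum_(a \in l1_sphere d n) expi (\sum_(i < d) (tnth a i)%:~R * tnth theta i).

Definition l1_card (d n : nat) : nat := #|` fset_set (l1_sphere d n)|.

(* Fundamental domain of the torus (R / 2 pi Z)^d. *)
Definition torus (d : nat) : set (d.-tuple T) :=
  [set theta | forall i, tnth theta i \in `[- pi, pi]].

(* For theta outside a null set, the knots cos theta_i are pairwise distinct. *)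
Definition m_integrand (d n : nat) (u : R) (theta : d.-tuple T) : R[i] :=
  (bspline d.-1 u (fun i => cos (nth 0 theta i)))%:C
    * (l1_exp_sum n theta / (l1_card d n)%:R).

Definition bspline_coef (d n : nat) (u : R) : R[i] :=
  (((2 * pi) ^+ d)^-1)%:C
    * complex_integral (lebesgue_tuple R d) (@torus d) (@m_integrand d n u).

(* r |-> (1 - 2 r t + r^2)^(- lambda) generates the Gegenbauer polynomials:
   C_n^lambda(t) is its n-th Taylor coefficient at r = 0. *)
Definition gegenbauer (lambda : R) (n : nat) (t : R) : R :=
  derive1n n (fun r : R => (1 - 2 * r * t + r ^+ 2) `^ (- lambda)) 0 / n`!%:R.

Definition Gamma (x : R) : R :=
  \int[@lebesgue_measure R]_(t in `]0, +oo[) (t `^ (x - 1) * expR (- t)).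

End definitions.
Arguments torus : clear implicits.
Arguments m_integrand : clear implicits.
Arguments bspline_coef : clear implicits.

(* Main.v *)
Require Import Defs.
From mathcomp Require Import all_boot all_order all_algebra finmap.
From mathcomp Require Import all_classical all_reals all_analysis.
From mathcomp Require Import measurable_realfun complex.
From mathcomp Require Import ring lra zify.

Set Implicit Arguments.
Unset Strict Implicit.
Unset Printing Implicit Defensive.

Import Order.TTheory GRing.Theory Num.Theory.
Import numFieldNormedType.Exports.

Local Open Scope classical_set_scope.
Local Open Scope ring_scope.


Section divided_differences.
Variable R : realType.
Implicit Types (x y : nat -> R) (f g : R -> R) (p q : {poly R}) (u : R).

Definition distinct_knots m x :=
  forall i j, (i <= m)%N -> (j <= m)%N -> x i = x j -> i = j.

Lemma distinct_knotsW m x : distinct_knots m.+1 x -> distinct_knots m x.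
Proof. by move=> dx i j im jm; apply: dx; exact: leqW. Qed.

Lemma distinct_knotsS m x :
  distinct_knots m.+1 x -> distinct_knots m (fun i => x i.+1).
Proof. by move=> dx i j im jm /dx-/(_ im jm)[]. Qed.

Lemma distinct_knots_neq m x : distinct_knots m.+1 x -> x 0%N - x m.+1 != 0.
Proof. by move=> dx; rewrite subr_eq0; apply/eqP => /dx-/(_ isT (leqnn _)). Qed.

Lemma divided_differenceS m x f : divided_difference m.+1 x f =
  (divided_difference m x f - divided_difference m (fun i => x i.+1) f)
  / (x 0%N - x m.+1).
Proof. by []. Qed.

Lemma eq_divided_difference m x y f g :
  (forall i, (i <= m)%N -> x i = y i) ->
  (forall i, (i <= m)%N -> f (x i) = g (x i)) ->
  divided_difference m x f = divided_difference m y g.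
Proof.
elim: m x y => [|m IHm] x y xy fg /=; first by rewrite -xy ?fg.
rewrite -!xy//; congr ((_ - _) / _).
  by apply: IHm => i im; [exact/xy/leqW|exact/fg/leqW].
by apply: IHm => i im; [exact: xy|exact: fg].
Qed.

Lemma divided_differenceD m x f g :
  divided_difference m x (fun t => f t + g t) =
  divided_difference m x f + divided_difference m x g.
Proof. by elim: m x => [//|m IHm] x /=; rewrite !IHm; ring. Qed.

Lemma divided_differenceZ m x c f :
  divided_difference m x (fun t => c * f t) = c * divided_difference m x f.
Proof. by elim: m x => [//|m IHm] x /=; rewrite !IHm; ring. Qed.

Lemma divided_difference0 m x : divided_difference m x (fun=> 0) = 0.
Proof. by elim: m x => [//|m IHm] x /=; rewrite !IHm subrr mul0r. Qed.

Lemma divided_difference_cst m x c : divided_difference m.+1 x (fun=> c) = 0.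
Proof.
elim: m x => [|m IHm] x; first by rewrite /= subrr mul0r.
by rewrite divided_differenceS !IHm subrr mul0r.
Qed.

(** The Leibniz rule for a product with a linear factor: it is what turns
    the recurrences satisfied by truncated powers and by Chebyshev polynomials
    into recurrences for their divided differences. *)
Lemma divided_difference_linM m x a g : distinct_knots m.+1 x ->
  divided_difference m.+1 x (fun t => (t - a) * g t) =
  (x 0%N - a) * divided_difference m.+1 x g
  + divided_difference m (fun i => x i.+1) g.
Proof.
elim: m x => [|m IHm] x dx.
  have := distinct_knots_neq dx; rewrite /= => x01.
  by field.
have x0m := distinct_knots_neq dx.
have x1m := distinct_knots_neq (distinct_knotsS dx).
rewrite divided_differenceS (IHm _ (distinct_knotsW dx)) (IHm _ (distinct_knotsS dx)).
rewrite [divided_difference m.+2 x g]divided_differenceS.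
set A := divided_difference m.+1 x g.
set B := divided_difference m.+1 (fun i => x i.+1) g.
have -> : divided_difference m (fun i => x i.+1) g =
    divided_difference m (fun i => x i.+2) g + (x 1%N - x m.+2) * B.
  by rewrite /B divided_differenceS; field.
rewrite -/A -/B; field.
exact: x0m.
Qed.

Lemma divided_difference_poly m x p : distinct_knots m x ->
  (size p <= m.+1)%N -> divided_difference m x (horner p) = p`_m.
Proof.
elim/poly_ind: p m x => [|p c IHp] m x dx sp.
  rewrite coef0 -[RHS](divided_difference0 m x).
  by apply: eq_divided_difference => // i _; rewrite horner0.
have {}sp : (size p <= m)%N.
  have [->|p0] := eqVneq p 0; first by rewrite size_poly0.
  by move: sp; rewrite size_MXaddC (negbTE p0).
rewrite coefD coefMX coefC.
have -> : divided_difference m x (horner (p * 'X + c%:P)) =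
    divided_difference m x (fun t => (t - 0) * p.[t] + c).
  by apply: eq_divided_difference => // i _; rewrite !hornerE; ring.
rewrite divided_differenceD.
case: m => [|m] /= in dx sp *.
  by move: sp; rewrite leqn0 size_poly_eq0 => /eqP ->; rewrite horner0 mulr0.
rewrite -/(divided_difference m.+1 x (fun t => (t - 0) * p.[t])).
rewrite -/(divided_difference m.+1 x (fun=> c)) divided_difference_cst.
rewrite divided_difference_linM// IHp ?(leqW sp)// IHp//; last first.
  exact: distinct_knotsS.
by rewrite (nth_default _ sp) !addr0 mulr0 add0r.
Qed.

Lemma interpolation m x f : distinct_knots m x ->
  exists2 p : {poly R}, (size p <= m.+1)%N &
    forall i, (i <= m)%N -> p.[x i] = f (x i).
Proof.
elim: m => [|m IHm] dx.
  exists (f (x 0%N))%:P; first exact: size_polyC_leq1.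
  by move=> i; rewrite leqn0 => /eqP ->; rewrite hornerC.
have [p sp pf] := IHm (distinct_knotsW dx).
pose w := \prod_(i < m.+1) ('X - (x i)%:P).
have w0 : w.[x m.+1] != 0.
  rewrite horner_prod; apply/prodf_neq0 => i _.
  rewrite hornerXsubC subr_eq0; apply/eqP => /dx-/(_ (leqnn _) (leqW (leq_ord i))).
  by move=> mi; move: (leq_ord i); rewrite -mi ltnn.
pose c := (f (x m.+1) - p.[x m.+1]) / w.[x m.+1].
exists (p + c *: w).
  apply: (leq_trans (size_polyD _ _)); rewrite geq_max (leq_trans sp)//=.
  apply: (leq_trans (size_scale_leq _ _)).
  by rewrite size_prod_XsubC [X in size X]unlock -enumT size_enum_ord.
move=> i; rewrite leq_eqVlt => /predU1P[->|]; rewrite !hornerE.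
  by rewrite divfK// addrC subrK.
move=> im; rewrite pf//; suff -> : w.[x i] = 0 by rewrite mulr0 addr0.
rewrite horner_prod (bigD1 (Ordinal im))//= hornerXsubC subrr.
by rewrite mul0r.
Qed.

(** A divided difference is the leading coefficient of the interpolation
    polynomial, which depends on the set of knots only. *)
Lemma divided_difference_sym m x y f :
  distinct_knots m x -> distinct_knots m y ->
  (forall i, (i <= m)%N -> exists2 j, (j <= m)%N & y i = x j) ->
  divided_difference m x f = divided_difference m y f.
Proof.
move=> dx dy xy; have [p sp pf] := interpolation f dx.
rewrite (_ : divided_difference m x f = divided_difference m x (horner p)).
  rewrite (_ : divided_difference m y f = divided_difference m y (horner p)).
    by rewrite !divided_difference_poly.
  by apply: eq_divided_difference => // i /xy[j jm ->]; rewrite pf.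
by apply: eq_divided_difference => // i im; rewrite pf.
Qed.

Lemma divided_difference_endpoints m x f i j :
  distinct_knots m.+1 x -> (i <= m.+1)%N -> (j <= m.+1)%N -> i != j ->
  exists y, [/\ distinct_knots m.+1 y, y 0%N = x i, y m.+1 = x j,
    (forall k, (k <= m.+1)%N -> exists2 l, (l <= m.+1)%N & y k = x l) &
    divided_difference m.+1 x f = divided_difference m.+1 y f].
Proof.
move=> dx im jm ij.
pose sw (a b k : nat) := if k == a then b else if k == b then a else k.
have swI a b : injective (sw a b).
  move=> k l; rewrite /sw.
  by case: (eqVneq k a) => ?; case: (eqVneq l a) => ?; case: (eqVneq k b) => ?;
    case: (eqVneq l b) => ?; lia.
have swm a b k : (a <= m.+1)%N -> (b <= m.+1)%N -> (k <= m.+1)%N ->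
    (sw a b k <= m.+1)%N.
  by rewrite /sw; case: ifP => // _; case: ifP.
pose j' := sw 0%N i j.
have j'm : (j' <= m.+1)%N by exact: swm.
have j'0 : j' != 0%N by move: ij; rewrite /j' /sw; repeat case: ifP => ?; lia.
pose s k := sw 0%N i (sw j' m.+1 k).
have sm k : (k <= m.+1)%N -> (s k <= m.+1)%N.
  by move=> km; apply: (swm) => //; exact: swm.
have sI : injective s by move=> k l /swI/swI.
have s0 : s 0%N = i.
  have -> : s 0%N = sw 0%N i 0%N.
    by rewrite /s; congr sw; rewrite /sw [0%N == _]eq_sym (negbTE j'0).
  by rewrite /sw eqxx.
have sS : s m.+1 = j.
  have -> : s m.+1 = sw 0%N i j'.
    by rewrite /s; congr sw; rewrite /sw eqxx; case: eqP.
  by move: ij; rewrite /j' /sw; case: (eqVneq j 0%N) => ?;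
    case: (eqVneq j i) => ?; repeat case: ifP => ?; lia.
have dy : distinct_knots m.+1 (x \o s).
  by move=> k l km lm /= /dx-/(_ (sm _ km) (sm _ lm))/sI.
exists (x \o s); split; rewrite ?[(_ \o _) _]/= ?s0 ?sS//.
- by move=> k km; exists (s k) => //; exact: sm.
- apply: divided_difference_sym => // k km; exists (s k) => //; exact: sm.
Qed.

End divided_differences.

Section bspline_bounds.
Variable R : realType.
Implicit Types (x y : nat -> R) (u : R).

Definition scaled_tpower k u (t : R) : R := truncated_power k (t - u) / k`!%:R.

Lemma bsplineE m u x : bspline m u x = divided_difference m x (scaled_tpower m.-1 u).
Proof. by []. Qed.

Lemma scaled_tpowerS k u t :
  scaled_tpower k.+1 u t = k.+1%:R^-1 * ((t - u) * scaled_tpower k u t).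
Proof.
rewrite /scaled_tpower /truncated_power factS natrM; case: ifP => _; last first.
  by rewrite !mul0r !mulr0.
have k0 : k`!%:R != 0 :> R by rewrite pnatr_eq0 -lt0n fact_gt0.
have k1 : k.+1%:R != 0 :> R by rewrite pnatr_eq0.
rewrite exprS !invfM; rewrite [LHS](_ : _ = k.+1%:R^-1 * ((t - u) * ((t - u) ^+ k / k`!%:R)))//.
ring.
Qed.

Lemma scaled_tpower_le k u t : t <= u -> scaled_tpower k u t = 0.
Proof.
by move=> tu; rewrite /scaled_tpower /truncated_power subr_gt0 ltNge tu mul0r.
Qed.

Lemma scaled_tpower_gt k u t : u < t ->
  scaled_tpower k u t = ((k`!%:R)^-1 *: (('X - u%:P) ^+ k)).[t].
Proof.
move=> ut; rewrite /scaled_tpower /truncated_power subr_gt0 ut.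
by rewrite !hornerE mulrC.
Qed.

Lemma dd_scaled_tpower_right m k u x : (forall i, (i <= m)%N -> x i <= u) ->
  divided_difference m x (scaled_tpower k u) = 0.
Proof.
move=> xu; rewrite -[RHS](divided_difference0 m x).
by apply: eq_divided_difference => // i /xu; exact: scaled_tpower_le.
Qed.

Lemma dd_scaled_tpower_left m k u x : distinct_knots m x -> (k < m)%N ->
  (forall i, (i <= m)%N -> u < x i) ->
  divided_difference m x (scaled_tpower k u) = 0.
Proof.
move=> dx km xu; pose p := (k`!%:R)^-1 *: (('X - u%:P) ^+ k).
have sp : (size p <= m)%N.
  by apply: (leq_trans (size_scale_leq _ _)); rewrite size_exp_XsubC.
rewrite [LHS](_ : _ = divided_difference m x (horner p)).
  by rewrite divided_difference_poly ?(leqW sp)// nth_default.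
by apply: eq_divided_difference => // i /xu; exact: scaled_tpower_gt.
Qed.

Lemma dd_scaled_tpowerS k u x : distinct_knots k.+1 x ->
  divided_difference k.+1 x (scaled_tpower k.+1 u) = k.+1%:R^-1 *
  ((x 0%N - u) * divided_difference k.+1 x (scaled_tpower k u)
   + divided_difference k (fun i => x i.+1) (scaled_tpower k u)).
Proof.
move=> dx; rewrite -divided_difference_linM// -divided_differenceZ.
by apply: eq_divided_difference => // i _; exact: scaled_tpowerS.
Qed.

(** By the Leibniz rule the divided difference of degree k+1 is the mean of
    two divided differences of degree k, with weights (x_0 - u)/(x_0 - x_{k+1})
    and its complement.  These weights lie in [0, 1] once the knots are
    reordered so that u separates x_0 from x_{k+1}. *)
Lemma dd_scaled_tpower_le1 k u x : distinct_knots k x ->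
  `|divided_difference k x (scaled_tpower k u)| <= 1.
Proof.
elim: k x => [|k IHk] x dx.
  rewrite /= /scaled_tpower /truncated_power fact0 divr1 expr0.
  by case: ifP => _; rewrite ?normr1 ?normr0 ?ler01.
have kle1 : `|k.+1%:R^-1 : R| <= 1.
  by rewrite ger0_norm ?invr_ge0 ?ler0n// invf_le1 ?ler1n// ltr0n.
have step y : distinct_knots k.+1 y ->
    `|(y 0%N - u) * divided_difference k.+1 y (scaled_tpower k u)
      + divided_difference k (fun i => y i.+1) (scaled_tpower k u)| <= 1 ->
    `|divided_difference k.+1 y (scaled_tpower k.+1 u)| <= 1.
  move=> dy y1; rewrite dd_scaled_tpowerS// normrM.
  by rewrite -[leRHS]mulr1 ler_pM.
have [xr|/existsNP[i /not_implyP[ik /negP]]] :=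
    pselect (forall i, (i <= k.+1)%N -> x i <= u).
  by rewrite dd_scaled_tpower_right// normr0 ler01.
rewrite -ltNge => xi.
have [xl|/existsNP[j /not_implyP[jk /negP]]] :=
    pselect (forall i, (i <= k.+1)%N -> u < x i).
  apply: step => //; rewrite (dd_scaled_tpower_left dx)// mulr0 add0r.
  by apply: IHk; exact: distinct_knotsS.
rewrite -leNgt => xj.
have ij : i != j by apply/eqP => ij; move: xi; rewrite ij ltNge xj.
have [y [dy y0 yk _ ->]] := divided_difference_endpoints (scaled_tpower k.+1 u) dx ik jk ij.
apply: step => //; rewrite divided_differenceS y0 yk.
have A1 := IHk _ (distinct_knotsW dy).
have B1 := IHk _ (distinct_knotsS dy).
set A := divided_difference _ _ _ in A1 *.
set B := divided_difference _ _ _ in B1 *.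
have xij : 0 < x i - x j by rewrite subr_gt0 (le_lt_trans xj).
pose w := (x i - u) / (x i - x j).
have w0 : 0 <= w by rewrite divr_ge0 ?subr_ge0 ?(ltW xi) ?(ltW xij)// -subr_ge0 ltW.
have w1 : w <= 1 by rewrite ler_pdivrMr// mul1r lerB.
rewrite (_ : _ + _ = w * A + (1 - w) * B); last first.
  by rewrite /w; field; rewrite gt_eqF.
rewrite (le_trans (ler_normD _ _))// (normrM w) (normrM (1 - w)).
rewrite (ger0_norm w0) (@ger0_norm _ (1 - w)) ?subr_ge0//.
rewrite -[leRHS](subrK w) addrC lerD// -[leRHS]mulr1 ler_wpM2l// subr_ge0//.
Qed.

Lemma bspline_eq0_right m u x : (forall i, (i <= m)%N -> x i <= u) ->
  bspline m u x = 0.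
Proof. exact: dd_scaled_tpower_right. Qed.

Lemma bspline_eq0_left m u x : (0 < m)%N -> distinct_knots m x ->
  (forall i, (i <= m)%N -> u < x i) -> bspline m u x = 0.
Proof. by move=> m0 dx xu; apply: dd_scaled_tpower_left => //; case: m m0 {dx xu}. Qed.

(** If the B-spline does not vanish at u then u lies between two knots x_j <= u < x_i.
    Moving x_i and x_l (or x_l and x_j) to the ends of the list of knots bounds
    the B-spline by 2 / |x_l - x_i|, hence by 2 / |x_l - u|. *)
Lemma bspline_bound m u x l : (0 < m)%N -> distinct_knots m x -> (l <= m)%N ->
  `|bspline m u x| * `|x l - u| <= 2.
Proof.
case: m => // m _ dx lm.
have bound i j : (i <= m.+1)%N -> (j <= m.+1)%N -> i != j ->
    `|bspline m.+1 u x| * `|x i - x j| <= 2.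
  move=> im jm ij; rewrite bsplineE.
  have [y [dy y0 yk _ ->]] := divided_difference_endpoints (scaled_tpower m u) dx im jm ij.
  rewrite divided_differenceS y0 yk -normrM mulfVK; last first.
    rewrite subr_eq0; apply/eqP => /dx; rewrite im jm => /(_ isT isT) ji.
    by rewrite ji eqxx in ij.
  rewrite (le_trans (ler_normB _ _))// -[leRHS]/(1 + 1 : R).
  by rewrite lerD// dd_scaled_tpower_le1//; [exact: distinct_knotsW|exact: distinct_knotsS].
have [->|M0] := eqVneq (bspline m.+1 u x) 0; first by rewrite normr0 mul0r.
have [xr|/existsNP[i /not_implyP[im /negP]]] :=
    pselect (forall i, (i <= m.+1)%N -> x i <= u).
  by rewrite bspline_eq0_right ?eqxx in M0.
rewrite -ltNge => xi.
have [xl|/existsNP[j /not_implyP[jm /negP]]] :=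
    pselect (forall i, (i <= m.+1)%N -> u < x i).
  by rewrite bspline_eq0_left ?eqxx in M0.
rewrite -leNgt => xj.
have [ul|lu] := ltP u (x l).
  apply: le_trans (bound l j lm jm _).
    rewrite ler_wpM2l// !gtr0_norm ?subr_gt0 ?(le_lt_trans xj)//.
    by rewrite lerB.
  by apply/eqP => lj; move: ul; rewrite lj ltNge xj.
apply: le_trans (bound l i lm im _).
  rewrite ler_wpM2l// ler0_norm ?subr_le0// ltr0_norm ?subr_lt0 ?(le_lt_trans lu)//.
  by rewrite !opprB lerB// ltW.
by apply/eqP => li; move: xi; rewrite -li ltNge lu.
Qed.

End bspline_bounds.

Section convolution.
Variable R : realType.
Implicit Types f g h v : nat -> R.

(** Cauchy product, i.e. multiplication of formal power series. *)
Definition conv f g n := \sum_(i < n.+1) f i * g (n - i)%N.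

Lemma conv0 f g : conv f g 0 = f 0%N * g 0%N.
Proof. by rewrite /conv big_ord_recl big_ord0 addr0 subn0. Qed.

Lemma conv1 f g : conv f g 1 = f 0%N * g 1%N + f 1%N * g 0%N.
Proof. by rewrite /conv !big_ord_recl big_ord0 addr0 subn0. Qed.

Lemma convSS f g n : conv f g n.+2 =
  f 0%N * g n.+2 + f 1%N * g n.+1 + conv (fun i => f i.+2) g n.
Proof. by rewrite /conv !big_ord_recl/= subn0 subSS subn0 addrA. Qed.

(** Division of a power series by 1 - 2 a r + r^2. *)
Lemma conv_recurrence a f h v : f 0%N = 1 -> f 1%N = 2 * a ->
  (forall i, f i.+2 = 2 * a * f i.+1 - f i) ->
  v 0%N = h 0%N -> v 1%N = 2 * a * v 0%N + h 1%N ->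
  (forall m, v m.+2 = 2 * a * v m.+1 - v m + h m.+2) ->
  forall m, v m = conv f h m.
Proof.
move=> f0 f1 fS v0 v1 vS m.
suff [] : v m = conv f h m /\ v m.+1 = conv f h m.+1 by [].
elim: m => [|m [IH0 IH1]]; first by rewrite v1 v0 conv0 conv1 f0 f1; split; ring.
split => //; rewrite vS IH0 IH1 convSS.
have -> : conv f h m.+1 = f 0%N * h m.+1 + conv (fun i => f i.+1) h m.
  by rewrite /conv big_ord_recl/= subn0.
rewrite (_ : conv (fun i => f i.+2) h m =
    2 * a * conv (fun i => f i.+1) h m - conv f h m); last first.
  rewrite /conv mulr_sumr -sumrB; apply: eq_bigr => i _; rewrite fS; ring.
by rewrite f0 f1; ring.
Qed.

End convolution.

Section cosine_sums.
Variable R : realType.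
Implicit Types (x : R) (s : seq R).

(** The sum of exp(i k x) over the integers k with |k| = a. *)
Definition cos_term (a : nat) x : R := if a is 0 then 1 else 2 * cos (a%:R * x).

(** The Chebyshev polynomial of the second kind U_i at cos x. *)
Fixpoint cos_U (i : nat) x : R :=
  match i with
  | 0 => 1
  | 1 => 2 * cos x
  | j.+2 => cos_U j x + cos_term j.+2 x
  end.

(** The n-th coefficient of the product over s of the Poisson kernels
    (1 - r^2) / (1 - 2 r cos x + r^2). *)
Fixpoint cos_E s (n : nat) : R :=
  if s is x :: s' then conv (cos_term^~ x) (cos_E s') n else (n == 0%N)%:R.

(** The m-th coefficient of the product over x :: s of the Poisson kernels,
    divided by (1 - r^2) to the power size s. *)
Fixpoint cos_F x s (m : nat) : R :=
  if s is y :: s' then conv (cos_U^~ x) (cos_F y s') m else cos_term m x.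

Lemma cos_mulS (a : nat) x :
  2 * cos x * cos (a.+1%:R * x) = cos (a.+2%:R * x) + cos (a%:R * x).
Proof.
have -> : a.+2%:R * x = a.+1%:R * x + x by rewrite -[a.+2]addn1 natrD; ring.
have -> : a%:R * x = a.+1%:R * x - x by rewrite -[a.+1]addn1 natrD; ring.
by rewrite cosB cosD; ring.
Qed.

Lemma cos_UE i x : cos_U i.+2 x = 2 * cos x * cos_U i.+1 x - cos_U i x.
Proof.
suff [] : cos_U i.+2 x = 2 * cos x * cos_U i.+1 x - cos_U i x /\
          cos_U i.+3 x = 2 * cos x * cos_U i.+2 x - cos_U i.+1 x by [].
elim: i => [|i [IH0 IH1]].
  have h0 := cos_mulS 0 x; have h1 := cos_mulS 1 x.
  move: h0 h1; rewrite /= !mul1r mul0r cos0 => h0 h1; split; first by lra.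
  rewrite mulrDr mulr1 [X in _ = _ + X - _]mulrCA h1; lra.
split => //.
rewrite -[cos_U i.+4 x]/(cos_U i.+2 x + 2 * cos (i.+4%:R * x)).
rewrite -[cos_U i.+3 x]/(cos_U i.+1 x + 2 * cos (i.+3%:R * x)).
have := cos_mulS i.+2 x; have := IH0.
rewrite -[cos_U i.+2 x]/(cos_U i x + 2 * cos (i.+2%:R * x)).
by rewrite mulrDr [_ * (2 * _)]mulrCA => *; lra.
Qed.

Lemma conv_cos_USS x (g : nat -> R) m : conv (cos_U^~ x) g m.+2 =
  conv (cos_U^~ x) g m + conv (cos_term^~ x) g m.+2.
Proof.
rewrite !convSS [X in _ = _ + (_ + X)](_ : _ = 
  conv (fun i => cos_U i.+2 x) g m - conv (cos_U^~ x) g m).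
  by rewrite /= !mul1r; ring.
by rewrite /conv -sumrB; apply: eq_bigr => i _; rewrite /=; ring.
Qed.

Lemma conv_cos_U0 x (g : nat -> R) : conv (cos_U^~ x) g 0 = conv (cos_term^~ x) g 0.
Proof. by rewrite !conv0. Qed.

Lemma conv_cos_U1 x (g : nat -> R) : conv (cos_U^~ x) g 1 = conv (cos_term^~ x) g 1.
Proof. by rewrite !conv1/= !mul1r. Qed.

Fixpoint chebT (n : nat) : {poly R} :=
  match n with
  | 0 => 1
  | 1 => 'X
  | (m.+1 as k).+1 => 'X *+ 2 * chebT k - chebT m
  end.

Lemma chebTSS n : chebT n.+2 = 'X *+ 2 * chebT n.+1 - chebT n.
Proof. by []. Qed.

Lemma chebT_cos n x : (chebT n).[cos x] = cos (n%:R * x).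
Proof.
suff [] : (chebT n).[cos x] = cos (n%:R * x) /\
          (chebT n.+1).[cos x] = cos (n.+1%:R * x) by [].
elim: n => [|n [IH0 IH1]]; first by rewrite /= hornerC hornerX mul0r cos0 mul1r.
split => //; rewrite chebTSS !hornerE IH0 IH1.
by have := cos_mulS n x; rewrite mulr_natl; lra.
Qed.

Lemma size_chebT n : size (chebT n) = n.+1.
Proof.
suff [] : size (chebT n) = n.+1 /\ size (chebT n.+1) = n.+2 by [].
elim: n => [|n [IH0 IH1]]; first by rewrite size_poly1 size_polyX.
split => //; rewrite chebTSS -scaler_nat -scalerAl.
have s2 : size (2%:R *: ('X * chebT n.+1)) = n.+3.
  rewrite size_scale ?pnatr_eq0// mulrC size_mulX ?IH1//.
  by rewrite -size_poly_eq0 IH1.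
by rewrite size_polyDl s2// size_polyN IH0.
Qed.

(** Comparing the generating function of the Chebyshev polynomials, whose
    divided differences are computed with the Leibniz rule, with the product of
    the Poisson kernels. *)
Lemma dd_chebT x s m :
  distinct_knots (size s) (fun i => cos (nth 0 (x :: s) i)) ->
  (0 < m + size s)%N ->
  2 * divided_difference (size s) (fun i => cos (nth 0 (x :: s) i))
        (horner (chebT (m + size s))) = 2 ^+ size s * cos_F x s m.
Proof.
elim: s x m => [|y s IHs] x m dx ms.
  rewrite /= addn0 in ms *; rewrite chebT_cos expr0 mul1r.
  by case: m ms.
set X := (fun i => cos _) in dx *.
set k := size s in IHs *.
have dX : distinct_knots k (fun i => cos (nth 0 (y :: s) i)).
  exact: (distinct_knotsS dx).
have dd_lt N : (N <= k)%N ->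
    divided_difference k.+1 X (horner (chebT N)) = 0.
  move=> Nk; rewrite divided_difference_poly ?size_chebT//.
    by rewrite nth_default// size_chebT.
  exact: leqW.
have rec N : divided_difference k.+1 X (horner (chebT N.+2)) =
    2 * (cos x * divided_difference k.+1 X (horner (chebT N.+1))
         + divided_difference k (fun i => cos (nth 0 (y :: s) i))
             (horner (chebT N.+1)))
    - divided_difference k.+1 X (horner (chebT N)).
  have := divided_difference_linM 0 (horner (chebT N.+1)) dx.
  rewrite subr0 => <-; rewrite -divided_differenceZ -[- divided_difference _ _ _]mulN1r.
  rewrite -divided_differenceZ -divided_differenceD.
  apply: eq_divided_difference => // i _.
  by rewrite chebTSS hornerD hornerN hornerM hornerMn hornerX; ring.
rewrite (_ : size (y :: s) = k.+1)//.
pose v m := 2 * divided_difference k.+1 X (horner (chebT (m + k.+1))).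
pose h m := 2 ^+ k.+1 * cos_F y s m.
have hE N : (0 < N + k)%N -> h N = 2 * (2 *
    divided_difference k (fun i => cos (nth 0 (y :: s) i)) (horner (chebT (N + k)))).
  by move=> Nk; rewrite IHs// /h exprS; ring.
rewrite -/(v m) (@conv_recurrence _ (cos x) (cos_U^~ x) h v)//.
- rewrite /conv /= mulr_sumr; apply: eq_bigr => i _; rewrite /h; ring.
- by move=> i; exact: cos_UE.
- rewrite /v add0n; case: (posnP k) => [k0|k0].
    rewrite /h (size0nil k0) k0 divided_difference_poly ?size_chebT//.
      by rewrite /= coefX expr1.
    by rewrite -k0.
  have /prednK kE := k0; have := rec k.-1; rewrite kE => ->.
  by rewrite hE// add0n !dd_lt ?leq_pred//; ring.
- rewrite /v hE ?add1n// add0n rec (dd_lt k)//; ring.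
- move=> N; rewrite /v hE// !addSn rec !addnS; ring.
Qed.

End cosine_sums.

Section calculus.
Variable R : realType.
Notation mu := (@lebesgue_measure R).
Implicit Types (f g F : R -> R) (a b : R).

Lemma continuous_integrable_itv f a b : continuous f ->
  mu.-integrable `[a, b] (EFin \o f).
Proof.
move=> cf; apply: continuous_compact_integrable; first exact: segment_compact.
exact: continuous_subspaceT.
Qed.

(** The fundamental theorem of calculus for a primitive on the whole line. *)
Lemma Rintegral_primitive F f a b : a <= b -> (forall x : R, is_derive x 1 F (f x)) ->
  continuous f -> \int[mu]_(x in `[a, b]) f x = F b - F a.
Proof.
move=> ab dF cf; have [<-|nab] := eqVneq a b.
  by rewrite set_itv1 Rintegral_set1 subrr.
have {}ab : a < b by rewrite lt_neqAle nab ab.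
have cF : continuous F.
  by move=> x; apply: differentiable_continuous; apply/derivable1_diffP; case: (dF x).
rewrite /Rintegral (@continuous_FTC2 R f F a b) => //=.
- exact: continuous_subspaceT.
- split; first by move=> x _; case: (dF x).
  + by apply: cvg_at_right_filter; exact: cF.
  + by apply: cvg_at_left_filter; exact: cF.
- by move=> x _; rewrite derive1E; case: (dF x).
Qed.

Lemma is_derive_sin_mul c (x : R) : is_derive x 1 (fun t => sin (c * t)) (c * cos (c * x)).
Proof.
have h1 : is_derive x 1 (fun t : R => c * t) c.
  by apply: is_derive_eq; rewrite /GRing.scale /=; ring.
have := @is_derive1_comp R sin _ _ _ _ (is_derive_sin (c * x)) h1.
by rewrite mulrC.
Qed.

Lemma is_derive_cos_mul c (x : R) : is_derive x 1 (fun t => cos (c * t)) (- (c * sin (c * x))).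
Proof.
have h1 : is_derive x 1 (fun t : R => c * t) c.
  by apply: is_derive_eq; rewrite /GRing.scale /=; ring.
have := @is_derive1_comp R cos _ _ _ _ (is_derive_cos (c * x)) h1.
by rewrite mulNr mulrC.
Qed.

Lemma continuous_cos_mul c : continuous (fun t : R => cos (c * t)).
Proof.
by move=> x; apply: differentiable_continuous; apply/derivable1_diffP;
  case: (is_derive_cos_mul c x).
Qed.

Lemma continuous_sin_mul c : continuous (fun t : R => sin (c * t)).
Proof.
by move=> x; apply: differentiable_continuous; apply/derivable1_diffP;
  case: (is_derive_sin_mul c x).
Qed.

Lemma sin_natpi (n : nat) : sin (n%:R * pi) = 0 :> R.
Proof.
elim: n => [|n IHn]; first by rewrite mul0r sin0.
by rewrite -natr1 mulrDl mul1r sinDpi IHn oppr0.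
Qed.

Lemma sin_intpi (z : int) : sin (z%:~R * pi) = 0 :> R.
Proof.
case: z => n; first exact: sin_natpi.
by rewrite NegzE mulrNz mulNr sinN sin_natpi oppr0.
Qed.

(** Both half periods and periods are used, hence the lower bound a. *)
Lemma Rintegral_cos_int a (z : int) : a <= pi ->
  (forall z : int, sin (z%:~R * a) = 0) ->
  \int[mu]_(t in `[a, pi]) cos (z%:~R * t) = if z == 0 then pi - a else 0.
Proof.
move=> api sa; have [->|z0] := eqVneq z 0.
  under eq_Rintegral do rewrite mul0r cos0.
  rewrite Rintegral_cst//= lebesgue_measure_itv/= lte_fin; case: ltP => api'.
    by rewrite -EFinB/= mul1r.
  by rewrite (@le_anti _ _ a pi) ?api//= subrr mulr0.
have z0' : (z%:~R : R) != 0 by rewrite intr_eq0.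
have dS (t : R) : is_derive t 1 (fun t : R => z%:~R^-1 * sin (z%:~R * t)) (cos (z%:~R * t)).
  have h := is_derive_sin_mul z%:~R t.
  by apply: is_derive_eq; rewrite /GRing.scale/=; field.
rewrite (Rintegral_primitive api dS (@continuous_cos_mul _)).
by rewrite sin_intpi sa !mulr0 subrr.
Qed.

Lemma cosM_half (x y : R) : cos x * cos y = 2^-1 * (cos (x - y) + cos (x + y)).
Proof. by rewrite cosB cosD; field. Qed.

Lemma sinM_half (x y : R) : sin x * sin y = 2^-1 * (cos (x - y) - cos (x + y)).
Proof. by rewrite cosB cosD; field. Qed.

Lemma Rintegral_cosM a (m n : nat) : a <= pi ->
  (forall z : int, sin (z%:~R * a) = 0) ->
  \int[mu]_(t in `[a, pi]) (cos (m%:R * t) * cos (n%:R * t)) =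
  if m == n then (if m == 0%N then pi - a else (pi - a) / 2) else 0.
Proof.
move=> api sa.
have E (t : R) : cos (m%:R * t) * cos (n%:R * t) = 2^-1 *
    (cos ((m%:Z - n%:Z)%:~R * t) + cos ((m%:Z + n%:Z)%:~R * t)).
  by rewrite cosM_half rmorphB rmorphD/= mulrBl mulrDl !pmulrn.
under eq_Rintegral do rewrite E.
rewrite RintegralZl//; last first.
  apply: continuous_integrable_itv => t; apply: cvgD; exact: continuous_cos_mul.
rewrite RintegralD//; [|exact/continuous_integrable_itv/continuous_cos_mul..].
rewrite !Rintegral_cos_int// subr_eq0 eqz_nat -PoszD eqz_nat addn_eq0.
by case: (eqVneq m n) => [->|mn]; case: (eqVneq n 0%N) => [n0|n0];
  rewrite ?andbb ?eqxx ?(negbTE n0) ?andbF ?andbT //=; [field|field|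
  rewrite n0 in mn; rewrite (negbTE mn) ?addr0 ?mulr0|rewrite addr0 mulr0].
Qed.

Lemma Rintegral_cosM_half (m n : nat) : (0 < m)%N ->
  \int[mu]_(t in `[0, pi]) (cos (m%:R * t) * cos (n%:R * t)) =
  if m == n then pi / 2 else 0.
Proof.
move=> m0; rewrite Rintegral_cosM ?pi_ge0// ?subr0 => [|z].
  by rewrite [m == 0%N]gtn_eqF.
by rewrite mulr0 sin0.
Qed.

Lemma Rintegral_cosM_period (m n : nat) :
  \int[mu]_(t in `[- pi, pi]) (cos (m%:R * t) * cos (n%:R * t)) =
  if m == n then (if m == 0%N then 2 * pi else pi) else 0.
Proof.
rewrite Rintegral_cosM => [||z].
- by rewrite opprK -mulr2n mulr_natl -(mulr_natl pi) mulrAC divff ?mul1r.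
- by rewrite ge0_cp ?pi_ge0.
- by rewrite mulrN sinN sin_intpi oppr0.
Qed.

End calculus.

Section torus_integration.
Variable R : realType.
Local Notation T := (measurableTypeR R).
Notation mu := (@lebesgue_measure R).
Local Notation muT := (lebesgue_tuple R).
Local Notation I := (`[- pi, pi]%classic : set T).

Lemma measurable_torus d : measurable (torus R d).
Proof.
rewrite (_ : torus R d = \bigcap_(i in [set: 'I_d]) ((fun t => tnth t i) @^-1` I)).
  apply: fin_bigcap_measurable => // i _.
  by rewrite -[X in measurable X]setTI; apply: measurable_tnth.
by apply/seteqP; split => t /= ht i; [move=> _|]; apply: ht.
Qed.

Lemma torus_cons d x (t : d.-tuple T) :
  torus R d.+1 (tuple_of_pair (x, t)) <-> I x /\ torus R d t.
Proof.
rewrite /torus/=; split=> [h|[Ix h] i].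
  by split=> [|i]; [have := h ord0|have := h (lift ord0 i); rewrite tnthS].
by case: (unliftP ord0 i) => [j ->|->]; rewrite ?tnthS//; exact: h.
Qed.

Local Open Scope ereal_scope.

Lemma ge0_integral_tupleS d (f : d.+1.-tuple T -> \bar R) :
  (forall t, 0 <= f t) -> measurable_fun setT f ->
  \int[muT d.+1]_t f t = \int[mu]_x \int[muT d]_t f (tuple_of_pair (x, t)).
Proof.
move=> f0 mf.
have mtp := @measurable_tuple_of_pair R d.
rewrite [LHS]/= /lebesgue_tuple_succ ge0_integral_pushforward//= preimage_setT.
rewrite fubini_tonelli1//; exact: measurableT_comp.
Qed.

Lemma ge0_integral_torusS d (f : d.+1.-tuple T -> \bar R) :
  (forall t, 0 <= f t) -> measurable_fun setT f ->
  \int[muT d.+1]_(t in torus R d.+1) f t =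
  \int[mu]_(x in I) \int[muT d]_(t in torus R d) f (tuple_of_pair (x, t)).
Proof.
move=> f0 mf; rewrite integral_mkcond ge0_integral_tupleS.
- rewrite [RHS]integral_mkcond; apply: eq_integral => x _.
  rewrite patchE; case: ifPn => [/set_mem Ix|Ix].
    rewrite [RHS]integral_mkcond; apply: eq_integral => t _; rewrite !patchE.
    congr (if _ then _ else _); apply/idP/idP => /set_mem; rewrite inE.
      by move=> /torus_cons[].
    by move=> ht; apply/torus_cons.
  apply: integral0_eq => t _; rewrite patchE ifF//.
  by apply/negbTE; apply: contra Ix; rewrite !inE => /torus_cons[].
- by move=> t; apply: erestrict_ge0.
- apply/(measurable_restrictT _ _).1 => //; first exact: measurable_torus.
  exact: measurable_funTS.
Qed.


Lemma integral_torusS d (f : d.+1.-tuple T -> \bar R) :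
  measurable_fun setT f -> (muT d.+1).-integrable (torus R d.+1) f ->
  \int[muT d.+1]_(t in torus R d.+1) f t =
  \int[mu]_(x in I) \int[muT d]_(t in torus R d) f (tuple_of_pair (x, t)).
Proof.
move=> mf intf; have mtp := @measurable_tuple_of_pair R d.
pose F := f \_ (torus R d.+1).
have mF : measurable_fun setT F.
  apply/(measurable_restrictT _ _).1 => //; first exact: measurable_torus.
  exact: measurable_funTS.
have iF : (mu \x muT d)%E.-integrable setT (F \o @tuple_of_pair R d).
  apply/integrable12ltyP; first exact: measurableT_comp.
  have : (muT d.+1).-integrable setT F.
    exact: ((integrable_mkcond f (@measurable_torus d.+1)).1 intf).
  move=> /integrableP[_]; rewrite (@ge0_integral_tupleS _ (fun t => `|F t|)) //.
  exact: measurableT_comp.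
rewrite integral_mkcond -/F [LHS]/= /lebesgue_tuple_succ integral_pushforward//=.
rewrite preimage_setT -integral12_prod_meas1//.
rewrite [RHS]integral_mkcond; apply: eq_integral => x _.
rewrite patchE; case: ifPn => [/set_mem Ix|Ix].
  rewrite [RHS]integral_mkcond; apply: eq_integral => t _; rewrite /F/= !patchE.
  congr (if _ then _ else _); apply/idP/idP => /set_mem; rewrite inE.
    by move=> /torus_cons[].
  by move=> ht; apply/torus_cons.
apply: integral0_eq => t _; rewrite /F/= patchE ifF//.
by apply/negbTE; apply: contra Ix; rewrite !inE => /torus_cons[].
Qed.

Local Close Scope ereal_scope.

Lemma thead_tuple_of_pair d x (t : d.-tuple T) : thead (tuple_of_pair (x, t)) = x.
Proof. by []. Qed.

Lemma behead_tuple_of_pair d x (t : d.-tuple T) :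
  [tuple of behead (tuple_of_pair (x, t))] = t.
Proof. exact: val_inj. Qed.

Section product_functions.
Variables (d : nat) (g : T -> R) (h : d.-tuple T -> R).
Hypotheses (mg : measurable_fun setT g) (mh : measurable_fun setT h).

Let gh (t : d.+1.-tuple T) : R := g (thead t) * h [tuple of behead t].

Lemma measurable_torus_prod : measurable_fun setT gh.
Proof.
apply: measurable_funM; first exact: (measurableT_comp mg (@measurable_tnth _ _ _ ord0)).
exact: (measurableT_comp mh (@measurable_behead _ T d)).
Qed.

Hypotheses (ig : mu.-integrable I (EFin \o g))
  (ih : (muT d).-integrable (torus R d) (EFin \o h)).

Let mI : measurable I. Proof. by []. Qed.
Let mtorus := measurable_torus.

Lemma integrable_torus_prod : (muT d.+1).-integrable (torus R d.+1) (EFin \o gh).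
Proof.
apply/integrableP; split.
  by apply/measurable_EFinP/measurable_funTS; exact: measurable_torus_prod.
rewrite (@ge0_integral_torusS _ (fun t => `|(gh t)%:E|%E))//; last first.
  by do 2 apply: measurableT_comp => //; exact: measurable_torus_prod.
move/integrableP : ih => [_ hoo]; move/integrableP : ig => [_ goo].
have hfin : (\int[muT d]_(t in torus R d) `|(h t)%:E| \is a fin_num)%E.
  by rewrite ge0_fin_numE// integral_ge0.
have E x : (\int[muT d]_(t in torus R d) `|(gh (tuple_of_pair (x, t)))%:E| =
    `|(g x)%:E| * \int[muT d]_(t in torus R d) `|(h t)%:E|)%E.
  rewrite -ge0_integralZl//; last 2 first.
  - exact: mtorus.
  - by apply: measurableT_comp => //; apply/measurable_EFinP/measurable_funTS.
  apply: eq_integral => t _.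
  by rewrite /gh thead_tuple_of_pair behead_tuple_of_pair EFinM abseM.
under eq_integral do rewrite E.
rewrite ge0_integralZr//.
- by rewrite lte_mul_pinfty// ?integral_ge0// ge0_fin_numE// integral_ge0.
- by apply: measurableT_comp => //; apply/measurable_EFinP/measurable_funTS.
- exact: integral_ge0.
Qed.

Lemma Rintegral_torus_prod :
  \int[muT d.+1]_(t in torus R d.+1) gh t =
  \int[mu]_(x in I) g x * \int[muT d]_(t in torus R d) h t.
Proof.
rewrite /Rintegral -fineM; [|exact: (integrable_fin_num mI ig)|
  exact: (integrable_fin_num (@mtorus d) ih)].
congr fine.
rewrite (@integral_torusS _ (EFin \o gh)); last 2 first.
- by apply/measurable_EFinP; exact: measurable_torus_prod.
- exact: integrable_torus_prod.
have E x : (\int[muT d]_(t in torus R d) (EFin \o gh) (tuple_of_pair (x, t)) =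
    (g x)%:E * \int[muT d]_(t in torus R d) (h t)%:E)%E.
  rewrite -integralZl//; last exact: mtorus.
  apply: eq_integral => t _.
  by rewrite /gh/= thead_tuple_of_pair behead_tuple_of_pair EFinM.
transitivity (\int[mu]_(x in I) ((g x)%:E * \int[muT d]_(t in torus R d) (h t)%:E))%E.
  by apply: eq_integral => x _; exact: E.
have /fineK <- := integrable_fin_num (@mtorus d) ih.
by rewrite integralZr.
Qed.

End product_functions.

End torus_integration.

Section integral_tools.
Context d (T : measurableType d) (R : realType) (mu : {measure set T -> \bar R}).
Variables (D : set T) (mD : measurable D).

Lemma integrable_sumR (n : nat) (f : 'I_n -> T -> R) :
  (forall i, mu.-integrable D (EFin \o f i)) ->
  mu.-integrable D (EFin \o (fun t => \sum_(i < n) f i t)).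
Proof.
move=> h; rewrite (_ : _ \o _ = (fun t => (\sum_(i < n) (f i t)%:E)%E)); last first.
  by apply/funext => t /=; rewrite sumEFin.
by apply: integrable_sum => // i _; exact: h.
Qed.

Lemma Rintegral_sum (n : nat) (f : 'I_n -> T -> R) :
  (forall i, mu.-integrable D (EFin \o f i)) ->
  \int[mu]_(t in D) (\sum_(i < n) f i t) = \sum_(i < n) \int[mu]_(t in D) f i t.
Proof.
elim: n f => [|n IHn] f h.
  rewrite big_ord0; under eq_Rintegral do rewrite big_ord0.
  by rewrite Rintegral_cst// mul0r.
rewrite big_ord_recl -IHn//.
under eq_Rintegral do rewrite big_ord_recl.
by rewrite RintegralD//; exact: integrable_sumR.
Qed.

Lemma integrable_bounded (f : T -> R) M : (mu D < +oo)%E ->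
  measurable_fun D f -> (forall t, D t -> `|f t| <= M) ->
  mu.-integrable D (EFin \o f).
Proof.
move=> Dfin mf fM; apply: measurable_bounded_integrable => //; exists M; split; first exact: num_real.
by move=> x /ltW Mx t Dt; exact: le_trans (fM _ Dt) Mx.
Qed.

End integral_tools.

Section torus_orthogonality.
Variable R : realType.
Local Notation T := (measurableTypeR R).
Notation mu := (@lebesgue_measure R).
Local Notation muT := (lebesgue_tuple R).
Local Notation I := (`[- pi, pi]%classic : set T).

Lemma lebesgue_torus_lty d : (muT d (torus R d) < +oo)%E.
Proof.
have mI : measurable I by [].
rewrite (_ : muT d (torus R d) = \prod_(i < d) lebesgue_measure I)%E; last first.
  exact: (@lebesgue_tuple_box R d (fun=> I) (fun=> mI)).
rewrite big_const_ord/=.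
rewrite lebesgue_measure_itv/= lte_fin; case: ifP => _; last first.
  by case: d => [|d]; rewrite ?ltry//= mul0e ltry.
rewrite -EFinB; elim: d => [|d IHd]; first by rewrite ltry.
rewrite iterS; move: IHd; set x := iter _ _ _ => xoo.
have x0 : (0 <= x)%E.
  rewrite /x; elim: d {x xoo} => [|d IHd]/=; first by rewrite lee_fin.
  by rewrite mule_ge0// lee_fin opprK addr_ge0// pi_ge0.
by rewrite lte_mul_pinfty// lee_fin opprK addr_ge0// pi_ge0.
Qed.

Lemma integrable_torus_bounded d (f : d.-tuple T -> R) M :
  measurable_fun setT f -> (forall t, `|f t| <= M) ->
  (muT d).-integrable (torus R d) (EFin \o f).
Proof.
move=> mf fM; apply: (@integrable_bounded _ _ _ _ _ (@measurable_torus R d) _ M).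
- exact: lebesgue_torus_lty.
- exact: measurable_funTS.
- by move=> t _; exact: fM.
Qed.

Lemma continuous_cos_term a : continuous (@cos_term R a).
Proof.
case: a => [|a] x; first exact: cvg_cst.
by apply: cvgM; [exact: cvg_cst|exact: continuous_cos_mul].
Qed.

Lemma continuous_cos_U i : continuous (@cos_U R i).
Proof.
suff [] : continuous (@cos_U R i) /\ continuous (@cos_U R i.+1) by [].
elim: i => [|i [IH0 IH1]]; split => //.
- by move=> x; exact: cvg_cst.
- by move=> x; apply: cvgM; [exact: cvg_cst|exact: continuous_cos].
- by move=> x; apply: cvgD; [exact: IH0|exact: (@continuous_cos_term i.+2)].
Qed.

Lemma cos_term_bound a (x : R) : `|cos_term a x| <= 2.
Proof.
case: a => [|a] /=; first by rewrite normr1 ler1n.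
by rewrite normrM ger0_norm// ler_piMr// ler_norml cos_geN1 cos_le1.
Qed.

Lemma cos_U_bound i : exists M, forall x : R, `|cos_U i x| <= M.
Proof.
suff [] : (exists M, forall x : R, `|cos_U i x| <= M) /\
          (exists M, forall x : R, `|cos_U i.+1 x| <= M) by [].
elim: i => [|i [[M0 h0] [M1 h1]]].
  split; first by exists 1 => x; rewrite normr1.
  by exists 2 => x; have := cos_term_bound 1 x; rewrite /= mul1r.
split; first by exists M1.
exists (M0 + 2) => x; apply: le_trans (ler_normD _ _) _.
by apply: lerD => //; exact: (cos_term_bound i.+2).
Qed.

Definition tbehead d (t : d.+1.-tuple T) : d.-tuple T := [tuple of behead t].

(** Measurable functions bounded on the whole space; on the torus they are
    integrable, and they are stable under products. *)
Definition tame d (f : d.-tuple T -> R) :=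
  measurable_fun setT f /\ exists M, forall t, `|f t| <= M.

Lemma tame_integrable d (f : d.-tuple T -> R) : tame f ->
  (muT d).-integrable (torus R d) (EFin \o f).
Proof. by move=> [mf [M fM]]; exact: integrable_torus_bounded fM. Qed.

Lemma tameM d (f g : d.-tuple T -> R) : tame f -> tame g ->
  tame (fun t => f t * g t).
Proof.
move=> [mf [M fM]] [mg [N gN]]; split; first exact: measurable_funM.
by exists (M * N) => t; rewrite normrM ler_pM.
Qed.

Lemma tame_sum d n (f : 'I_n -> d.-tuple T -> R) : (forall i, tame (f i)) ->
  tame (fun t => \sum_(i < n) f i t).
Proof.
move=> h; split; first by apply: measurable_sum => i; case: (h i).
have {}h i : exists M, forall t, `|f i t| <= M by case: (h i).
have [M fM] := choice h.
exists (\sum_(i < n) M i) => t; rewrite (le_trans (ler_norm_sum _ _ _))//.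
by apply: ler_sum => i _.
Qed.

Lemma tame_head d (g : R -> R) : continuous g -> (exists M, forall x, `|g x| <= M) ->
  tame (fun t : d.+1.-tuple T => g (thead t)).
Proof.
move=> cg [M gM]; split; last by exists M.
apply: (@measurableT_comp _ _ _ _ _ _ g); first exact: continuous_measurable_fun.
exact: (@measurable_tnth _ T d.+1 ord0).
Qed.

Lemma tame_tbehead d (f : d.-tuple T -> R) : tame f ->
  tame (fun t : d.+1.-tuple T => f (tbehead t)).
Proof.
move=> [mf [M fM]]; split; last by exists M.
exact: (measurableT_comp mf (@measurable_behead _ T d)).
Qed.

Lemma cos_E_tuple d n (t : d.+1.-tuple T) : cos_E t n =
  \sum_(a < n.+1) cos_term a (thead t) * cos_E (tbehead t) (n - a).
Proof. by rewrite {1}(tuple_eta t). Qed.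

Lemma cos_F_tuple d m (t : d.+2.-tuple T) : cos_F (thead t) (behead t) m =
  \sum_(i < m.+1) cos_U i (thead t)
    * cos_F (thead (tbehead t)) (behead (tbehead t)) (m - i).
Proof.
have -> : behead t = thead (tbehead t) :: behead (tbehead t).
  by rewrite -[behead t]/(tval (tbehead t)) {1}(tuple_eta (tbehead t)).
by [].
Qed.

Lemma tame_cos_E d n : tame (fun t : d.-tuple T => cos_E t n).
Proof.
elim: d n => [|d IHd] n.
  rewrite (_ : (fun _ => _) = cst (n == 0%N)%:R); last first.
    by apply/funext => t; rewrite tuple0.
  by split; [exact: measurable_cst|exists 1 => t; rewrite /cst/= ger0_norm ?lern1 ?leq_b1].
rewrite (_ : (fun _ => _) = (fun t : d.+1.-tuple T =>
  \sum_(a < n.+1) cos_term a (thead t) * cos_E (tbehead t) (n - a))); last first.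
  by apply/funext => t; exact: cos_E_tuple.
apply: tame_sum => a; apply: tameM.
  by apply: tame_head; [exact: continuous_cos_term|exists 2; exact: cos_term_bound].
exact: (tame_tbehead (IHd _)).
Qed.

Lemma tame_cos_F d m :
  tame (fun t : d.+1.-tuple T => cos_F (thead t) (behead t) m).
Proof.
elim: d m => [|d IHd] m.
  rewrite (_ : (fun _ => _) = (fun t : 1.-tuple T => cos_term m (thead t))); last first.
    by apply/funext => t; case/tupleP: t => x t; rewrite (tuple0 t).
  by apply: tame_head; [exact: continuous_cos_term|exists 2; exact: cos_term_bound].
rewrite (_ : (fun _ => _) = (fun t : d.+2.-tuple T => \sum_(i < m.+1) cos_U i (thead t)
    * cos_F (thead (tbehead t)) (behead (tbehead t)) (m - i))); last first.
  by apply/funext => t; exact: cos_F_tuple.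
apply: tame_sum => i; apply: tameM.
  by apply: tame_head; [exact: continuous_cos_U|exact: cos_U_bound].
exact: (tame_tbehead (IHd _)).
Qed.

Lemma Rintegral_cos_term a b :
  \int[mu]_(x in I) (cos_term a x * cos_term b x) =
  if a == b then 2 * pi * cos_term a 0 else 0 :> R.
Proof.
rewrite (_ : (fun x => _) = (fun x => cos_term a 0 * cos_term b 0 *
    (cos (a%:R * x) * cos (b%:R * x)))); last first.
  apply/funext => x; case: a => [|a]; case: b => [|b] //=;
  rewrite ?mul0r ?mulr0 ?cos0; ring.
rewrite RintegralZl//; last first.
  apply: continuous_integrable_itv => t; apply: cvgM; exact: continuous_cos_mul.
rewrite Rintegral_cosM_period; case: eqVneq => [<-|_]; last by rewrite mulr0.
case: a => [|a] /=; rewrite ?mulr0 ?cos0; ring.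
Qed.

(** Integration of a product of two Cauchy products over the first variable. *)
Lemma Rintegral_conv_cos d (f g : nat -> d.-tuple T -> R) m n :
  (forall i, tame (f i)) -> (forall i, tame (g i)) ->
  \int[muT d.+1]_(t in torus R d.+1)
    ((\sum_(i < m.+1) cos_term i (thead t) * f (m - i)%N (tbehead t)) *
     (\sum_(a < n.+1) cos_term a (thead t) * g (n - a)%N (tbehead t))) =
  \sum_(a < n.+1 | (a <= m)%N) 2 * pi * cos_term a 0 *
    \int[muT d]_(t in torus R d) (f (m - a)%N t * g (n - a)%N t).
Proof.
move=> tf tg; have mI : measurable I by [].
have itame i j : mu.-integrable I (EFin \o (fun x : T => cos_term i x * cos_term j x)).
  apply: continuous_integrable_itv => t; apply: cvgM; exact: continuous_cos_term.
pose H i a (t : d.+1.-tuple T) := cos_term i (thead t) * cos_term a (thead t) *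
  (f (m - i)%N (tbehead t) * g (n - a)%N (tbehead t)).
rewrite (_ : (fun t => _) = (fun t => \sum_(i < m.+1) \sum_(a < n.+1) H i a t)); last first.
  apply/funext => t; rewrite mulr_suml; apply: eq_bigr => i _.
  rewrite mulr_sumr; apply: eq_bigr => a _; rewrite /H; ring.
have mterm i : measurable_fun setT (@cos_term R i).
  by apply: continuous_measurable_fun; exact: continuous_cos_term.
have tH i a : (muT d.+1).-integrable (torus R d.+1) (EFin \o H i a).
  apply: (@integrable_torus_prod R d (fun x => cos_term i x * cos_term a x)
    (fun t => f (m - i)%N t * g (n - a)%N t)).
  - exact: (measurable_funM (mterm _) (mterm _)).
  - by case: (tameM (tf (m - i)%N) (tg (n - a)%N)).
  - exact: itame.
  - exact/tame_integrable/tameM.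
rewrite Rintegral_sum; [|exact: measurable_torus|]; last first.
  by move=> i; apply: integrable_sumR => //; exact: measurable_torus.
have E (i : 'I_m.+1) : \int[muT d.+1]_(t in torus R d.+1) (\sum_(a < n.+1) H i a t) =
    \sum_(a < n.+1) if i == a :> nat then 2 * pi * cos_term a 0 *
      \int[muT d]_(t in torus R d) (f (m - a)%N t * g (n - a)%N t) else 0.
  rewrite Rintegral_sum//; last exact: measurable_torus.
  apply: eq_bigr => a _.
  rewrite (@Rintegral_torus_prod R d (fun x => cos_term i x * cos_term a x)
    (fun t => f (m - i)%N t * g (n - a)%N t)).
  - by rewrite Rintegral_cos_term; case: eqVneq => [->|_]; rewrite ?mul0r.
  - exact: (measurable_funM (mterm _) (mterm _)).
  - by case: (tameM (tf (m - i)%N) (tg (n - a)%N)).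
  - exact: itame.
  - exact/tame_integrable/tameM.
under eq_bigr do rewrite E.
rewrite exchange_big/= [RHS]big_mkcond; apply: eq_bigr => a _.
rewrite -big_mkcond/=; case: leqP => am; last first.
  by rewrite big1// => i /eqP ia; have := ltn_ord i; rewrite ia ltnS leqNgt am.
by rewrite (big_pred1 (Ordinal (am : (a < m.+1)%N))).
Qed.

End torus_orthogonality.

Section orthogonality.
Variable R : realType.
Local Notation T := (measurableTypeR R).
Notation mu := (@lebesgue_measure R).
Local Notation muT := (lebesgue_tuple R).

(** Sums of every other term, i.e. division of a power series by 1 - r^2. *)
Fixpoint every_other_sum (g : nat -> R) (m : nat) : R :=
  if m is k.+2 then every_other_sum g k + g m else g m.

(** The coefficient of r^(m - n) in (1 - r^2)^(- d). *)
Fixpoint kap (d m n : nat) : R :=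
  if d is d'.+1 then every_other_sum (kap d' ^~ n) m else (m == n)%:R.

Lemma kap_lt d m n : (m < n)%N -> kap d m n = 0.
Proof.
elim: d m => [|d IHd] m mn /=; first by rewrite ltn_eqF.
suff [] : ((m < n)%N -> every_other_sum (kap d ^~ n) m = 0) /\
          ((m.+1 < n)%N -> every_other_sum (kap d ^~ n) m.+1 = 0) by move=> /(_ mn).
elim: m {mn} => [|m [IH0 IH1]]; first by split => ?; exact: IHd.
by split => // h; rewrite /= IH0 ?IHd ?addr0//; lia.
Qed.

Lemma kap_shift1 d m n : kap d m.+1 n.+1 = kap d m n.
Proof.
elim: d m => [//|d IHd] m.
suff [] : kap d.+1 m.+1 n.+1 = kap d.+1 m n /\ kap d.+1 m.+2 n.+1 = kap d.+1 m.+1 n by [].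
elim: m => [|m [IH0 IH1]].
  by split; rewrite /= IHd// kap_lt// add0r.
split => //.
rewrite -[LHS]/(kap d.+1 m.+1 n.+1 + kap d m.+3 n.+1) IH0 IHd.
by [].
Qed.

Lemma kap_shift d m n a : (a <= n)%N -> (a <= m)%N -> kap d (m - a) (n - a) = kap d m n.
Proof.
elim: a m n => [|a IHa] m n an am; first by rewrite !subn0.
case: m n an am => [|m] [|n]// an am.
by rewrite !subSS IHa// kap_shift1.
Qed.

Lemma pochhammerS a k : pochhammer a k.+1 = pochhammer a k * (a + k%:R) :> R.
Proof. by rewrite /pochhammer big_ord_recr. Qed.

Lemma pochhammerSl a k : pochhammer a k.+1 = a * pochhammer (a + 1) k :> R.
Proof.
rewrite /pochhammer big_ord_recl addr0; congr (_ * _).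
by apply: eq_bigr => i _; rewrite /= /bump/= natrD; ring.
Qed.

Lemma kap_even d k n : kap d (n + 2 * k) n = pochhammer d%:R k / k`!%:R.
Proof.
rewrite -(@kap_shift d (n + 2 * k) n n)// ?leq_addr// subnn addKn.
elim: d k => [|d IHd] k.
  case: k => [|k]; first by rewrite /pochhammer big_ord0 /= fact0 divr1.
  by rewrite pochhammerSl !mul0r.
elim: k => [|k IHk]; first by rewrite -[LHS]/(kap d (2 * 0) 0) IHd /pochhammer !big_ord0.
rewrite mulnS -[LHS]/(kap d.+1 (2 * k) 0 + kap d (2 * k).+2 0) IHk.
have -> : (2 * k).+2 = (2 * k.+1)%N by rewrite mulnS.
rewrite IHd (pochhammerSl d%:R) (pochhammerS d.+1%:R) factS natrM -natr1 -[k.+1%:R]natr1.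
have k0 : (k`!%:R : R) != 0 by rewrite pnatr_eq0 -lt0n fact_gt0.
have k1 : (k%:R + 1 : R) != 0 by rewrite natr1 pnatr_eq0.
by field; rewrite ?k0 ?k1.
Qed.

Lemma kap_odd d m n : (forall k, m <> n + 2 * k)%N -> kap d m n = 0.
Proof.
elim: d m => [|d IHd] m h /=.
  by case: eqVneq => // mn; case: (h 0%N); rewrite muln0 addn0.
suff [] : ((forall k, m <> n + 2 * k)%N -> every_other_sum (kap d ^~ n) m = 0) /\
    ((forall k, m.+1 <> n + 2 * k)%N -> every_other_sum (kap d ^~ n) m.+1 = 0).
  by move=> /(_ h).
elim: m {h} => [|m [IH0 IH1]]; first by split => h; exact: IHd.
split => // h; rewrite /= IHd// IH0 ?addr0// => k mk.
by apply: (h k.+1); rewrite mk; lia.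
Qed.

Lemma cos_E_zero d n : cos_E (nseq d.+1 0) n =
  \sum_(a < n.+1) cos_term a 0 * cos_E (nseq d (0 : R)) (n - a).
Proof. by []. Qed.

(** Orthogonality of the exponentials, in the form in which it is used: only the
    n-th coefficient of the product of Poisson kernels contributes. *)
Lemma Rintegral_cos_F_cos_E d m n :
  \int[muT d.+1]_(t in torus R d.+1) (cos_F (thead t) (behead t) m * cos_E t n) =
  (2 * pi) ^+ d.+1 * cos_E (nseq d.+1 (0 : R)) n * kap d m n.
Proof.
have tE d' n' := @tame_cos_E R d' n'.
pose J d m n := \int[muT d.+1]_(t in torus R d.+1)
  (cos_F (thead t) (behead t) m * cos_E t n).
elim: d m n => [|d IHd] m n.
  have conv1E x k : cos_term k x = \sum_(i < k.+1) cos_term i x * ((k - i)%N == 0%N)%:R :> R.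
    rewrite big_ord_recr/= subnn eqxx mulr1 big1 ?add0r// => i _.
    by rewrite subn_eq0 leqNgt ltn_ord mulr0.
  pose dl i (t : 0.-tuple T) : R := (i == 0%N)%:R.
  have tdl i : tame (dl i).
    by split; [exact: measurable_cst|exists 1 => t; rewrite ger0_norm ?lern1 ?leq_b1].
  rewrite (@eq_Rintegral _ _ R (muT 1) (torus R 1) (fun t : 1.-tuple T =>
    (\sum_(i < m.+1) cos_term i (thead t) * dl (m - i)%N (tbehead t)) *
    (\sum_(i < n.+1) cos_term i (thead t) * dl (n - i)%N (tbehead t)))); last first.
    move=> t _; rewrite cos_E_tuple; congr (_ * _).
      by rewrite -conv1E; case/tupleP: t => x t; rewrite (tuple0 t).
    by apply: eq_bigr => i _; rewrite (tuple0 (tbehead t)).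
  rewrite Rintegral_conv_cos// cos_E_zero expr1 mulr_sumr mulr_suml.
  rewrite big_mkcond; apply: eq_bigr => a _.
  rewrite /dl Rintegral_cst; last exact: measurable_torus.
  rewrite (_ : fine _ = 1); last first.
    rewrite (_ : torus R 0 = setT).
      by rewrite -[RHS]/(fine 1%E); congr fine; exact: diracT.
    by apply/seteqP; split => t // _ [].
  case: leqP => am.
    rewrite /= mulr1; case: (eqVneq (n - a)%N 0%N) => na; last by rewrite !mulr0 !mul0r.
    have -> : nat_of_ord a = n by move: (ltn_ord a); lia.
    case: (eqVneq m n) => [->|mn]; first by rewrite subnn !mul1r !mulr1.
    rewrite subn_eq0 [(m <= n)%N](_ : _ = false) ?mul0r ?mulr0//.
    by move: am mn (ltn_ord a); lia.
  rewrite /= [m == n]ltn_eqF ?mulr0//.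
  by move: am (ltn_ord a); lia.
have step M : \int[muT d.+2]_(t in torus R d.+2)
    (conv ((@cos_term R)^~ (thead t)) (cos_F (thead (tbehead t)) (behead (tbehead t))) M
     * cos_E t n) =
    (2 * pi) ^+ d.+2 * cos_E (nseq d.+2 (0 : R)) n * kap d M n.
  under eq_Rintegral do rewrite cos_E_tuple.
  rewrite (@Rintegral_conv_cos R d.+1 (fun i t => cos_F (thead t) (behead t) i)
    (fun i t => cos_E t i)); [|exact: tame_cos_F|exact: tE].
  rewrite cos_E_zero mulr_sumr mulr_suml big_mkcond; apply: eq_bigr => a _.
  have an : (a <= n)%N by rewrite -ltnS.
  case: leqP => aM; first by rewrite IHd kap_shift// [in RHS]exprS; ring.
  by rewrite kap_lt ?mulr0// (leq_trans aM).
have J1 k : (k < 2)%N -> J d.+1 k n =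
    (2 * pi) ^+ d.+2 * cos_E (nseq d.+2 (0 : R)) n * kap d k n.
  move=> k2; rewrite -step /J; apply: eq_Rintegral => t _; congr (_ * _).
  by rewrite cos_F_tuple; case: k k2 => [|[|]]// _;
    [exact: conv_cos_U0|exact: conv_cos_U1].
have JS k : J d.+1 k.+2 n = J d.+1 k n +
    (2 * pi) ^+ d.+2 * cos_E (nseq d.+2 (0 : R)) n * kap d k.+2 n.
  rewrite -step /J -RintegralD.
  - apply: eq_Rintegral => t _; rewrite -mulrDl; congr (_ * _).
    by rewrite !cos_F_tuple; exact: conv_cos_USS.
  - exact: measurable_torus.
  - apply/tame_integrable/tameM => //; exact: tame_cos_F.
  - apply/tame_integrable/tameM => //; apply: tame_sum => i; apply: tameM.
      by apply: tame_head; [exact: continuous_cos_term|exists 2; exact: cos_term_bound].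
    exact: (tame_tbehead (@tame_cos_F R d _)).
rewrite -/(J d.+1 m n).
suff [] : J d.+1 m n = (2 * pi) ^+ d.+2 * cos_E (nseq d.+2 (0 : R)) n * kap d.+1 m n /\
  J d.+1 m.+1 n = (2 * pi) ^+ d.+2 * cos_E (nseq d.+2 (0 : R)) n * kap d.+1 m.+1 n by [].
elim: m => [|m [IH0 IH1]]; first by split; rewrite J1.
by split => //; rewrite JS IH0 -mulrDr.
Qed.

End orthogonality.

Section l1_sums.
Variable R : realType.
Local Notation T := (measurableTypeR R).
Local Open Scope complex_scope.

Definition int_ball n : seq int := map Posz (iota 0 n.+1) ++ map Negz (iota 0 n).

Fixpoint l1_list d n : seq (d.-tuple int) :=
  if d is d'.+1 then
    [seq cons_tuple z b | z <- int_ball n, b <- l1_list d' (n - `|z|)%N]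
  else if n is 0 then [:: [tuple]] else [::].

Lemma mem_int_ball n z : (z \in int_ball n) = (`|z| <= n)%N.
Proof.
have PI : injective Posz by move=> ? ? [].
have NI : injective Negz by move=> ? ? [].
rewrite mem_cat; case: z => k.
  rewrite mem_map// mem_iota add0n ltnS leq0n/=.
  by rewrite (_ : _ \in map Negz _ = false) ?orbF//; apply/negbTE/negP => /mapP[].
rewrite (_ : _ \in map Posz _ = false); last by apply/negbTE/negP => /mapP[].
by rewrite mem_map// mem_iota add0n leq0n.
Qed.

Lemma uniq_int_ball n : uniq (int_ball n).
Proof.
rewrite cat_uniq !map_inj_uniq ?iota_uniq//; [|by move=> ? ? []|by move=> ? ? []].
by rewrite andbT/=; apply/hasPn => z /mapP[k _ ->]; apply/negP => /mapP[].
Qed.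

Lemma mem_l1_list d n (a : d.-tuple int) :
  (a \in l1_list d n) = ((\sum_(i < d) `|tnth a i|)%N == n).
Proof.
elim: d n a => [|d IHd] n a.
  by rewrite big_ord0 (tuple0 a); case: n => [|n]; rewrite /l1_list ?mem_seq1 ?eqxx.
case/tupleP: a => z b; rewrite big_ord_recl tnth0.
under eq_bigr do rewrite tnthS.
apply/idP/eqP => [/allpairsPdep[z' [b' [+ + /(congr1 val)[-> /val_inj ->]]]]|<-].
  by rewrite mem_int_ball IHd => zn /eqP ->; rewrite subnKC.
apply/allpairsPdep; exists z, b; rewrite mem_int_ball leq_addr IHd addKn.
by split => //; exact: val_inj.
Qed.

Lemma uniq_l1_list d n : uniq (l1_list d n).
Proof.
elim: d n => [|d IHd] n; first by case: n.
apply: allpairs_uniq_dep; first exact: uniq_int_ball.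
  by move=> z _; exact: IHd.
move=> [z b] [z' b'] _ _ /= /(congr1 val)[zz' /val_inj bb'].
by rewrite zz' bb'.
Qed.

Lemma perm_l1_list d n : perm_eq (fset_set (@l1_sphere d n)) (l1_list d n).
Proof.
apply: uniq_perm; [exact: fset_uniq|exact: uniq_l1_list|move=> a].
rewrite in_fset_set ?mem_l1_list; last exact: finite_l1_sphere.
by apply/idP/eqP => [/set_mem//|h]; apply/mem_set.
Qed.

Lemma expiD x y : expi (x + y) = expi x * expi y :> R[i].
Proof.
by apply/eqP; rewrite eq_complex/= cosD sinD [cos x * sin y]mulrC addrC eqxx [sin y * _ + _]addrC eqxx.
Qed.

Lemma expi_pair x : expi x + expi (- x) = (2 * cos x)%:C :> R[i].
Proof.
by apply/eqP; rewrite eq_complex/= cosN sinN subrr eqxx andbT mulr2n mulrDl mul1r.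
Qed.

Lemma sum_int_ball n x (F : nat -> R[i]) :
  \sum_(z <- int_ball n) expi (z%:~R * x) * F (n - `|z|)%N =
  \sum_(a < n.+1) (cos_term a x)%:C * F (n - a)%N.
Proof.
rewrite /int_ball big_cat !big_map -[iota 0 n.+1]/(index_iota 0 n.+1).
rewrite -[X in iota _ X](subn0 n) -/(index_iota 0 n) !big_mkord !big_ord_recl/=.
rewrite -addrA -big_split/= mul0r /expi cos0 sin0; congr (_ + _).
apply: eq_bigr => i _; rewrite -mulrDl; congr (_ * _).
by rewrite -expi_pair /bump/= add1n NegzE mulrNz mulNr.
Qed.

Lemma sum_l1_list d n (t : d.-tuple T) :
  \sum_(a <- l1_list d n) expi (\sum_(i < d) (tnth a i)%:~R * tnth t i) =
  (cos_E t n)%:C.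
Proof.
elim: d n t => [|d IHd] n t.
  rewrite (tuple0 t); case: n => [|n] /=; last by rewrite big_nil.
  by rewrite big_seq1 big_ord0 /expi cos0 sin0.
rewrite big_allpairs_dep/= cos_E_tuple rmorph_sum/=.
rewrite (eq_bigr (fun z : int => expi (z%:~R * thead t) *
    (cos_E (tbehead t) (n - `|z|)%N)%:C)) => [|z _].
  rewrite (sum_int_ball n (thead t) (fun k => (cos_E (tbehead t) k)%:C)).
  by apply: eq_bigr => a _; rewrite rmorphM.
rewrite -IHd mulr_sumr; apply: eq_bigr => b _; rewrite -expiD big_ord_recl.
congr (expi (_ + _)); apply: eq_bigr => i _; rewrite tnthS.
by rewrite {1}(tuple_eta t) tnthS.
Qed.

Lemma l1_exp_sumE d n (t : d.-tuple T) : l1_exp_sum n t = (cos_E t n)%:C.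
Proof.
rewrite /l1_exp_sum fsbig_finite; last exact: finite_l1_sphere.
by rewrite (perm_big _ (perm_l1_list d n)) sum_l1_list.
Qed.

Lemma l1_cardE d n : (l1_card d n)%:R = cos_E (nseq d (0 : R)) n :> R.
Proof.
have := sum_l1_list n [tuple of nseq d (0 : T)].
rewrite (eq_bigr (fun=> 1)) => [|a _]; last first.
  rewrite big1 ?/expi ?cos0 ?sin0// => i _.
  by rewrite tnth_nseq mulr0.
rewrite big_const_seq count_predT -(perm_size (perm_l1_list d n)).
rewrite (_ : iter _ _ _ = (l1_card d n)%:R); last first.
  by rewrite /l1_card -Monoid.iteropE.
by move=> /(congr1 (@complex.Re R)) /=; rewrite -(rmorph_nat (real_complex R)).
Qed.

Lemma cos_E_zero_gt0 d n : 0 < cos_E (nseq d.+1 (0 : R)) n.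
Proof.
have ge0 k m : 0 <= cos_E (nseq k (0 : R)) m.
  by rewrite -l1_cardE.
have E0 k : cos_E (nseq k (0 : R)) 0 = 1.
  by elim: k => //= k; rewrite conv0/= => ->; rewrite mul1r.
rewrite cos_E_zero big_ord_recr/= subnn E0 mulr1 ltr_wpDl//.
  apply: sumr_ge0 => i _; rewrite mulr_ge0//.
  by case: (nat_of_ord i) => // k; rewrite /= mulr0 cos0 mulr1.
by case: n => // k; rewrite /= mulr0 cos0 mulr1.
Qed.

End l1_sums.

Section gegenbauer_polynomials.
Variables (R : realType) (t : R).
Implicit Types (p q : {poly R}) (k n : nat).

Definition gegen_den : {poly R} := 1 - (2 * t) *: 'X + 'X * 'X.
Local Notation G := gegen_den.

(** The derivative of p / G^k is gegen_step k p / G^(k+1). *)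
Definition gegen_step k p := p^`() * G - k%:R *: (p * G^`()).

Fixpoint gegen_num n k p :=
  if n is n'.+1 then gegen_num n' k.+1 (gegen_step k p) else p.

Lemma gegen_stepD k : {morph gegen_step k : p q / p + q}.
Proof. by move=> p q; rewrite /gegen_step derivD !mulrDl scalerDr; ring. Qed.

Lemma gegen_stepZ k a p : gegen_step k (a *: p) = a *: gegen_step k p.
Proof.
by rewrite /gegen_step derivZ scalerBr -!scalerAl !scalerA [k%:R * a]mulrC.
Qed.

Lemma gegen_numD n k p q : gegen_num n k (p + q) = gegen_num n k p + gegen_num n k q.
Proof. by elim: n k p q => [|n IHn] k p q //=; rewrite gegen_stepD IHn. Qed.

Lemma gegen_numZ n k a p : gegen_num n k (a *: p) = a *: gegen_num n k p.
Proof. by elim: n k p => [|n IHn] k p //=; rewrite gegen_stepZ IHn. Qed.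

Lemma gegen_numSr n k p : gegen_num n.+1 k p = gegen_step (k + n) (gegen_num n k p).
Proof.
elim: n k p => [|n IHn] k p; first by rewrite addn0.
by rewrite -[LHS]/(gegen_num n.+1 k.+1 (gegen_step k p)) IHn addSnnS.
Qed.

Lemma gegen_stepG k p : gegen_step k.+1 (p * G) = gegen_step k p * G.
Proof.
by rewrite /gegen_step derivM -natr1 -!mul_polyC polyCD; ring.
Qed.

Lemma gegen_numG n k p : gegen_num n k.+1 (p * G) = gegen_num n k p * G.
Proof. by elim: n k p => [|n IHn] k p //=; rewrite gegen_stepG IHn. Qed.

Lemma gegen_stepX k p : gegen_step k ('X * p) = 'X * gegen_step k p + p * G.
Proof. by rewrite /gegen_step derivM derivX -!mul_polyC; ring. Qed.

Lemma gegen_den0 : G.[0] = 1.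
Proof. by rewrite !hornerE; ring. Qed.

Lemma gegen_numX0 n k p :
  (gegen_num n k ('X * p)).[0] = n%:R * (gegen_num n.-1 k p).[0].
Proof.
elim: n k p => [|n IHn] k p; first by rewrite /= hornerM hornerX !mul0r.
rewrite /= gegen_stepX gegen_numD hornerD IHn gegen_numG hornerM gegen_den0 mulr1.
case: n {IHn} => [|n]; first by rewrite mul0r add0r mul1r.
by rewrite /= -[n.+2%:R]natr1 mulrDl mul1r.
Qed.

Lemma derive_gegen n k p (f : R -> R) :
  (forall r, 0 < G.[r] -> f r = p.[r] / G.[r] ^+ k) ->
  forall r, 0 < G.[r] -> derive1n n f r = (gegen_num n k p).[r] / G.[r] ^+ (k + n).
Proof.
move=> fE; elim: n => [|n IHn] r Gr; first by rewrite addn0; exact: fE.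
rewrite derive1nS derive1E gegen_numSr.
have nearG : \forall s \near r, 0 < G.[s].
  have cG : continuous (horner G).
    by move=> s; apply: differentiable_continuous; apply/derivable1_diffP; exact: derivable_horner.
  by move/(_ r): cG => /cvgr_gt; apply.
rewrite (@near_eq_derive _ _ _ _ (fun s => (gegen_num n k p).[s] * (G.[s] ^+ (k + n))^-1)); last first.

  by apply: filterS nearG => s; exact: IHn.
set q := gegen_num n k p; set m := (k + n)%N.
have hq : is_derive r 1 (horner q) q^`().[r].
  by apply: DeriveDef; [exact: derivable_horner|rewrite -derive1E derivE].
have hG : is_derive r 1 (horner G) G^`().[r].
  by apply: DeriveDef; [exact: derivable_horner|rewrite -derive1E derivE].
have Gn0 : G.[r] ^+ m != 0 by rewrite expf_neq0// gt_eqF.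
have hGm : is_derive r 1 (fun s => G.[s] ^+ m) (m%:R * G.[r] ^+ m.-1 * G^`().[r]).
  have := @is_deriveX R R (horner G) m r 1 _ hG; rewrite /GRing.scale/=.
  by rewrite exprfctE.
have hV := @is_deriveV R (fun s => G.[s] ^+ m) r _ 1 Gn0 hGm.
have := is_deriveM hq hV; rewrite /GRing.scale/= => h.
rewrite (_ : (fun s => _) = (horner q * (fun s => (G.[s] ^+ m)^-1))%R)//.
rewrite derive_val addnS -/m.
have -> : (gegen_step m q).[r] = q^`().[r] * G.[r] - m%:R * (q.[r] * G^`().[r]).
  by rewrite /gegen_step hornerD hornerM hornerN hornerZ hornerM.
have Gr0 : G.[r] != 0 by rewrite gt_eqF.
rewrite exprS; case: m Gn0 {hGm hV h} => [|m] Gn0.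
  by rewrite !mul0r expr0; field.
have G0 : G.[r] ^+ m != 0 by rewrite expf_neq0.
rewrite !exprS !expr0 !mulr1 [m.+1.-1]/=; field.
by rewrite Gr0 G0.
Qed.

(** The Gegenbauer polynomial of index l (a natural number) and degree n at t. *)
Definition gegen l n : R := (gegen_num n l 1).[0] / n`!%:R.

Lemma gegenbauerE l n : gegenbauer l%:R n t = gegen l n.
Proof.
rewrite /gegenbauer (@derive_gegen n l 1).
- by rewrite gegen_den0 expr1n divr1.
- move=> r Gr; rewrite hornerC.
  have -> : 1 - 2 * r * t + r ^+ 2 = G.[r].
    rewrite /gegen_den hornerD hornerD hornerN hornerZ hornerM hornerC hornerX; ring.
  by rewrite powR_invn ?ltW// div1r.
- by rewrite gegen_den0.
Qed.

Definition gegen_pred l n : R := if n is k.+1 then gegen l k else 0.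

Let fact_neq0 n : n`!%:R != 0 :> R.
Proof. by rewrite pnatr_eq0 -lt0n fact_gt0. Qed.

Lemma gegen0 l : gegen l 0 = 1.
Proof. by rewrite /gegen /= hornerC divr1. Qed.

Lemma gegen_numX n l p : (gegen_num n.+1 l ('X * p)).[0] / n.+1`!%:R =
  (gegen_num n l p).[0] / n`!%:R.
Proof.
have n1 : n%:R + 1 != 0 :> R by rewrite natr1 pnatr_eq0.
have nf := fact_neq0 n.
by rewrite gegen_numX0 factS natrM; rewrite -?natr1; field; rewrite ?n1 ?nf.
Qed.

(** Multiplication of the generating function by its denominator. *)
Lemma gegen_index l n :
  gegen l.+1 n.+1 - 2 * t * gegen l.+1 n + gegen_pred l.+1 n = gegen l n.+1.
Proof.
have := gegen_numG n.+1 l 1; rewrite mul1r => /(congr1 (fun p => p.[0] / n.+1`!%:R)).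
rewrite hornerM gegen_den0 mulr1 -/(gegen l n.+1) => <-.
have -> : G = 1 + (- (2 * t)) *: ('X * 1) + 'X * 'X by rewrite mulr1 scaleNr.
rewrite !gegen_numD gegen_numZ !hornerD hornerZ !mulrDl -[_ * _.[0] / _]mulrA.
rewrite !gegen_numX -/(gegen l.+1 n.+1) -/(gegen l.+1 n) mulNr; congr (_ + _); first by ring.
case: n => [|n].
  by rewrite -['X]mulr1 gegen_numX0 !mul0r.
by rewrite -['X]mulr1 gegen_numX.
Qed.

(** Differentiation of the generating function. *)
Lemma gegen_deriv l n :
  n.+1%:R * gegen l n.+1 = 2 * l%:R * (t * gegen l.+1 n - gegen_pred l.+1 n).
Proof.
have nf := fact_neq0 n.
have n1 : n%:R + 1 != 0 :> R by rewrite natr1 pnatr_eq0.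
rewrite {1}/gegen factS natrM.
have -> : n.+1%:R * ((gegen_num n.+1 l 1).[0] / (n.+1%:R * n`!%:R)) =
    (gegen_num n l.+1 (gegen_step l 1)).[0] / n`!%:R.
  by rewrite /=; rewrite -?natr1; field; rewrite ?n1 ?nf.
have -> : gegen_step l 1 = (2 * l%:R * t) *: 1 + (- (2 * l%:R)) *: ('X * 1) :> {poly R}.
  rewrite /gegen_step /gegen_den !poly.derivE -!mul_polyC !polyCM !polyCN !polyCM; ring.
rewrite gegen_numD !gegen_numZ hornerD !hornerZ mulrDl -!mulrA -/(gegen l.+1 n).
case: n nf {n1} => [|n] nf; first by rewrite gegen_numX0 /= !mul0r; ring.
rewrite gegen_numX -/(gegen l.+1 n) /=; ring.
Qed.

Lemma gegen_contig l n : (n%:R + 2 * l%:R) * gegen l n =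
  2 * l%:R * (gegen l.+1 n - t * gegen_pred l.+1 n).
Proof.
case: n => [|n]; first by rewrite /= !gegen0; ring.
rewrite mulrDl gegen_deriv -gegen_index /=; ring.
Qed.

Lemma gegen_rec l n : n.+1%:R * gegen l.+1 n.+1 =
  2 * t * (n%:R + 1 + l%:R) * gegen l.+1 n - (n%:R + 1 + 2 * l%:R) * gegen_pred l.+1 n.
Proof.
have := gegen_deriv l n; rewrite -gegen_index -[n.+1%:R]natr1 => h.
have : forall a b c : R, a - b + c = a - b + c by [].
by lra.
Qed.

(** Raising the index by one. *)
Lemma gegen_raise l n : 4 * l%:R * (n%:R + l%:R + 1) * ((1 - t ^+ 2) * gegen l.+1 n) =
  (n%:R + 2 * l%:R) * (n%:R + 2 * l%:R + 1) * gegen l n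
  - (n%:R + 1) * (n%:R + 2) * gegen l n.+2.
Proof.
have h1 := gegen_contig l n.
have h2 := gegen_deriv l n.+1.
have h3 := gegen_rec l n.
rewrite -[n.+2%:R]natr1 -[n.+1%:R]natr1 /= in h2 h3 *.
have -> : (n%:R + 2 * l%:R) * (n%:R + 2 * l%:R + 1) * gegen l n =
  (n%:R + 2 * l%:R + 1) * (2 * l%:R * (gegen l.+1 n - t * gegen_pred l.+1 n)).
  by rewrite -h1; ring.
have -> : (n%:R + 1) * (n%:R + 2) * gegen l n.+2 =
  2 * l%:R * (t * ((n%:R + 1) * gegen l.+1 n.+1) - (n%:R + 1) * gegen l.+1 n).
  have -> : (n%:R + 1) * (n%:R + 2) * gegen l n.+2 =
     (n%:R + 1) * ((n%:R + 1 + 1) * gegen l n.+2) by ring.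
  rewrite h2; ring.
rewrite h3; ring.
Qed.

End gegenbauer_polynomials.

Section normalized_gegenbauer.
Variable R : realType.
Implicit Types (t x : R) (n l j N : nat).

Let fact_neq0 n : n`!%:R != 0 :> R.
Proof. by rewrite pnatr_eq0 -lt0n fact_gt0. Qed.

Lemma pochhammer_gt0 (a : R) n : 0 < a -> 0 < pochhammer a n.
Proof. by move=> a0; apply: prodr_gt0 => i _; rewrite ltr_wpDr. Qed.

Lemma gegen_at1 l n : gegen (1 : R) l.+1 n = pochhammer (2 * l.+1%:R) n / n`!%:R.
Proof.
suff [] : gegen (1 : R) l.+1 n = pochhammer (2 * l.+1%:R) n / n`!%:R /\
  gegen (1 : R) l.+1 n.+1 = pochhammer (2 * l.+1%:R) n.+1 / n.+1`!%:R by [].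
have S0 : gegen (1 : R) l.+1 0 = pochhammer (2 * l.+1%:R) 0 / 0`!%:R.
  by rewrite gegen0 /pochhammer big_ord0 divr1.
have nz k : k%:R + 1 != 0 :> R by rewrite natr1 pnatr_eq0.
elim: n => [|n [IH0 IH1]].
  split => //; rewrite -[LHS]mul1r (gegen_rec (1 : R) l 0) gegen0.
  rewrite pochhammerS /pochhammer big_ord0 divr1 -natr1 /=; ring.
split => //; have := gegen_rec (1 : R) l n.+1.
rewrite -[gegen_pred 1 l.+1 n.+1]/(gegen 1 l.+1 n) IH0 IH1.
rewrite (pochhammerS _ n.+1) pochhammerS [n.+2`!]factS [n.+1`!]factS !natrM -!natr1.
set P := pochhammer _ _; have nf := fact_neq0 n; have n1 := nz n.
have n2 : n%:R + 1 + 1 != 0 :> R by rewrite natr1 nz.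
move=> h; apply: (mulfI n2); rewrite h; field.
by rewrite ?n1 ?nf ?n2.
Qed.

Lemma gegen_at1_gt0 l n : 0 < gegen (1 : R) l.+1 n.
Proof.
rewrite gegen_at1 divr_gt0 ?ltr0n ?fact_gt0// pochhammer_gt0// mulr_gt0// ltr0n//.
Qed.

(** Gegenbauer polynomial normalized to take the value 1 at 1. *)
Definition gegen_nrm t l n : R := gegen t l n / gegen 1 l n.

Lemma gegen_nrm_raise t l n :
  gegen_nrm t l.+1 n - gegen_nrm t l.+1 n.+2 =
  (n%:R + l.+1%:R + 1) / (l.+1%:R + 1 / 2) * (1 - t ^+ 2) * gegen_nrm t l.+2 n.
Proof.
have h := gegen_raise t l.+1 n.
rewrite /gegen_nrm !gegen_at1 (pochhammerS _ n.+1) pochhammerS.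
have e2 : pochhammer (2 * l.+1%:R) n.+2 = 2 * l.+1%:R * (2 * l.+1%:R + 1)
    * pochhammer (2 * l.+2%:R) n :> R.
  rewrite pochhammerSl pochhammerSl mulrA; congr (_ * pochhammer _ _).
  by rewrite -[l.+2%:R]natr1; ring.
move: e2; rewrite pochhammerS pochhammerS => e2.
have P0 : pochhammer (2 * l.+1%:R) n != 0 :> R.
  by rewrite gt_eqF// pochhammer_gt0// mulr_gt0// ltr0n.
have Q0 : pochhammer (2 * l.+2%:R) n != 0 :> R.
  by rewrite gt_eqF// pochhammer_gt0// mulr_gt0// ltr0n.
have nf := fact_neq0 n.
rewrite [n.+2`!]factS [n.+1`!]factS !natrM -![n.+2%:R]natr1 -![n.+1%:R]natr1 in h e2 *.
have L : 0 < l.+1%:R :> R by rewrite ltr0n.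
have N : 0 <= n%:R :> R by [].
set P := pochhammer _ n in e2 P0 *; set Q := pochhammer _ n in e2 Q0 *.
set L1 := l.+1%:R in h e2 L *.
have eQ : Q = P * (2 * L1 + n%:R) * (2 * L1 + (n%:R + 1)) / (2 * L1 * (2 * L1 + 1)).
  by rewrite e2; field; rewrite ?gt_eqF//; lra.
have d1 : n%:R + 2 * L1 != 0 by rewrite gt_eqF//; lra.
have d2 : n%:R + 2 * L1 + 1 != 0 by rewrite gt_eqF//; lra.
have -> : gegen t l.+1 n / (P / n`!%:R) - gegen t l.+1 n.+2 /
   (P * (2 * L1 + n%:R) * (2 * L1 + (n%:R + 1)) / ((n%:R + 1 + 1) * ((n%:R + 1) * n`!%:R))) =
   n`!%:R / (P * (n%:R + 2 * L1) * (n%:R + 2 * L1 + 1)) *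
   ((n%:R + 2 * L1) * (n%:R + 2 * L1 + 1) * gegen t l.+1 n -
     (n%:R + 1) * (n%:R + 2) * gegen t l.+1 n.+2).
  field; rewrite ?P0 ?nf ?d1 ?d2 ?andbT /=.
  by rewrite !gt_eqF//; lra.
rewrite -h eQ; field.
by rewrite ?P0 ?nf ?d1 ?d2 ?andbT /= !gt_eqF//; lra.
Qed.

Lemma gegen_sin x n : sin x * gegen (cos x) 1 n = sin (n.+1%:R * x).
Proof.
have S m : gegen (cos x) 0 m.+1 = 0.
  have := gegen_deriv (cos x) 0 m; rewrite mulr0 mul0r => /eqP.
  by rewrite mulf_eq0 pnatr_eq0 => /eqP.
suff [] : sin x * gegen (cos x) 1 n = sin (n.+1%:R * x) /\
  sin x * gegen (cos x) 1 n.+1 = sin (n.+2%:R * x) by [].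
elim: n => [|n [IH0 IH1]].
  rewrite gegen0 mul1r mulr1; split => //.
  have := gegen_index (cos x) 0 0; rewrite S gegen0 /= => h.
  rewrite (_ : gegen (cos x) 1 1 = 2 * cos x); last by lra.
  by rewrite (_ : 2%:R * x = x + x) ?sinD; ring.
split => //.
have := gegen_index (cos x) 0 n.+1; rewrite S /= => h.
rewrite (_ : gegen (cos x) 1 n.+2 = 2 * cos x * gegen (cos x) 1 n.+1 - gegen (cos x) 1 n); last by lra.
rewrite mulrBr IH0 mulrCA IH1.
have -> : n.+3%:R * x = n.+2%:R * x + x by rewrite -[n.+3%:R]natr1; ring.
have -> : n.+1%:R * x = n.+2%:R * x - x by rewrite -[n.+2%:R]natr1; ring.
by rewrite sinB sinD; ring.
Qed.

(** The Fourier cosine coefficient of index N of (cos t - cos x)_+^j / j!, as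
    obtained from j integrations by parts. *)
Fixpoint tpower_coef j N x : R :=
  if j is i.+1 then (tpower_coef i N.-1 x - tpower_coef i N.+1 x) / (2 * N%:R)
  else sin (N%:R * x) / (N%:R * pi).

Lemma tpower_coefE j m x : 2 ^+ j.+1 * tpower_coef j (m + j.+1) x =
  (pi * pochhammer (1 / 2) j.+1)^-1 * sin x ^+ (2 * j).+1 * gegen_nrm (cos x) j.+1 m.
Proof.
have pi0 : pi != 0 :> R by rewrite gt_eqF// pi_gt0.
elim: j m => [|j IHj] m.
  rewrite addn1 expr1 muln0 expr1 /gegen_nrm /pochhammer big_ord1 addr0.
  rewrite /tpower_coef -gegen_sin gegen_at1.
  rewrite (_ : pochhammer _ m = m.+1`!%:R); last first.
    elim: m => [|m IHm]; first by rewrite /pochhammer big_ord0.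
    by rewrite pochhammerS IHm [m.+2`!]factS natrM -[m.+2%:R]natr1 -[m.+1%:R]natr1; ring.
  rewrite factS natrM; have mf := fact_neq0 m.
  have m1 : 1 + m%:R != 0 :> R by rewrite nat1r pnatr_eq0.
  move: (pi : R) pi0 => p p0.
  by field; rewrite ?mf ?p0 ?m1.
have r := gegen_nrm_raise (cos x) j m.
have A := IHj m; have B := IHj m.+2.
rewrite -[LHS]/(2 ^+ j.+2 * ((tpower_coef j (m + j.+2).-1 x -
   tpower_coef j (m + j.+2).+1 x) / (2 * (m + j.+2)%:R))).
rewrite (_ : (m + j.+2).-1 = m + j.+1)%N; last by rewrite !addnS.
rewrite (_ : (m + j.+2).+1 = m.+2 + j.+1)%N; last by rewrite !addnS !addSn.
have q0 : pochhammer (1 / 2) j.+1 != 0 :> R by rewrite gt_eqF// pochhammer_gt0// divr_gt0.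
have mj : m%:R + j.+1%:R + 1 != 0 :> R by rewrite -natrD natr1 pnatr_eq0.
have jh : j.+1%:R + 1 / 2 != 0 :> R.
  by rewrite gt_eqF// ltr_wpDl// divr_gt0.
have -> : (m + j.+2)%:R = m%:R + j.+1%:R + 1 :> R by rewrite addnS -natr1 natrD.
have -> : 2 ^+ j.+2 * ((tpower_coef j (m + j.+1) x - tpower_coef j (m.+2 + j.+1) x)
    / (2 * (m%:R + j.+1%:R + 1))) = (2 ^+ j.+1 * tpower_coef j (m + j.+1) x -
   2 ^+ j.+1 * tpower_coef j (m.+2 + j.+1) x) / (m%:R + j.+1%:R + 1).
  by rewrite [2 ^+ j.+2]exprS; field.
rewrite A B -mulrBr r (pochhammerS _ j.+1).
have -> : (2 * j.+1).+1 = ((2 * j).+1 + 2)%N by lia.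
rewrite exprD -[sin x ^+ 2](_ : 1 - cos x ^+ 2 = _); last by rewrite sin2cos2.
move: {r A B IHj} (pi : R) pi0 (j.+1%:R : R) mj jh => p p0 J mj jh.
have jh' : 1 + J * 2 != 0.
  by rewrite (_ : 1 + J * 2 = 2 * (J + 1 / 2)) ?mulf_neq0//; field.
by field; rewrite p0 q0 mj jh'.
Qed.

Lemma tpower_coef_bound j N x : (j < N)%N ->
  `|tpower_coef j N x| <= ((N - j)%:R ^+ j.+1)^-1.
Proof.
elim: j N => [|j IHj] N jN.
  have N0 : 0 < N%:R :> R by rewrite ltr0n.
  rewrite subn0 expr1 /= normrM normrV ?unitfE ?gt_eqF ?mulr_gt0 ?pi_gt0//.
  rewrite (@gtr0_norm _ (N%:R * pi)) ?mulr_gt0 ?pi_gt0// invfM mulrA -[leRHS]mulr1.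
  apply: ler_pM; rewrite ?invr_ge0 ?pi_ge0 ?divr_ge0//.
    by rewrite ler_piMl ?invr_ge0// ler_norml sin_geN1 sin_le1.
  by rewrite invf_le1 ?pi_gt0// (le_trans _ (pi_ge2 R))// ler1n.
have N0 : 0 < N%:R :> R by rewrite ltr0n (leq_ltn_trans _ jN).
rewrite [leLHS]/= normrM normrV ?unitfE ?gt_eqF ?mulr_gt0//.
rewrite (@gtr0_norm _ (2 * _)) ?mulr_gt0// ler_pdivrMr ?mulr_gt0//.
have jN1 : (j < N.-1)%N by lia.
have jN2 : (j < N.+1)%N by lia.
have h1 := IHj _ jN1; have h2 := IHj _ jN2.
set M := (N - j.+1)%N; have M0 : (0 < M)%N by rewrite subn_gt0.
have M0' : 0 < M%:R :> R by rewrite ltr0n.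
have e1 : ((N.-1 - j)%:R ^+ j.+1)^-1 = (M%:R ^+ j.+1)^-1 :> R.
  by congr ((_ %:R ^+ _)^-1); rewrite /M; lia.
have e2 : ((N.+1 - j)%:R ^+ j.+1)^-1 <= (M%:R ^+ j.+1)^-1 :> R.
  rewrite lef_pV2 ?posrE ?exprn_gt0 ?ltr0n//; last by rewrite subn_gt0.
  by rewrite lerXn2r ?nnegrE// ler_nat /M; lia.
apply: (le_trans (ler_normB _ _)).
apply: (@le_trans _ _ ((M%:R ^+ j.+1)^-1 *+ 2)).
  by rewrite mulr2n lerD// ?(le_trans h2)// (le_trans h1)// e1.
have -> : (M%:R ^+ j.+2)^-1 * (2 * N%:R) = 2 * (M%:R ^+ j.+1)^-1 * (N%:R / M%:R) :> R.
  by rewrite [M%:R ^+ j.+2]exprS invfM; ring.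
rewrite -[leLHS]mulr_natl ler_peMr//.
by rewrite ler_pdivlMr// mul1r ler_nat; exact: leq_subr.
Qed.

End normalized_gegenbauer.

Section uniform_approximation.
Variable R : realType.

Lemma continuous_uniform_approx (f : R -> R) :
  (forall e, 0 < e -> exists2 g : R -> R, continuous g & forall x, `|f x - g x| <= e) ->
  continuous f.
Proof.
move=> h x; apply/cvgrPdist_le => e e0.
have e3 : 0 < e / 3 by rewrite divr_gt0.
have [g cg fg] := h _ e3.
have /cvgrPdist_le /(_ _ e3) := cg x.
apply: filterS => y gxy.
rewrite (_ : f x - f y = (f x - g x) + (g x - g y) - (f y - g y)); last by ring.
rewrite (le_trans (ler_normB _ _))// (le_trans (lerD (ler_normD _ _) (fg y)))//.
rewrite (le_trans (lerD (lerD (fg x) gxy) (lexx _)))//.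
by rewrite -!mulrDl -{1 2 3}[e]mulr1 -!mulrDr; lra.
Qed.

Lemma exists_inv_le (c e : R) : 0 < e -> exists K : nat, c / K.+1%:R <= e.
Proof.
move=> e0; exists (Num.trunc (c / e)).
by rewrite ler_pdivrMr ?ltr0n// -ler_pdivrMl// mulrC ltW// Num.Theory.truncnS_gt.
Qed.

End uniform_approximation.

Section tpower_coef_calculus.
Variable R : realType.
Notation mu := (@lebesgue_measure R).
Implicit Types (j N M n : nat) (x : R) (p q : {poly R}).

Lemma is_derive_continuous (f : R -> R) (df : R -> R) :
  (forall x : R, is_derive x 1 f (df x)) -> continuous f.
Proof.
by move=> h x; apply: differentiable_continuous; apply/derivable1_diffP; case: (h x).
Qed.

Lemma is_derive_tpower_coef0 N x : (0 < N)%N ->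
  is_derive x 1 (@tpower_coef R 0 N) (cos (N%:R * x) / pi).
Proof.
move=> N0; have N0' : N%:R != 0 :> R by rewrite pnatr_eq0 -lt0n.
have pi0 : pi != 0 :> R by rewrite gt_eqF// pi_gt0.
have h := is_derive_sin_mul N%:R x.
rewrite (_ : tpower_coef 0 N = (fun t => (N%:R * pi)^-1 * sin (N%:R * t))); last first.
  by apply/funext => t; rewrite /= mulrC.
apply: is_derive_eq; rewrite /GRing.scale/=.
by move: (pi : R) pi0 => p p0; field; rewrite N0' p0.
Qed.

Lemma is_derive_tpower_coefS j N x : (j.+1 < N)%N ->
  is_derive x 1 (@tpower_coef R j.+1 N) (sin x * tpower_coef j N x).
Proof.
elim: j N => [|j IHj] N jN.
  have h1 := @is_derive_tpower_coef0 N.-1 x.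
  have h2 := @is_derive_tpower_coef0 N.+1 x.
  have {}h1 := h1 ltac:(lia); have {}h2 := h2 isT.
  have N0 : N%:R != 0 :> R by rewrite pnatr_eq0 -lt0n; lia.
  have pi0 : pi != 0 :> R by rewrite gt_eqF// pi_gt0.
  rewrite (_ : tpower_coef 1 N = (fun t => (2 * N%:R)^-1 *
    (tpower_coef 0 N.-1 t - tpower_coef 0 N.+1 t))); last first.
    by apply/funext => t; rewrite [LHS]mulrC.
  apply: is_derive_eq; rewrite /GRing.scale [RHS]/=.
  have -> : N.-1%:R * x = N%:R * x - x.
    by rewrite -[in RHS](prednK (ltnW jN)) -[N.-1.+1%:R]natr1; ring.
  have -> : N.+1%:R * x = N%:R * x + x by rewrite -natr1; ring.
  rewrite cosB cosD.
  rewrite -[LHS]/((2 * N%:R)^-1 * (_ - _)).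
  by move: (pi : R) pi0 => p p0; field; rewrite N0 p0.
have {}h1 := IHj N.-1 ltac:(lia); have {}h2 := IHj N.+1 ltac:(lia).
rewrite (_ : tpower_coef j.+2 N = (fun t => (2 * N%:R)^-1 *
    (tpower_coef j.+1 N.-1 t - tpower_coef j.+1 N.+1 t))); last first.
  by apply/funext => t; rewrite [LHS]mulrC.
apply: is_derive_eq; rewrite -[LHS]/((2 * N%:R)^-1 * (_ - _)) [RHS]/=; ring.
Qed.

Lemma continuous_tpower_coef j N : (j < N)%N -> continuous (@tpower_coef R j N).
Proof.
case: j => [|j] jN.
  apply: (@is_derive_continuous _ (fun x => cos (N%:R * x) / pi)) => x.
  exact: is_derive_tpower_coef0.
apply: (@is_derive_continuous _ (fun x => sin x * tpower_coef j N x)) => x.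
exact: is_derive_tpower_coefS.
Qed.

Lemma tpower_coef_0 j N : tpower_coef j N (0 : R) = 0.
Proof.
by elim: j N => [|j IHj] N /=; rewrite ?mulr0 ?sin0 ?IHj ?subrr mul0r.
Qed.

Lemma tpower_coef_pi j N : tpower_coef j N (pi : R) = 0.
Proof. by elim: j N => [|j IHj] N /=; rewrite ?sin_natpi ?IHj ?subrr mul0r. Qed.

Lemma is_derive_horner_cos p x :
  is_derive x 1 (fun t : R => p.[cos t]) (- sin x * p^`().[cos x]).
Proof.
have hp : is_derive (cos x) 1 (horner p) p^`().[cos x].
  by apply: DeriveDef; [exact: derivable_horner|rewrite -derive1E derivE].
have := @is_derive1_comp R _ _ _ _ _ hp (is_derive_cos x).
by rewrite mulrC.
Qed.

Lemma continuous_horner_cos p : continuous (fun t : R => p.[cos t]).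
Proof.
apply: (@is_derive_continuous _ (fun x => - sin x * p^`().[cos x])) => x.
exact: is_derive_horner_cos.
Qed.

(** Integration by parts against a polynomial in cos t. *)
Lemma tpower_coef_parts (f g : R -> R) p :
  (forall x : R, is_derive x 1 f (g x)) -> continuous g -> f 0 = 0 -> f pi = 0 ->
  \int[mu]_(t in `[0, pi]) (f t * p^`().[cos t] * sin t) =
  \int[mu]_(t in `[0, pi]) (g t * p.[cos t]).
Proof.
move=> dfg cg f0 fpi; have cf := is_derive_continuous dfg.
have c1 : continuous (fun t => g t * p.[cos t]).
  by move=> t; apply: cvgM; [exact: cg|exact: continuous_horner_cos].
have c2 : continuous (fun t => f t * p^`().[cos t] * sin t).
  move=> t; apply: cvgM; last exact: continuous_sin.
  by apply: cvgM; [exact: cf|exact: continuous_horner_cos].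
have dF (x : R) : is_derive x 1 (fun t => f t * p.[cos t])
    (g x * p.[cos x] - f x * p^`().[cos x] * sin x).
  have h1 := dfg x; have h2 := is_derive_horner_cos p x.
  have h := is_deriveM h1 h2.
  by apply: is_derive_eq; rewrite /GRing.scale/=; ring.
have := Rintegral_primitive (pi_ge0 R) dF.
rewrite f0 fpi !mul0r subrr RintegralB//; [|exact: continuous_integrable_itv..].
move=> h; apply/esym/eqP; rewrite -subr_eq0; apply/eqP/h.
by move=> t; apply: cvgB; [exact: c1|exact: c2].
Qed.

Lemma tpower_coef_moment j N p : (j < N)%N ->
  \int[mu]_(t in `[0, pi]) (tpower_coef j N t * p^`(j.+1).[cos t] * sin t) =
  pi^-1 * \int[mu]_(t in `[0, pi]) (cos (N%:R * t) * p.[cos t]).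
Proof.
elim: j N => [|j IHj] N jN.
  have cg : continuous (fun t : R => cos (N%:R * t) / pi).
    by move=> t; apply: cvgMl; exact: continuous_cos_mul.
  rewrite derivn1 (tpower_coef_parts p (fun x => is_derive_tpower_coef0 x jN) cg
    (tpower_coef_0 0 N) (tpower_coef_pi 0 N)).
  under eq_Rintegral do rewrite mulrAC mulrC.
  rewrite RintegralZl//; apply: continuous_integrable_itv => t.
  by apply: cvgM; [exact: continuous_cos_mul|exact: continuous_horner_cos].
have cg : continuous (fun t : R => sin t * tpower_coef j N t).
  move=> t; apply: cvgM; first exact: continuous_sin.
  by apply: continuous_tpower_coef; exact: ltnW.
rewrite -IHj ?(ltnW jN)// derivnS.
rewrite (tpower_coef_parts _ (fun x => is_derive_tpower_coefS x jN) cg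
  (tpower_coef_0 _ N) (tpower_coef_pi _ N)).
by apply: eq_Rintegral => t _; ring.
Qed.

Lemma tpower_coef_chebT j N M : (j < N)%N ->
  \int[mu]_(t in `[0, pi])
    (tpower_coef j N t * (chebT R M)^`(j.+1).[cos t] * sin t) =
  if N == M then 1 / 2 else 0.
Proof.
move=> jN; rewrite tpower_coef_moment//.
under eq_Rintegral do rewrite chebT_cos.
rewrite Rintegral_cosM_half; last by rewrite (leq_ltn_trans _ jN).
case: ifP => _; last by rewrite mulr0.
have pi0 : pi != 0 :> R by rewrite gt_eqF// pi_gt0.
by move: (pi : R) pi0 => p p0; field.
Qed.

End tpower_coef_calculus.

Section gegenbauer_series.
Variable R : realType.
Variables (i n : nat).
Implicit Types (k K L : nat) (x : R).

Definition binom_coef k : R := pochhammer i.+2%:R k / k`!%:R.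

Definition tseries_term x k : R :=
  binom_coef k * tpower_coef i.+1 (n + 2 * k + i.+2) x.

Let N k : R := (n + 2 * k + i.+2)%:R.
Let a k : R := binom_coef k / (2 * N k).
Let b k x : R := tpower_coef i (n + 2 * k + i.+1) x.

Let N_gt0 k : 0 < N k.
Proof. by rewrite /N addnS ltr0n. Qed.

Let termE x k : tseries_term x k = a k * (b k x - b k.+1 x).
Proof.
rewrite /tseries_term /a /b -[tpower_coef i.+1 _ x]/((tpower_coef i (n + 2 * k + i.+2).-1 x -
  tpower_coef i (n + 2 * k + i.+2).+1 x) / (2 * N k)).
rewrite (_ : (n + 2 * k + i.+2).-1 = n + 2 * k + i.+1)%N; last by lia.
rewrite (_ : (n + 2 * k + i.+2).+1 = n + 2 * k.+1 + i.+1)%N; last by lia.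
by ring.
Qed.

Lemma pochhammer_fact_le j k : pochhammer j.+1%:R k / k`!%:R <= k.+1%:R ^+ j :> R.
Proof.
elim: j => [|j IHj].
  rewrite expr0 (_ : pochhammer 1%:R k = k`!%:R) ?divff ?pnatr_eq0 -?lt0n ?fact_gt0//.
  elim: k => [|k IHk]; first by rewrite /pochhammer big_ord0.
  by rewrite pochhammerS IHk factS natrM mulrC -natrD add1n.
have E : pochhammer j.+2%:R k = pochhammer j.+1%:R k * ((j.+1 + k)%:R / j.+1%:R) :> R.
  have j0 : j.+1%:R != 0 :> R by rewrite pnatr_eq0.
  apply: (mulfI j0); rewrite -[j.+2%:R]natr1 -pochhammerSl pochhammerS -natrD.
  by rewrite mulrCA [_ * (_ / _)]mulrC divfK.
rewrite E exprSr mulrAC ler_pM ?divr_ge0//.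
  by apply: prodr_ge0 => l _; rewrite addr_ge0.
by rewrite ler_pdivrMr ?ltr0n// -natrM ler_nat; nia.
Qed.

Let a_ge0 k : 0 <= a k.
Proof.
rewrite /a /binom_coef !mulr_ge0 ?invr_ge0 ?mulr_ge0 ?(ltW (N_gt0 k))//.
by apply: prodr_ge0 => l _; rewrite addr_ge0.
Qed.

Let a_le k : a k <= k.+1%:R ^+ i.
Proof.
rewrite /a ler_pdivrMr ?mulr_gt0// (le_trans (pochhammer_fact_le _ _))//.
rewrite exprSr ler_wpM2l ?exprn_ge0// /N -natrM ler_nat; lia.
Qed.

Let a_diff k : `|a k.+1 - a k| <= a k * (i.+1%:R / k.+1%:R).
Proof.
have k0 : 0 < k.+1%:R :> R by rewrite ltr0n.
have N0 := N_gt0 k.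
have NS : N k.+1 = N k + 2 by rewrite /N -natrD; congr (_%:R); lia.
have Nk : 2 * k.+1%:R <= N k by rewrite /N -natrM ler_nat; lia.
have i0 : 1 <= i.+1%:R :> R by rewrite ler1n.
have f0 : k`!%:R != 0 :> R by rewrite pnatr_eq0 -lt0n fact_gt0.
have -> : a k.+1 - a k = a k *
    ((i.+1%:R * N k - 2 * k.+1%:R) / (k.+1%:R * (N k + 2))).
  rewrite /a /binom_coef pochhammerS NS factS natrM.
  have -> : i.+2%:R + k%:R = i.+1%:R + k.+1%:R :> R by rewrite -!natrD; congr (_%:R); lia.
  move: (k.+1%:R : R) (i.+1%:R : R) k0 => K I K0.
  field; rewrite f0 ?gt_eqF//; lra.
rewrite normrM (ger0_norm (a_ge0 k)) ler_wpM2l ?a_ge0// ger0_norm; last first.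
  apply: divr_ge0; last by rewrite mulr_ge0 ?addr_ge0 ?(ltW N0) ?(ltW k0).
  rewrite subr_ge0 (le_trans Nk)//.
  by rewrite ler_peMl// ltW.
rewrite invfM [k.+1%:R^-1 * _]mulrC mulrA ler_pM2r ?invr_gt0// ler_pdivrMr; last lra.
by rewrite mulrDr; lra.
Qed.

Let b_le k x : `|b k x| <= (k.+1%:R ^+ i.+1)^-1.
Proof.
rewrite (le_trans (tpower_coef_bound _ _))//; first by lia.
rewrite lef_pV2 ?posrE ?exprn_gt0 ?ltr0n//; last by lia.
by rewrite lerXn2r ?nnegrE// ler_nat; lia.
Qed.

Let ab_le k x : `|a k * b k x| <= k.+1%:R^-1.
Proof.
have k0 : 0 < k.+1%:R :> R by rewrite ltr0n.
rewrite normrM (ger0_norm (a_ge0 k)).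
rewrite (le_trans (ler_pM (a_ge0 k) (normr_ge0 _) (a_le k) (b_le k x)))//.
by rewrite exprS invfM mulrCA divff ?mulr1// expf_neq0// gt_eqF.
Qed.

Let dab_le k x : `|(a k.+1 - a k) * b k.+1 x| <= i.+1%:R * (k.+1%:R^-1 - k.+2%:R^-1).
Proof.
have k0 : 0 < k.+1%:R :> R by rewrite ltr0n.
have k1 : 0 < k.+2%:R :> R by rewrite ltr0n.
have e : k.+1%:R^-1 - k.+2%:R^-1 = k.+1%:R^-1 * k.+2%:R^-1 :> R.
  by move: k0 k1; rewrite -[k.+2%:R]natr1; move: (k.+1%:R : R) => K K0 K1; field; rewrite !gt_eqF//; lra.
rewrite normrM e; apply: (@le_trans _ _ (k.+2%:R ^+ i * (i.+1%:R / k.+1%:R) * (k.+2%:R ^+ i.+1)^-1)).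
  rewrite ler_pM// (le_trans (a_diff k))// ler_wpM2r ?divr_ge0//.
  by rewrite (le_trans (a_le k))// lerXn2r ?nnegrE// ler_nat.
rewrite exprS invfM le_eqVlt; apply/orP; left; apply/eqP.
have z : k.+2%:R ^+ i != 0 :> R by rewrite expf_neq0// gt_eqF.
by move: (k.+2%:R ^+ i : R) z => z z0; field; rewrite z0 !gt_eqF.
Qed.

(** One summation by parts makes the series absolutely convergent, uniformly in x. *)
Lemma tseries_cauchy x K L : (K <= L)%N ->
  `|series (tseries_term x) L - series (tseries_term x) K| <= i.+3%:R / K.+1%:R.
Proof.
move=> KL.
have E M : series (tseries_term x) M = a 0%N * b 0%N x - a M * b M x +
    \sum_(0 <= k < M) (a k.+1 - a k) * b k.+1 x.
  elim: M => [|M IHM]; first by rewrite /series/= !big_geq// subrr addr0.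
  rewrite /series/= !big_nat_recr//= -[X in X + _]/(series _ M) IHM termE; ring.
rewrite !E (big_cat_nat (n := K))//=.
set s := \sum_(0 <= k < K) _; set r := \sum_(K <= k < L) _.
rewrite (_ : _ - _ = (a K * b K x - a L * b L x) + r); last by ring.
rewrite (le_trans (ler_normD _ _))// (le_trans (lerD (ler_normB _ _) (lexx _)))//.
have rle : `|r| <= i.+1%:R * (K.+1%:R^-1 - L.+1%:R^-1).
  rewrite /r (le_trans (ler_norm_sum _ _ _))//.
  rewrite (le_trans (ler_sum _ (fun k _ => dab_le k x)))//.
  rewrite -mulr_sumr ler_wpM2l//.
  rewrite (@telescope_sumr_eq _ K L (fun k => - k.+1%:R^-1))//.
    by rewrite opprK addrC.
  by move=> k _; rewrite opprK addrC.
have KL' : L.+1%:R^-1 <= K.+1%:R^-1 :> R by rewrite lef_pV2 ?posrE ?ltr0n// ler_nat.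
have := ab_le K x; have := ab_le L x.
have L0 : 0 < L.+1%:R^-1 :> R by rewrite invr_gt0 ltr0n.
have i0 : 0 <= i.+1%:R :> R by [].
have : i.+1%:R * (K.+1%:R^-1 - L.+1%:R^-1) <= i.+1%:R * K.+1%:R^-1 :> R.
  by rewrite ler_wpM2l// gerBl ltW.
have -> : i.+3%:R = i.+1%:R + 2 :> R by rewrite -natrD addn2.
move=> ri aL aK; rewrite mulrDl addrC lerD// ?(le_trans rle)//.
by rewrite mulr_natl mulr2n lerD// (le_trans aL).
Qed.

Lemma cvg_tseries x : cvgn (series (tseries_term x)).
Proof.
apply/cauchy_cvgP/cauchy_exP => e e0.
have [K Ke] := exists_inv_le i.+3%:R (divr_gt0 e0 (ltr0n R 2)).
exists (series (tseries_term x) K); exists K => // L /= KL.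
rewrite -ball_normE /ball_/= distrC (le_lt_trans (tseries_cauchy _ KL))//.
by rewrite (le_lt_trans Ke)// ltr_pdivrMr// ltr_pMr // ltr1n.
Qed.

Definition tseries x : R := limn (series (tseries_term x)).

Lemma tseries_dist x K : `|tseries x - series (tseries_term x) K| <= i.+3%:R / K.+1%:R.
Proof.
have h : `|series (tseries_term x) L - series (tseries_term x) K| @[L --> \oo]
    --> `|tseries x - series (tseries_term x) K|.
  by apply: cvg_norm; apply: cvgB; [exact: cvg_tseries|exact: cvg_cst].
rewrite -(cvg_lim _ h)//; apply: limr_le; first by apply/cvg_ex; eexists; exact: h.
by exists K => // L /= KL; exact: tseries_cauchy.
Qed.

Lemma continuous_series_tseries K : continuous (fun x => series (tseries_term x) K).
Proof.
elim: K => [|K IHK].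
  rewrite (_ : (fun x => _) = cst 0); first by move=> x; exact: cvg_cst.
  by apply/funext => x; rewrite /series/= big_geq.
rewrite (_ : (fun x => _) = (fun x => series (tseries_term x) K + tseries_term x K)); last first.
  by apply/funext => x; rewrite /series/= big_nat_recr.
move=> x; apply: cvgD; first exact: IHK.
by apply: cvgMr; apply: continuous_tpower_coef; lia.
Qed.

Lemma continuous_tseries : continuous tseries.
Proof.
apply: continuous_uniform_approx => e e0.
have [K Ke] := exists_inv_le i.+3%:R e0.
exists (fun x => series (tseries_term x) K); first exact: continuous_series_tseries.
by move=> x; rewrite (le_trans (tseries_dist _ _)).
Qed.

End gegenbauer_series.

Section knots_measurability.
Variable R : realType.
Local Notation T := (measurableTypeR R).

Lemma measurable_invr : measurable_fun [set: R] (@GRing.inv R).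
Proof.
have m0 : measurable ([set 0] : set R) by exact: measurable_set1.
have -> : [set: R] = [set 0] `|` ~` [set 0] by rewrite setUv.
apply/measurable_funU => //; first exact: measurableC.
split; first exact: measurable_fun_set1.
apply: open_continuous_measurable_fun.
  by apply: closed_openC; apply: compact_closed; [exact: Rhausdorff|exact: compact_set1].
by move=> x; rewrite inE/= => /eqP x0; exact: inv_continuous.
Qed.

Lemma measurable_divided_difference d (W : measurableType d) m (x : nat -> W -> R)
    (g : W -> R -> R) :
  (forall i, measurable_fun setT (x i)) ->
  (forall i, measurable_fun setT (fun w => g w (x i w))) ->
  measurable_fun setT (fun w => divided_difference m (x^~ w) (g w)).
Proof.
elim: m x => [|m IHm] x mx mg; first exact: mg.
apply: measurable_funM.
  apply: measurable_funB; first exact: IHm.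
  by apply: (IHm (fun i => x i.+1)) => i.
apply: (measurableT_comp measurable_invr).
exact: measurable_funB.
Qed.

Lemma scaled_tpower_max k (u t : R) :
  scaled_tpower k.+1 u t = Num.max 0 (t - u) ^+ k.+1 / (k.+1)`!%:R.
Proof.
rewrite /scaled_tpower /truncated_power; case: ltP => // tu.
by rewrite expr0n.
Qed.

Lemma continuous_scaled_tpower k t : continuous (fun u : R => scaled_tpower k.+1 u t).
Proof.
rewrite (_ : (fun u => _) = (fun u : R => Num.max 0 (t - u) ^+ k.+1 / (k.+1)`!%:R)); last first.
  by apply/funext => u; exact: scaled_tpower_max.
move=> u; apply: cvgMl.
apply: (@continuous_comp _ _ _ (fun u : R => Num.max 0 (t - u)) (fun v => v ^+ k.+1)); last first.
  exact: exprn_continuous.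
rewrite (_ : (fun u => _) = (fun u : R => (0 + (t - u) + `|0 - (t - u)|) / 2)); last first.
  by apply/funext => v; exact: maxr_absE.
have cB : {for u, continuous (fun u : R => t - u)}.
  by apply: cvgB; [exact: cvg_cst|exact: cvg_id].
apply: cvgMl; apply: cvgD; first by apply: cvgD; [exact: cvg_cst|exact: cB].
by apply: cvg_norm; apply: cvgB; [exact: cvg_cst|exact: cB].
Qed.

Lemma continuous_divided_difference m (x : nat -> R) (g : R -> R -> R) :
  (forall t, continuous (g^~ t)) ->
  continuous (fun u => divided_difference m x (g u)).
Proof.
move=> cg; elim: m x => [|m IHm] x u; first exact: cg.
by apply: cvgMl; apply: cvgB; exact: IHm.
Qed.

Lemma measurable_cos : measurable_fun [set: T] (@cos R : T -> R).
Proof. exact: (continuous_measurable_fun (@continuous_cos R)). Qed.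

Lemma measurable_knot d i : measurable_fun setT (fun t : d.-tuple T => cos (nth 0 t i)).
Proof.
apply: (measurableT_comp measurable_cos).
have [id|di] := ltnP i d.
  rewrite (_ : (fun t => _) = (fun t : d.-tuple T => tnth t (Ordinal id))).
    exact: measurable_tnth.
  by apply/funext => t; rewrite (tnth_nth 0).
rewrite (_ : (fun t => _) = cst 0); first exact: measurable_cst.
by apply/funext => t; rewrite nth_default// size_tuple.
Qed.

(** The B-spline at cos x with knots cos t_i. *)
Definition torus_bspline d (x : R) (t : d.-tuple T) : R :=
  bspline d.-1 (cos x) (fun i => cos (nth 0 t i)).

Lemma measurable_torus_bspline d :
  measurable_fun setT (fun z : T * d.+3.-tuple T => torus_bspline z.1 z.2).
Proof.
pose x i (z : T * d.+3.-tuple T) : R := cos (nth 0 z.2 i).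
have mx i : measurable_fun setT (x i).
  exact: (measurableT_comp (@measurable_knot d.+3 i) measurable_snd).
have mu1 : measurable_fun setT (fun z : T * d.+3.-tuple T => cos z.1).
  exact: (measurableT_comp measurable_cos).
apply: (@measurable_divided_difference _ _ _ x (fun z => scaled_tpower d.+1 (cos z.1))) => // i.
rewrite (_ : (fun w => _) = (fun w => Num.max 0 (x i w - cos w.1) ^+ d.+1 * ((d.+1)`!%:R)^-1)); last first.
  by apply/funext => w; exact: scaled_tpower_max.
apply: measurable_funM => //.
apply: measurable_funX; apply: measurable_maxr => //.
exact: measurable_funB.
Qed.

Lemma measurable_torus_bspline_l d x :
  measurable_fun setT (fun t : d.+3.-tuple T => torus_bspline x t).
Proof. exact: (measurable_fun_pair2 x (@measurable_torus_bspline d)). Qed.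

Lemma continuous_torus_bspline d (t : d.+3.-tuple T) :
  continuous (fun x : R => torus_bspline x t).
Proof.
move=> x; apply: (@continuous_comp _ _ _ cos (fun u => bspline d.+2 u _)).
  exact: continuous_cos.
apply: continuous_divided_difference => y; exact: continuous_scaled_tpower.
Qed.

End knots_measurability.

Section distinct_ae.
Variable R : realType.
Local Notation T := (measurableTypeR R).
Notation mu := (@lebesgue_measure R).
Local Notation muT := (lebesgue_tuple R).
Local Notation I := (`[- pi, pi]%classic : set T).

Lemma cos_level_null (c : R) : mu [set x : R | I x /\ cos x = c] = 0%E.
Proof.
apply: countable_lebesgue_measure0; apply: finite_set_countable.
apply: (@sub_finite_set _ _ [set acos c; - acos c]) => [x /= [+ xc]|]; last exact: finite_set2.
rewrite in_itv/= => /andP[x1 x2]; rewrite -xc; have [x0|x0] := leP 0 x.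
  by left; rewrite cosK// in_itv/= x0 x2.
by right; rewrite -cosN cosK ?opprK// in_itv/= oppr_ge0 (ltW x0) lerNl.
Qed.

Lemma measurable_eq_set d (W : measurableType d) (f g : W -> R) :
  measurable_fun setT f -> measurable_fun setT g -> measurable [set w | f w = g w].
Proof.
move=> mf mg; rewrite (_ : [set w | _] = (fun w => f w - g w) @^-1` [set 0]).
  rewrite -[X in measurable X]setTI.
  by apply: (measurable_funB mf mg) => //; exact: measurable_set1.
by apply/seteqP; split => w /=; [move=> ->; rewrite subrr|move=> /subr0_eq].
Qed.

Lemma null_torusS d (A : set (d.+1.-tuple T)) : measurable A ->
  (forall x, I x -> muT d [set t | torus R d t /\ A (tuple_of_pair (x, t))] = 0%E) ->
  muT d.+1 (torus R d.+1 `&` A) = 0%E.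
Proof.
move=> mA h; rewrite setIC -integral_indic//; last exact: measurable_torus.
rewrite ge0_integral_torusS//; last first.
  by apply/measurable_EFinP; exact: measurable_indic.
apply: integral0_eq => x Ix; rewrite -(h _ Ix).
have -> : [set t | torus R d t /\ A (tuple_of_pair (x, t))] =
   (fun t => tuple_of_pair (x, t)) @^-1` A `&` torus R d.
  by apply/seteqP; split => t [].
rewrite -integral_indic; last 2 first.
- exact: measurable_torus.
- rewrite -[X in measurable X]setTI.
  by apply: (measurableT_comp (@measurable_tuple_of_pair R d) (pair1_measurable x)).
by apply: eq_integral => t _; rewrite !indicE; congr ((_ %:R)%:E);
  apply/idP/idP => /set_mem h'; apply/mem_set.
Qed.

Lemma null_cos_eq_cst d (i : 'I_d) c :
  muT d (torus R d `&` [set t | cos (tnth t i) = c]) = 0%E.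
Proof.
pose A (j : 'I_d) : set T := if j == i then [set x | I x /\ cos x = c] else I.
have mA j : measurable (A j).
  rewrite /A; case: eqP => _ //; rewrite (_ : [set x | _] = I `&` [set x | cos x = c])//.
  apply: measurableI => //.
  exact: (measurable_eq_set (@measurable_cos R) (measurable_cst c)).
have := lebesgue_tuple_box mA; rewrite (bigD1 i)//=.
rewrite {2}/A eqxx [X in (X * _)%E]cos_level_null mul0e => <-.
congr (muT d _); apply/seteqP; split => t /=.
  by move=> [tt tc] j; rewrite /A; case: eqP => [->|_]; [by split; [exact: tt|exact: tc]|exact: tt].
move=> h; split; last by have := h i; rewrite /A eqxx => -[].
by move=> j; have := h j; rewrite /A; case: eqP => [->[]|].
Qed.

Lemma null_cos_eq d (i j : 'I_d) : i != j ->
  muT d (torus R d `&` [set t | cos (tnth t i) = cos (tnth t j)]) = 0%E.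
Proof.
have mcos d' (k : 'I_d') : measurable_fun setT (fun t : d'.-tuple T => cos (tnth t k)).
  exact: (measurableT_comp (@measurable_cos R) (@measurable_tnth _ T d' k)).
elim: d i j => [[]//|d IHd] i j ij.
apply: null_torusS; first by apply: measurable_eq_set; exact: (mcos d.+1).
move=> x Ix; case: (unliftP ord0 i) ij => [i' ->|->]; case: (unliftP ord0 j) => [j' ->|->] ij.
- rewrite (_ : [set t | _] = torus R d `&` [set t | cos (tnth t i') = cos (tnth t j')]).
    by apply: IHd; apply: contraNneq ij => ->.
  by apply/seteqP; split => t /=; rewrite !tnthS.
- rewrite (_ : [set t | _] = torus R d `&` [set t | cos (tnth t i') = cos x]).
    exact: null_cos_eq_cst.
  by apply/seteqP; split => t /=; rewrite tnthS tnth0.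
- rewrite (_ : [set t | _] = torus R d `&` [set t | cos (tnth t j') = cos x]).
    exact: null_cos_eq_cst.
  by apply/seteqP; split => t /=; rewrite tnthS tnth0 => -[].
- by rewrite eqxx in ij.
Qed.

Lemma ae_distinct_knots d :
  {ae muT d, forall t, torus R d t ->
    forall i j, (i < d)%N -> (j < d)%N -> cos (nth 0 t i) = cos (nth 0 t j) -> i = j}.
Proof.
have : {ae muT d, forall t, forall ij : 'I_d * 'I_d, torus R d t ->
    cos (tnth t ij.1) = cos (tnth t ij.2) -> ij.1 = ij.2}.
  apply: filter_forall => -[i j] /=.
  have [->|ij] := eqVneq i j; first exact: filterE.
  exists (torus R d `&` [set t | cos (tnth t i) = cos (tnth t j)]); split.
  - apply: measurableI; first exact: measurable_torus.
    apply: measurable_eq_set;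
      exact: (measurableT_comp (@measurable_cos R) (@measurable_tnth _ T d _)).
  - exact: null_cos_eq.
  - by move=> t /= /not_implyP[tt /not_implyP[]].
apply: filterS => t h tt i j id jd e.
have := h (Ordinal id, Ordinal jd) tt.
by rewrite !(tnth_nth 0)/= => /(_ e)[].
Qed.

End distinct_ae.

Section cosine_levels.
Variable R : realType.
Local Notation T := (measurableTypeR R).
Notation mu := (@lebesgue_measure R).
Local Notation I := (`[- pi, pi]%classic : set T).

Lemma cos_pi4_sqr : cos (pi / 4 : R) ^+ 2 = 1 / 2.
Proof.
have : cos ((pi / 4) *+ 2) = 0 :> R.
  by rewrite -mulr_natr -mulrA (_ : 4^-1 * 2 = 2^-1) ?cos_pihalf//; field.
by rewrite cos_mulr2n; lra.
Qed.

Lemma sin_ge_half (x : R) : 0 <= x <= pi / 2 -> x / 2 <= sin x.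
Proof.
move=> /andP[x0 x1]; have pi0 := pi_gt0 R.
have c0 : 0 <= cos (pi / 4 : R).
  by rewrite cos_ge0_pihalf//; apply/andP; split; lra.
have cle y : 0 <= y <= x / 2 -> cos (pi / 4) <= cos y.
  move=> /andP[y0 y1]; rewrite leNgt; apply/negP => yc.
  have : pi / 4 < y by rewrite -ltr_cos ?in_itv/=//; apply/andP; split; lra.
  by lra.
have [->|xn0] := eqVneq x 0; first by rewrite sin0 mul0r.
have {xn0} x0' : 0 < x by rewrite lt_neqAle eq_sym xn0.
have x20 : 0 <= x / 2 by lra.
have [y] := MVT_segment x20 (fun y _ => is_derive_sin y)
  (continuous_subspaceT (@continuous_sin R)).
rewrite in_itv/= => /andP[y0 y1] e.
have s2 : x / 2 * cos (pi / 4) <= sin (x / 2).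
  have := e; rewrite sin0 !subr0 => ->; rewrite mulrC ler_wpM2r ?divr_ge0//.
  by apply: cle; rewrite y0 y1.
have c2 : cos (pi / 4) <= cos (x / 2) by apply: cle; rewrite lexx andbT; lra.
have -> : sin x = sin (x / 2) * cos (x / 2) *+ 2.
  by rewrite [sin _ * _]mulrC -sin_mulr2n; congr sin; rewrite -mulr_natr; field.
have : x / 2 * cos (pi / 4) * cos (pi / 4) <= sin (x / 2) * cos (x / 2).
  by apply: ler_pM => //; rewrite mulr_ge0// divr_ge0.
rewrite -mulrA -expr2 cos_pi4_sqr -mulr_natr; lra.
Qed.

Lemma cosB_ge (x y : R) : 0 <= x -> x <= y -> y <= pi ->
  (y - x) ^+ 2 / 8 <= cos x - cos y.
Proof.
move=> x0 xy ypi; have pi0 := pi_gt0 R.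
pose p := (x + y) / 2; pose q := (y - x) / 2.
have ex : x = p - q by rewrite /p /q; field.
have ey : y = p + q by rewrite /p /q; field.
have -> : cos x - cos y = 2 * (sin p * sin q) by rewrite ex ey cosB cosD; ring.
have q0 : 0 <= q by rewrite /q; lra.
have q1 : q <= pi / 2 by rewrite /q; lra.
have sq : q / 2 <= sin q by apply: sin_ge_half; rewrite q0 q1.
have sq0 : 0 <= q / 2 by lra.
have sp : sin q <= sin p.
  rewrite -subr_ge0.
  have -> : sin p - sin q = 2 * (cos (y / 2) * sin (x / 2)).
    have -> : p = y / 2 + x / 2 by rewrite /p; field.
    have -> : q = y / 2 - x / 2 by rewrite /q; field.
    by rewrite sinD sinB; ring.
  rewrite !mulr_ge0// ?cos_ge0_pihalf ?sin_ge0_pi//; apply/andP; split; lra.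
have -> : y - x = q * 2 by rewrite /q; field.
have : q / 2 * (q / 2) <= sin p * sin q.
  by apply: ler_pM => //; apply: (le_trans sq).
by rewrite exprMn; move=> h; rewrite (_ : q ^+ 2 * 2 ^+ 2 / 8 = 2 * (q / 2 * (q / 2))) ?ler_pM2l//; field.
Qed.

Definition cos_level (u e : R) : set T := [set x | I x /\ `|cos x - u| <= e].

Lemma measurable_cos_level u e : measurable (cos_level u e).
Proof.
apply: measurableI => //.
rewrite (_ : (fun x => _) = (fun x : T => `|cos x - u|) @^-1` `]-oo, e]); last first.
  by apply/seteqP; split => x /=; rewrite in_itv.
rewrite -[X in measurable X]setTI.
have m : measurable_fun [set: T] (fun x : T => `|cos x - u|).
  apply: (measurableT_comp (@normr_measurable R setT)).
  by apply: measurable_funB; [exact: measurable_cos|exact: measurable_cst].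
exact: m.
Qed.

Lemma cos_level_small u k (x y : R) : 0 <= x <= pi -> 0 <= y <= pi ->
  `|cos x - u| <= 2 / 4 ^+ k -> `|cos y - u| <= 2 / 4 ^+ k -> `|x - y| <= 6 / 2 ^+ k.
Proof.
move=> hx hy lx ly; wlog xy : x y hx hy lx ly / x <= y.
  by move=> h; case/orP: (le_total x y) => xy; [|rewrite distrC]; exact: h.
move: hx hy => /andP[x0 _] /andP[_ y1].
have h := cosB_ge x0 xy y1.
have h2 : cos x - cos y <= 4 / 4 ^+ k.
  have h3 : cos x - cos y <= `|cos x - u| + `|cos y - u|.
    have -> : cos x - cos y = (cos x - u) - (cos y - u) by ring.
    by rewrite (le_trans _ (ler_normB _ _))// ler_norm.
  by move: lx ly h3; move: ((4 ^+ k)^-1 : R) => z *; lra.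
rewrite distrC ger0_norm ?subr_ge0//.
rewrite -ler_sqr ?nnegrE ?subr_ge0 ?divr_ge0 ?exprn_ge0//.
rewrite expr_div_n -exprM mulnC exprM.
have -> : 2 ^+ 2 = 4 :> R by ring.
have k0 : 0 <= (4 ^+ k)^-1 :> R by rewrite invr_ge0 exprn_ge0.
have -> : 6 ^+ 2 = 36 :> R by ring.
by move: h2 k0 h; set z := (4 ^+ k)^-1; lra.
Qed.

Lemma lebesgue_cos_level u k : (mu (cos_level u (2 / 4 ^+ k)) <= (24 / 2 ^+ k)%:E)%E.
Proof.
have k0 : 0 < 6 / 2 ^+ k :> R by rewrite divr_gt0 ?exprn_gt0.
have [[p [p01 lp]]|np] := pselect (exists p : R, 0 <= p <= pi /\ `|cos p - u| <= 2 / 4 ^+ k); last first.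
  rewrite (_ : cos_level u _ = set0) ?measure0 ?lee_fin ?divr_ge0 ?exprn_ge0//.
  apply/seteqP; split => // x -[+ lx]; rewrite /= ?in_itv/= => /andP[x1 x2].
  apply: np; exists `|x|; split; first by rewrite normr_ge0 ler_norml x1 x2.
  by have [x0|x0] := leP 0 x; rewrite ?(ger0_norm x0) ?(ltr0_norm x0) ?cosN.
pose r : R := 6 / 2 ^+ k.
have len (c : R) : mu `[c - r, c + r]%classic = (2 * r)%:E.
  rewrite lebesgue_measure_itv/= lte_fin ifT; last by rewrite /r; lra.
  by rewrite -EFinB; congr EFin; ring.
have sub : cos_level u (2 / 4 ^+ k) `<=` `[p - r, p + r]%classic `|` `[- p - r, - p + r]%classic.
  move=> x -[+ lx]; rewrite /= ?in_itv/= => /andP[x1 x2].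
  have [x0|x0] := leP 0 x.
    have hx : 0 <= x <= pi by rewrite x0 x2.
    left; rewrite /= ?in_itv/= -ler_distl; exact: cos_level_small lx lp.
  have hx : 0 <= - x <= pi by rewrite oppr_ge0 (ltW x0) lerNl.
  right; rewrite /= ?in_itv/= -ler_distl.
  have lx' : `|cos (- x) - u| <= 2 / 4 ^+ k by rewrite cosN.
  by have := cos_level_small hx p01 lx' lp; rewrite -opprD normrN opprK.
apply: (@le_trans _ _ (mu (`[p - r, p + r]%classic `|` `[- p - r, - p + r]%classic))).
  by apply: le_measure => //; rewrite inE; [exact: measurable_cos_level|exact: measurableU].
apply: (le_trans (measureU2 _ _ _)) => //.
apply: (@le_trans _ _ ((2 * r)%:E + (2 * r)%:E)%E).
  by apply: leeD; rewrite le_eqVlt; apply/orP; left; apply/eqP; exact: len.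
rewrite -EFinD lee_fin /r le_eqVlt; apply/orP; left; apply/eqP.
by ring.
Qed.

End cosine_levels.

Section tail_bound.
Context d (W : measurableType d) (R : realType) (mu : {measure set W -> \bar R}).
Variables (D : set W) (f : W -> R) (B : R).
Hypotheses (mD : measurable D) (mf : measurable_fun setT f) (B0 : 0 <= B).
Hypothesis muf : forall k, (mu (D `&` [set w | (4 ^+ k <= `|f w|)%R]) <= (B / 8 ^+ k)%:E)%E.

Definition tail K (y : R) : R := if 4 ^+ K <= `|y| then `|y| else 0.

Let level k : set W := [set w | (4 ^+ k <= `|f w|)%R].

Let mlevel k : measurable (level k).
Proof.
rewrite (_ : level k = (fun w => `|f w|) @^-1` `[4 ^+ k, +oo[); last first.
  by apply/seteqP; split => w /=; rewrite in_itv/= andbT.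
rewrite -[X in measurable X]setTI.
by apply: (measurableT_comp (@normr_measurable R setT) mf).
Qed.

Lemma tail_ge0 K y : 0 <= tail K y.
Proof. by rewrite /tail; case: ifP. Qed.

Lemma measurable_tail K : measurable_fun setT (fun w => tail K (f w)).
Proof.
rewrite (_ : (fun w => _) = (fun w => `|f w| * \1_(level K) w)).
  apply: measurable_funM; last exact: measurable_indic.
  exact: (measurableT_comp (@normr_measurable R setT) mf).
apply/funext => w; rewrite /tail indicE; case: ifPn => h.
  by rewrite mem_set// mulr1.
by rewrite memNset ?mulr0//; exact/negP.
Qed.

Lemma tail_le_series K w : ((tail K (f w))%:E <=
  \sum_(0 <= k <oo) (4 ^+ (K + k).+1 * \1_(level (K + k)) w)%:E)%E.
Proof.
have ge0 k : (0 <= (4 ^+ (K + k).+1 * \1_(level (K + k)) w)%:E)%E.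
  by rewrite lee_fin mulr_ge0 ?exprn_ge0.
rewrite /tail; case: ifPn => [fK|_]; last by apply: nneseries_ge0 => *.
have ex : exists n, `|f w| < 4 ^+ (K + n)%N.
  have [n hn] : exists n : nat, `|f w| < n%:R.
    by exists (Num.trunc `|f w|).+1; exact: Num.Theory.truncnS_gt.
  exists n; rewrite (lt_trans hn)// -natrX ltr_nat.
  by rewrite (leq_ltn_trans (leq_addl K n))// ltn_expl.
have [] := ex_minnP ex; case=> [|n] hn min.
  by move: hn; rewrite addn0 ltNge fK.
have ln : 4 ^+ (K + n)%N <= `|f w|.
  by rewrite leNgt; apply/negP => /min; rewrite ltnn.
apply: le_trans (nneseries_lim_ge n.+1 _) => //.
rewrite big_nat_recr//= (le_trans _ (leeDr _ _))//; last exact: sume_ge0.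
by rewrite lee_fin indicE mem_set// mulr1 -addnS ltW.
Qed.

Lemma tail_integral_le K : (\int[mu]_(w in D) (tail K (f w))%:E <= (8 * B / 2 ^+ K)%:E)%E.
Proof.
have ge0 k w : (0 <= (4 ^+ (K + k).+1 * \1_(level (K + k)) w)%:E)%E.
  by rewrite lee_fin mulr_ge0 ?exprn_ge0.
have ms k : measurable_fun D (fun w => (4 ^+ (K + k).+1 * \1_(level (K + k)) w)%:E : \bar R).
  apply/measurable_EFinP/measurable_funM; first exact: measurable_cst.
  exact: measurable_indic.
apply: (@le_trans _ _ (\int[mu]_(w in D)
    \sum_(0 <= k <oo) (4 ^+ (K + k).+1 * \1_(level (K + k)) w)%:E)%E).
  apply: ge0_le_integral => //.
  - by move=> w _; rewrite lee_fin tail_ge0.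
  - exact/measurable_EFinP/measurable_funTS/measurable_tail.
  - by apply: ge0_emeasurable_sum => // k w _ _; exact: ge0.
  - by move=> w _; exact: tail_le_series.
rewrite integral_nneseries//.
apply: lime_le; first by apply: is_cvg_nneseries => k _ _; exact: integral_ge0.
apply: nearW => n.
apply: (@le_trans _ _ (\sum_(0 <= k < n) (4 * B / 2 ^+ K / 2 ^+ k)%:E)%E).
  apply: lee_sum => k _; under eq_integral do rewrite EFinM.
  rewrite integralZl//; last first.
    apply/integrableP; split; first exact/measurable_EFinP/measurable_indic.
    under eq_integral do rewrite gee0_abs ?lee_fin//.
    by rewrite integral_indic// setIC (le_lt_trans (muf _))// ltry.
  rewrite integral_indic// setIC.
  apply: (@le_trans _ _ ((4 ^+ (K + k).+1)%:E * (B / 8 ^+ (K + k))%:E)%E).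
    by apply: lee_wpmul2l; [rewrite lee_fin exprn_ge0|exact: muf].
  rewrite -EFinM lee_fin le_eqVlt; apply/orP; left; apply/eqP.
  rewrite -mulrA -invfM -exprD; set m := (K + k)%N.
  have -> : 8 ^+ m = 4 ^+ m * 2 ^+ m :> R by rewrite -exprMn; congr (_ ^+ _); ring.
  have n4 : 4 ^+ m != 0 :> R by rewrite expf_neq0.
  have n2 : 2 ^+ m != 0 :> R by rewrite expf_neq0.
  by rewrite exprS; field; rewrite n2 n4.
rewrite sumEFin lee_fin -mulr_sumr.
have E : \sum_(0 <= k < n) (2 ^+ k)^-1 = 2 - 2 / 2 ^+ n :> R.
  elim: n => [|n IHn]; first by rewrite big_geq// expr0; field.
  by rewrite big_nat_recr//= IHn exprS; field; rewrite expf_neq0.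
rewrite E; have -> : 8 * B / 2 ^+ K = 4 * B / 2 ^+ K * 2 :> R by ring.
rewrite ler_wpM2l ?mulr_ge0 ?invr_ge0 ?exprn_ge0// gerBl divr_ge0// exprn_ge0//.
Qed.

Lemma tail_integrable K : mu.-integrable D (EFin \o (fun w => tail K (f w))).
Proof.
apply/integrableP; split; first exact/measurable_EFinP/measurable_funTS/measurable_tail.
under eq_integral do rewrite /= ger0_norm ?tail_ge0//.
by rewrite (le_lt_trans (tail_integral_le K))// ltry.
Qed.

Lemma integrable_of_tail : (mu D < +oo)%E -> mu.-integrable D (EFin \o f).
Proof.
move=> Dfin; apply: (@le_integrable _ _ _ _ _ mD _ (EFin \o (fun w => 1 + tail 0 (f w)))).
- exact/measurable_EFinP/measurable_funTS.
- move=> w _ /=; rewrite lee_fin (@ger0_norm _ (1 + _)) ?addr_ge0 ?tail_ge0//.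
  rewrite /tail expr0; case: (leP 1 `|f w|) => h; first by rewrite lerDr.
  by rewrite addr0 ltW.
- apply: (@integrableD _ _ _ _ _ mD (EFin \o cst 1) (EFin \o (fun w => tail 0 (f w)))).
    apply: (integrable_bounded mD Dfin (measurable_cst _) (M := 1)) => w _.
    by rewrite normr1.
  exact: tail_integrable.
Qed.

Lemma Rtail_integral_le K : \int[mu]_(w in D) (tail K (f w)) <= 8 * B / 2 ^+ K.
Proof.
rewrite -lee_fin /Rintegral fineK; first exact: tail_integral_le.
exact: (integrable_fin_num mD (tail_integrable K)).
Qed.

End tail_bound.

Section bspline_mean.
Variables (R : realType) (d : nat).
Local Notation T := (measurableTypeR R).
Notation mu := (@lebesgue_measure R).
Local Notation muT := (lebesgue_tuple R d.+3).
Local Notation D := (torus R d.+3).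
Local Notation M := (@torus_bspline R d.+3).
Local Notation B := (24 ^+ d.+3 : R).

Let mD : measurable D := @measurable_torus R d.+3.
Let Dfin : (muT D < +oo)%E := lebesgue_torus_lty R d.+3.
Let mM x := @measurable_torus_bspline_l R d x.

Lemma torus_bspline_level x k :
  (muT (D `&` [set t | (4 ^+ k <= `|M x t|)%R]) <= (B / 8 ^+ k)%:E)%E.
Proof.
have [N [mN N0 Nsub]] := ae_distinct_knots R d.+3.
pose box := [set t : d.+3.-tuple T | forall i, cos_level (cos x) (2 / 4 ^+ k) (tnth t i)].
have mbox : measurable box.
  rewrite (_ : box = \bigcap_(i in [set: 'I_d.+3])
      ((fun t => tnth t i) @^-1` cos_level (cos x) (2 / 4 ^+ k))).
    apply: fin_bigcap_measurable => // i _.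
    rewrite -[X in measurable X]setTI; apply: measurable_tnth => //.
    exact: measurable_cos_level.
  by apply/seteqP; split => t /= ht i; [move=> _|]; apply: ht.
have mE : measurable (D `&` [set t | (4 ^+ k <= `|M x t|)%R]).
  apply: measurableI => //.
  rewrite (_ : [set t | _] = (fun t => `|M x t|) @^-1` `[4 ^+ k, +oo[); last first.
    by apply/seteqP; split => w /=; rewrite in_itv/= andbT.
  rewrite -[X in measurable X]setTI.
  by apply: (measurableT_comp (@normr_measurable R setT) (mM x)).
have sub : D `&` [set t | (4 ^+ k <= `|M x t|)%R] `<=` box `|` N.
  move=> t [Dt /= Mt]; have [Nt|Nt] := pselect (N t); [by right|left => i].
  have dk : distinct_knots d.+2 (fun i => cos (nth 0 t i)).
    apply: contrapT => ndk; apply: Nt; apply: Nsub => /= h; apply: ndk => a b al bl.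
    by apply: h => //; rewrite ltnS.
  split; first exact: Dt.
  have := @bspline_bound R d.+2 (cos x) _ i isT dk (leq_ord i).
  rewrite -(tnth_nth 0) => h; rewrite ler_pdivlMr ?exprn_gt0// mulrC.
  by rewrite (le_trans _ h)// ler_wpM2r.
apply: (@le_trans _ _ (muT (box `|` N))).
  by apply: le_measure; rewrite ?inE//; exact: measurableU.
apply: (le_trans (measureU2 _ _ _)) => //; rewrite [X in (_ + X)%E]N0 adde0.
have hbox : (muT box <= \prod_(i < d.+3) mu (cos_level (cos x) (2 / 4 ^+ k)))%E.
  rewrite le_eqVlt; apply/orP; left; apply/eqP.
  exact: (@lebesgue_tuple_box R d.+3 (fun=> cos_level (cos x) (2 / 4 ^+ k))
    (fun=> measurable_cos_level _ _)).
apply: (le_trans hbox).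
apply: (@le_trans _ _ (\prod_(i < d.+3) (24 / 2 ^+ k)%:E)%E).
  have [] // : (0 <= \prod_(i < d.+3) mu (cos_level (cos x) (2 / 4 ^+ k)))%E /\
    (\prod_(i < d.+3) mu (cos_level (cos x) (2 / 4 ^+ k)) <=
     \prod_(i < d.+3) (24 / 2 ^+ k)%:E)%E.
  elim: d.+3 => [|m [m0 IHm]]; first by rewrite !big_ord0.
  rewrite !big_ord_recl; split; first by rewrite mule_ge0.
  by apply: lee_pmul => //; exact: lebesgue_cos_level.
rewrite prodEFin prodr_const card_ord lee_fin expr_div_n ler_wpM2l ?exprn_ge0//.
have -> : 8 = 2 ^+ 3 :> R by ring.
rewrite lef_pV2 ?posrE ?exprn_gt0// -!exprM ler_eXn2l ?ltr1n//; lia.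
Qed.

Let B0 : 0 <= B. Proof. by rewrite exprn_ge0. Qed.

Lemma torus_bspline_integrable x : muT.-integrable D (EFin \o M x).
Proof. exact: (integrable_of_tail mD (mM x) B0 (torus_bspline_level x) Dfin). Qed.

Lemma torus_bsplineM_integrable x g : tame g ->
  muT.-integrable D (EFin \o (fun t => M x t * g t)).
Proof.
move=> [mg [G gG]].
apply: (@le_integrable _ _ _ _ _ mD _ (EFin \o (fun t => G * M x t))).
- by apply/measurable_EFinP/measurable_funTS; exact: measurable_funM.
- move=> t _ /=; rewrite lee_fin !normrM mulrC ler_wpM2r//.
  by rewrite (le_trans (gG t))// ler_norm.
- rewrite (_ : _ \o _ = (fun t => G%:E * (M x t)%:E)%E); last exact/funext.
  by apply: integrableZl => //; exact: torus_bspline_integrable.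
Qed.

Definition bspline_mean (g : d.+3.-tuple T -> R) (x : R) : R :=
  \int[muT]_(t in D) (M x t * g t).

(** Truncation of y at level L. *)
Definition clip (L y : R) : R := (`|y + L| - `|y - L|) / 2.

Lemma clip_dist K y : `|y - clip (4 ^+ K) y| <= tail K y.
Proof.
have L0 : 0 < 4 ^+ K :> R by rewrite exprn_gt0.
rewrite /clip /tail; move: (4 ^+ K : R) L0 => L L0; case: ifPn; last first.
  rewrite -ltNge ltr_norml => /andP[y1 y2].
  have a1 : 0 <= y + L by lra.
  have a2 : y - L <= 0 by lra.
  rewrite (ger0_norm a1) (ler0_norm a2).
  by rewrite (_ : y - _ = 0) ?normr0//; field.
have [y0|y0] := leP 0 y.
  rewrite (ger0_norm y0) => h.
  have a1 : 0 <= y + L by lra.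
  have a2 : 0 <= y - L by lra.
  rewrite (ger0_norm a1) (ger0_norm a2) (_ : y - _ = y - L); last by field.
  by rewrite ger0_norm//; lra.
rewrite (ltr0_norm y0) => h.
have a1 : y + L <= 0 by lra.
have a2 : y - L <= 0 by lra.
rewrite (ler0_norm a1) (ler0_norm a2) (_ : y - _ = y + L); last by field.
by rewrite ler0_norm//; lra.
Qed.

Lemma clip_le L y : 0 <= L -> `|clip L y| <= L.
Proof.
move=> L0; rewrite /clip normrM (@ger0_norm _ 2^-1)// ler_pdivrMr//.
have -> : L * 2 = `|(y + L) - (y - L)| by rewrite ger0_norm; lra.
exact: ler_dist_dist.
Qed.

Lemma continuous_clip L : continuous (clip L).
Proof.
move=> y; apply: cvgMl; apply: cvgB; apply: cvg_norm.
  by apply: cvgD; [exact: cvg_id|exact: cvg_cst].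
by apply: cvgB; [exact: cvg_id|exact: cvg_cst].
Qed.

Let clip_tame g x L : 0 <= L -> tame g -> tame (fun t => clip L (M x t) * g t).
Proof.
move=> L0 tg; apply: tameM => //; split; last by exists L => t; exact: clip_le.
apply: (measurableT_comp (continuous_measurable_fun (@continuous_clip L)) (mM x)).
Qed.

Lemma continuous_clip_mean g L : 0 <= L -> tame g ->
  continuous (fun x => \int[muT]_(t in D) (clip L (M x t) * g t)).
Proof.
move=> L0 tg x; have [mg [G gG]] := tg.
have h := @continuity_under_integral R _ _ muT (fun x t => clip L (M x t) * g t) D mD
  (x - 1) (x + 1).
apply: (h _ _ (cst (L * G))).
- by move=> y _; exact/tame_integrable/clip_tame.
- apply: aeW => t _ y _ ; apply: cvgMl.
  apply: (@continuous_comp _ _ _ (fun x => M x t) (clip L)); last exact: continuous_clip.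
  exact: continuous_torus_bspline.
- apply: (integrable_bounded mD Dfin (measurable_cst _) (M := `|L * G|)) => t _.
  exact: lexx.
- move=> y _; apply: aeW => t _; rewrite normrM ler_pM//; exact: clip_le.
- by rewrite inE/= in_itv/=; apply/andP; split; lra.
Qed.

(** Truncation of the B-spline yields continuous functions, and the tail bound
    is uniform in the position x. *)
Lemma continuous_bspline_mean g : tame g -> continuous (bspline_mean g).
Proof.
move=> tg; have [mg [G gG]] := tg.
have G0 : 0 <= G by rewrite (le_trans _ (gG [tuple of nseq _ 0])).
apply: continuous_uniform_approx => e e0.
have [K Ke] := exists_inv_le (G * (8 * B)) e0.
have L0 : 0 <= 4 ^+ K.+1 :> R by rewrite exprn_ge0.
exists (fun x => \int[muT]_(t in D) (clip (4 ^+ K.+1) (M x t) * g t)).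
  exact: continuous_clip_mean.
move=> x; rewrite /bspline_mean -RintegralB//; last 2 first.
- exact: torus_bsplineM_integrable.
- exact/tame_integrable/clip_tame.
have i1 : muT.-integrable D (EFin \o (fun t => M x t * g t - clip (4 ^+ K.+1) (M x t) * g t)).
  rewrite (_ : _ \o _ = (fun t => (M x t * g t)%:E - (clip (4 ^+ K.+1) (M x t) * g t)%:E)%E) //.
  apply: integrableB => //; first exact: torus_bsplineM_integrable.
  exact/tame_integrable/clip_tame.
have iT := tail_integrable mD (mM x) B0 (torus_bspline_level x) K.+1.
have iGT : muT.-integrable D (EFin \o (fun t => G * tail K.+1 (M x t))).
  rewrite (_ : _ \o _ = (fun t => G%:E * (tail K.+1 (M x t))%:E)%E); last exact/funext.
  exact: integrableZl.
rewrite (le_trans (le_normr_Rintegral mD i1))//.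
apply: (@le_trans _ _ (\int[muT]_(t in D) (G * tail K.+1 (M x t)))).
  apply: le_Rintegral => //.
    by apply: (eq_integrable mD (abse \o (EFin \o (fun t => M x t * g t - clip (4 ^+ K.+1) (M x t) * g t)))) => //;
      exact: integrable_abse.
  move=> t _; rewrite -mulrBl normrM mulrC ler_pM//; exact: clip_dist.
rewrite RintegralZl//.
rewrite (le_trans (ler_wpM2l G0 (Rtail_integral_le mD (mM x) B0 (torus_bspline_level x) _)))//.
rewrite mulrA (le_trans _ Ke)//; apply: ler_wpM2l; first by apply: mulr_ge0 => //; exact: mulr_ge0.
rewrite lef_pV2 ?posrE ?exprn_gt0 ?ltr0n//.
by rewrite -natrX ler_nat ltnW// ltn_expl.
Qed.

Let bspline_abs_le x : (\int[muT]_(t in D) `|(M x t)%:E| <= muT D + (8 * B)%:E)%E.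
Proof.
have ile t : D t -> (`|(M x t)%:E| <= 1 + (tail 0 (M x t))%:E)%E.
  move=> _; rewrite -EFinD lee_fin /tail expr0; case: (leP 1 `|M x t|) => h; first by rewrite lerDr.
  by rewrite addr0 ltW.
have mt := @measurable_tail _ _ _ _ (mM x) 0.
apply: (@le_trans _ _ (\int[muT]_(t in D) (1 + (tail 0 (M x t))%:E))%E).
  apply: ge0_le_integral => //.
  - apply: measurableT_comp => //; apply/measurable_EFinP; exact: measurable_funTS.
  - apply: emeasurable_funD; first exact: measurable_cst.
    by apply/measurable_EFinP/measurable_funTS.
rewrite ge0_integralD//; last 2 first.
- by move=> t _; rewrite lee_fin tail_ge0.
- by apply/measurable_EFinP/measurable_funTS.
rewrite integral_cst// mul1e leeD2l//.
have := tail_integral_le mD (mM x) B0 (torus_bspline_level x) 0.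
by rewrite expr0 divr1.
Qed.

(** Interchange of the integrals over the position and over the knots. *)
Lemma bspline_mean_swap g (h : R -> R) (w : d.+3.-tuple T -> R) :
  tame g -> continuous h -> measurable_fun setT w ->
  {ae muT, forall t, D t -> \int[mu]_(x in `[0, pi]) (M x t * h x) = w t} ->
  \int[mu]_(x in `[0, pi]) (bspline_mean g x * h x) = \int[muT]_(t in D) (w t * g t).
Proof.
move=> tg ch mw hw; have [mg [G gG]] := tg.
have G0 : 0 <= G by rewrite (le_trans _ (gG [tuple of nseq _ 0])).
have Jfin : (mu `[0%R, pi]%classic < +oo)%E.
  by rewrite lebesgue_measure_itv/= lte_fin pi_gt0 -EFinB ltry.
pose J : set T := `[0, pi]%classic.
have mJ : measurable J by exact: measurable_itv.
have mh : measurable_fun [set: T] (h : T -> R) by exact: continuous_measurable_fun.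
pose f (z : T * d.+3.-tuple T) : R := M z.1 z.2 * g z.2 * h z.1.
have mf : measurable_fun setT f.
  apply: measurable_funM; last exact: (measurableT_comp mh measurable_fst).
  apply: measurable_funM; first exact: measurable_torus_bspline.
  exact: (measurableT_comp mg measurable_snd).
pose F (z : T * d.+3.-tuple T) : \bar R := ((f \_ (J `*` D)) z)%:E.
have mF : measurable_fun setT F.
  apply/measurable_EFinP/(measurable_restrictT _ _).1; first exact: measurableX.
  exact: measurable_funTS.
have FE x t : F (x, t) = (if (x \in J) && (t \in D) then f (x, t) else 0)%:E.
  by rewrite /F patchE in_setX.
have Fx x (k : \bar R -> \bar R) : k 0%E = 0%E -> (\int[muT]_t k (F (x, t)) =
   if x \in J then \int[muT]_(t in D) k (f (x, t))%:E else 0)%E.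
  move=> k0; case: ifPn => xJ.
    rewrite [RHS]integral_mkcond; apply: eq_integral => t _.
    by rewrite FE xJ patchE/=; case: ifP.
  by apply: integral0_eq => t _; rewrite FE (negbTE xJ).
have Ft t (k : \bar R -> \bar R) : k 0%E = 0%E -> (\int[mu]_x k (F (x, t)) =
   if t \in D then \int[mu]_(x in J) k (f (x, t))%:E else 0)%E.
  move=> k0; case: ifPn => tD.
    rewrite [RHS]integral_mkcond; apply: eq_integral => x _.
    by rewrite FE tD andbT patchE/=; case: ifP.
  by apply: integral0_eq => x _; rewrite FE (negbTE tD) andbF.
have [H hH] : exists H, forall x, x \in J -> `|h x| <= H.
  have cJ : compact (h @` J).
    apply: continuous_compact; last exact: segment_compact.
    exact: continuous_subspaceT.
  have [H [_ hH]] := compact_bounded cJ.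
  exists (H + 1) => x /set_mem Jx; apply: (hH (H + 1)); first by rewrite ltrDl.
  by exists x.
have H0 : 0 <= H.
  rewrite (le_trans _ (hH 0 _))//; apply/mem_set; rewrite /J/= in_itv/= lexx pi_ge0//.
have k0 : abse (0%E : \bar R) = 0%E by rewrite abse0.
have iF : (mu \x muT)%E.-integrable setT F.
  apply/integrable12ltyP => //.
  rewrite (_ : (\int[mu]_x \int[muT]_t `|F (x, t)|)%E = (\int[mu]_x
      if x \in J then \int[muT]_(t in D) `|(f (x, t))%:E| else 0)%E); last first.
    by apply: eq_integral => x _; exact: (Fx x abse k0).
  apply: (@le_lt_trans _ _ (\int[mu]_x ((fun=> ((G * H)%:E * (muT D + (8 * B)%:E))%E) \_ J) x)%E).
    apply: ge0_le_integral => //.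
    - by move=> x _; case: ifP => // _; exact: integral_ge0.
    - rewrite (_ : (fun x => _) = fubini_F muT (abse \o F)).
        apply: (measurable_fun_fubini_tonelli_F (abse \o F)) => //=.
        by apply: measurableT_comp => //; exact: abse_measurable.
      by apply/funext => x; rewrite -(Fx x abse k0).
    - by apply/(measurable_restrictT _ _).1 => //; exact: measurable_cst.
    - move=> x _; rewrite patchE; case: ifP => // xJ.
      apply: (@le_trans _ _ (\int[muT]_(t in D) ((G * H)%:E * `|(M x t)%:E|))%E).
        apply: ge0_le_integral => //.
        + apply: measurableT_comp => //; apply/measurable_EFinP/measurable_funTS.
          exact: (measurable_fun_pair2 x mf).
        + apply: emeasurable_funM; first exact: measurable_cst.
          by apply: measurableT_comp => //; apply/measurable_EFinP/measurable_funTS.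
        + move=> t _; rewrite /f/= lee_fin !normrM -mulrA mulrC.
          by apply: ler_wpM2r => //; apply: ler_pM => //; exact: hH.
      rewrite ge0_integralZl// ?lee_fin ?mulr_ge0//; last first.
        by apply: measurableT_comp => //; apply/measurable_EFinP/measurable_funTS.
      by apply: lee_wpmul2l; [rewrite lee_fin mulr_ge0|exact: bspline_abs_le].
  rewrite -integral_mkcond integral_cst//.
  rewrite lte_mul_pinfty//.
  - by rewrite mule_ge0// ?lee_fin ?mulr_ge0// adde_ge0// lee_fin mulr_ge0.
  - by rewrite fin_numM// fin_numD/= andbT ge0_fin_numE.
have /(congr1 fine) := Fubini iF.
have E1 : (\int[mu]_x \int[muT]_t F (x, t) =
    \int[mu]_(x in J) (bspline_mean g x * h x)%:E)%E.
  rewrite [RHS]integral_mkcond; apply: eq_integral => x _.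
  rewrite (Fx x id erefl) patchE; case: ifP => // _.
  rewrite /bspline_mean -RintegralZr//; last exact: torus_bsplineM_integrable.
  rewrite /Rintegral fineK//; apply: integrable_fin_num => //.
  rewrite (_ : (fun t => _) = (fun t => (M x t * g t)%:E * (h x)%:E)%E); last exact/funext.
  by apply: integrableZr => //; exact: torus_bsplineM_integrable.
have E2 : (\int[muT]_t \int[mu]_x F (x, t) = \int[muT]_(t in D) (w t * g t)%:E)%E.
  rewrite [RHS]integral_mkcond; apply: ae_eq_integral => //.
  - exact: (measurable_fubini_G iF).
  - apply/(measurable_restrictT _ _).1 => //.
    by apply/measurable_EFinP/measurable_funTS; exact: measurable_funM.
  apply: filterS hw => t hw _; rewrite (Ft t id erefl) patchE.
  case: ifP => // tD; rewrite -hw; last exact/set_mem.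
  have cM : continuous (fun x => M x t * h x).
    by move=> x; apply: cvgM; [exact: continuous_torus_bspline|exact: ch].
  have iM := continuous_integrable_itv 0 pi cM.
  rewrite -RintegralZr// /Rintegral fineK.
    by apply: eq_integral => x _; rewrite /f/=; congr EFin; ring.
  apply: integrable_fin_num => //.
  rewrite (_ : (fun x => _) = (fun x => (M x t * h x)%:E * (g t)%:E)%E); last exact/funext.
  exact: integrableZr.
by rewrite E1 E2.
Qed.

End bspline_mean.

Section interval_integrals.
Variable R : realType.
Notation mu := (@lebesgue_measure R).

Lemma le_cos (x y : R) : 0 <= x -> x <= y -> y <= pi -> cos y <= cos x.
Proof.
move=> x0 xy ypi; have := cosB_ge x0 xy ypi.
by have := sqr_ge0 (y - x); lra.
Qed.

Lemma Rintegral_itv_split (f : R -> R) a b c : continuous f -> a <= b -> b <= c ->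
  \int[mu]_(t in `[a, c]) f t =
  \int[mu]_(t in `[a, b]) f t + \int[mu]_(t in `[b, c]) f t.
Proof.
move=> cf ab bc; have iac := continuous_integrable_itv a c cf.
have := Rintegral_itvB iac (_ : (BLeft a <= BRight b)%O) (_ : (BRight b <= BRight c)%O).
rewrite !bnd_simp => /(_ ab bc).
rewrite Rintegral_itv_obnd_cbnd; last first.
  by apply: integrableS iac => //; apply: subset_itvr; rewrite bnd_simp.
by move=> <-; rewrite addrC subrK.
Qed.

Lemma Rintegral_ge_cst (f : R -> R) a b c : continuous f -> a <= b ->
  (forall t, a <= t <= b -> c <= f t) -> c * (b - a) <= \int[mu]_(t in `[a, b]) f t.
Proof.
move=> cf ab cfab.
have mE : mu `[a, b] = (b - a)%:E.
  by rewrite lebesgue_measure_itv/= lte_fin; case: ltgtP ab => // -> _; rewrite subrr.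
have -> : c * (b - a) = \int[mu]_(t in `[a, b]) c.
  by rewrite Rintegral_cst//= mE.
apply: le_Rintegral.
- exact: measurable_itv.
- by apply: (continuous_integrable_itv (f := cst c)) => x; exact: cvg_cst.
- exact: continuous_integrable_itv.
- by move=> t /=; rewrite in_itv/=; exact: cfab.
Qed.

Lemma Rintegral_norm_le (f : R -> R) a b c : continuous f -> a <= b ->
  (forall t, a <= t <= b -> `|f t| <= c) ->
  `|\int[mu]_(t in `[a, b]) f t| <= c * (b - a).
Proof.
move=> cf ab fc; rewrite ler_norml -mulNr; apply/andP; split.
  by apply: Rintegral_ge_cst => // t /fc; rewrite ler_norml => /andP[].
rewrite -[leRHS]opprK lerNr -mulNr.
rewrite (_ : - (\int[mu]_(t in `[a, b]) f t) = \int[mu]_(t in `[a, b]) (- f t)).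
  apply: (@Rintegral_ge_cst (fun t => - f t)) => // [t|t /fc].
    by apply: cvgN; exact: cf.
  by rewrite ler_norml => /andP[_]; rewrite lerN2.
rewrite -mulN1r -RintegralZl//; last exact: continuous_integrable_itv.
by apply: eq_Rintegral => t _; rewrite mulN1r.
Qed.

End interval_integrals.

Section bspline_moments.
Variable R : realType.
Notation mu := (@lebesgue_measure R).
Implicit Types (p : {poly R}) (x : nat -> R) (y : R).

Lemma divided_difference_functional m x : exists c : nat -> R,
  forall f, divided_difference m x f = \sum_(i < m.+1) c i * f (x i).
Proof.
elim: m x => [|m IHm] x; first by exists (fun=> 1) => f; rewrite big_ord1 mul1r.
have [c1 h1] := IHm x; have [c2 h2] := IHm (fun i => x i.+1).
exists (fun i => ((if (i <= m)%N then c1 i else 0) - (if i is k.+1 then c2 k else 0))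
  / (x 0%N - x m.+1)) => f.
rewrite divided_differenceS h1 h2.
under [RHS]eq_bigr do rewrite mulrAC mulrBl.
rewrite -mulr_suml sumrB; congr ((_ - _) / _).
  rewrite [RHS]big_ord_recr/= ltnn mul0r addr0.
  by apply: eq_bigr => i _; rewrite -ltnS ltn_ord.
by rewrite [RHS]big_ord_recl/= mul0r add0r.
Qed.

(** The Taylor polynomial of order k of p based at the variable, evaluated at y. *)
Definition taylor_at k p y : {poly R} :=
  \sum_(i < k.+1) (i`!%:R)^-1 *: (p^`(i) * (y%:P - 'X) ^+ i).

Lemma deriv_taylor_at k p y : (taylor_at k p y)^`() =
  (k`!%:R)^-1 *: (p^`(k.+1) * (y%:P - 'X) ^+ k).
Proof.
rewrite /taylor_at; elim: k => [|k IHk].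
  by rewrite big_ord1 derivZ !expr0 !mulr1 derivn1 derivn0.
rewrite big_ord_recr/= derivD IHk derivZ derivM -derivnS.
rewrite deriv_exp derivB derivC derivX sub0r [k.+1.-1]/=.
rewrite factS natrM invfM -!mul_polyC.
have k1 : k.+1%:R != 0 :> R by rewrite pnatr_eq0.
have E : (k.+1%:R^-1 : R)%:P * k.+1%:R = 1 :> {poly R}.
  by rewrite -polyC_natr -polyCM mulVf.
rewrite !polyCM ?mulr1.
set a := (k.+1%:R^-1 : R)%:P in E *; set b := ((k`!%:R)^-1 : R)%:P; set q : {poly R} := _ ^+ k.
rewrite -derivnS; set P1 := p^`(k.+1); set P2 := p^`(k.+2); set Q : {poly R} := _ ^+ k.+1.
rewrite -[(_ * q) *+ _]mulr_natl.
move: E; move: (k.+1%:R : {poly R}) => K E; clearbody a b q P1 P2 Q.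
have -> : b * (P1 * q) + a * b * (P2 * Q + P1 * (K * (-1 * q))) =
    a * b * (P2 * Q) + b * (P1 * q) * (1 - a * K) by ring.
by rewrite E subrr mulr0 addr0.
Qed.

Lemma taylor_at_self k p y : (taylor_at k p y).[y] = p.[y].
Proof.
rewrite /taylor_at big_ord_recl hornerD hornerZ fact0 invr1 mul1r expr0 mulr1 derivn0.
rewrite horner_sum big1 ?addr0// => i _.
by rewrite hornerZ hornerM horner_exp hornerD hornerN hornerC hornerX subrr exprS mul0r !mulr0.
Qed.

Definition taylor_poly k p (a : R) : {poly R} :=
  \sum_(i < k.+1) ((i`!%:R)^-1 * p^`(i).[a]) *: ('X - a%:P) ^+ i.

Lemma taylor_atE k p y a : (taylor_at k p y).[a] = (taylor_poly k p a).[y].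
Proof.
rewrite /taylor_at /taylor_poly !horner_sum; apply: eq_bigr => i _.
by rewrite !hornerZ hornerM !horner_exp !hornerD !hornerN !hornerC !hornerX mulrA.
Qed.

Lemma size_taylor_poly k p a : (size (taylor_poly k p a) <= k.+1)%N.
Proof.
apply: (leq_trans (size_sum _ _ _)); apply/bigmax_leqP => i _.
by rewrite (leq_trans (size_scale_leq _ _))// size_exp_XsubC.
Qed.

Lemma scaled_tpower_moment k p y : -1 <= y <= 1 ->
  \int[mu]_(t in `[0, pi]) (scaled_tpower k.+1 (cos t) y * p^`(k.+2).[cos t] * sin t) =
  p.[y] - (taylor_poly k.+1 p (-1)).[y].
Proof.
move=> y1; pose f (t : R) := scaled_tpower k.+1 (cos t) y * p^`(k.+2).[cos t] * sin t.
have pi0 := pi_gt0 R.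
have phi0 : 0 <= acos y by apply: acos_ge0.
have phi1 : acos y <= pi by apply: acos_lepi.
have cphi : cos (acos y) = y by rewrite acosK// in_itv.
have cf : continuous f.
  move=> t; apply: cvgM; last exact: continuous_sin.
  apply: cvgM; last exact: continuous_horner_cos.
  apply: (@continuous_comp _ _ _ cos (fun u => scaled_tpower k.+1 u y)).
    exact: continuous_cos.
  exact: continuous_scaled_tpower.
pose F (t : R) : R := - (taylor_at k.+1 p y).[cos t].
pose g (t : R) : R := ((k.+1)`!%:R)^-1 * (p^`(k.+2).[cos t] * (y - cos t) ^+ k.+1) * sin t.
have dF (t : R) : is_derive t 1 F (g t).
  have h := is_derive_horner_cos (taylor_at k.+1 p y) t.
  have := @is_deriveN _ _ _ _ _ _ _ h.
  rewrite deriv_taylor_at hornerZ hornerM horner_exp hornerD hornerN hornerC hornerX.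
  by rewrite mulNr opprK [sin t * _]mulrC.
have cg : continuous g.
  move=> t; apply: cvgM; last exact: continuous_sin.
  apply: cvgMr; apply: cvgM; first exact: continuous_horner_cos.
  apply: (@continuous_comp _ _ _ (fun t => y - cos t) (fun v => v ^+ k.+1)).
    by apply: cvgB; [exact: cvg_cst|exact: continuous_cos].
  exact: exprn_continuous.
rewrite (Rintegral_itv_split cf phi0 phi1).
have -> : \int[mu]_(t in `[0, acos y]) f t = 0.
  rewrite (@eq_Rintegral _ _ _ _ _ (cst 0)); first by rewrite Rintegral_cst// mul0r.
  move=> t; rewrite inE/= in_itv/= => /andP[t0 t1].
  rewrite /f scaled_tpower_le ?mul0r//= -cphi; exact: le_cos.
rewrite add0r.
transitivity (\int[mu]_(t in `[acos y, pi]) g t).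
  apply: eq_Rintegral.
  move=> t; rewrite inE/= in_itv/= => /andP[t0 t1].
  have yt : 0 <= y - cos t.
    by rewrite subr_ge0 -cphi; exact: le_cos.
  rewrite /f /g scaled_tpower_max; case: ltP => [_|yt']; first by ring.
  have -> : y - cos t = 0 by apply/eqP; rewrite eq_le yt yt'.
  by rewrite expr0n /= !(mul0r, mulr0).
rewrite (Rintegral_primitive phi1 dF cg) /F cphi cospi taylor_at_self taylor_atE.
by rewrite opprK addrC.
Qed.

(** Peano kernel formula: up to the sign of the orientation, the B-spline is the
    kernel that represents divided differences by derivatives. *)
Lemma bspline_moment k p x : distinct_knots k.+2 x ->
  (forall i, -1 <= x i <= 1) ->
  \int[mu]_(t in `[0, pi]) (bspline k.+2 (cos t) x * (p^`(k.+2).[cos t] * sin t)) =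
  divided_difference k.+2 x (horner p).
Proof.
move=> dx x1; have [c hc] := divided_difference_functional k.+2 x.
have cF i : mu.-integrable `[0, pi] (EFin \o (fun t => c i *
    (scaled_tpower k.+1 (cos t) (x i) * p^`(k.+2).[cos t] * sin t))).
  apply: continuous_integrable_itv => t; apply: cvgMr.
  apply: cvgM; last exact: continuous_sin.
  apply: cvgM; last exact: continuous_horner_cos.
  apply: (@continuous_comp _ _ _ cos (fun u => scaled_tpower k.+1 u (x i))).
    exact: continuous_cos.
  exact: continuous_scaled_tpower.
under eq_Rintegral => t _.
  rewrite bsplineE hc mulr_suml.
  under eq_bigr do rewrite -mulrA [scaled_tpower _ _ _ * _]mulrA.
  over.
rewrite Rintegral_sum//.
transitivity (\sum_(i < k.+3) c i * (p.[x i] - (taylor_poly k.+1 p (-1)).[x i])).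
  apply: eq_bigr => i _; rewrite RintegralZl//.
    by rewrite scaled_tpower_moment.
  apply: continuous_integrable_itv => t.
  apply: cvgM; last exact: continuous_sin.
  apply: cvgM; last exact: continuous_horner_cos.
  apply: (@continuous_comp _ _ _ cos (fun u => scaled_tpower k.+1 u (x i))).
    exact: continuous_cos.
  exact: continuous_scaled_tpower.
under eq_bigr do rewrite mulrBr.
rewrite sumrB -!hc [X in _ - X]divided_difference_poly ?(leqW (size_taylor_poly _ _ _))//.
by rewrite nth_default ?subr0// size_taylor_poly.
Qed.

End bspline_moments.

Section uniqueness.
Variable R : realType.
Notation mu := (@lebesgue_measure R).

Lemma cos_polynomials_le0 (f : R -> R) x : continuous f ->
  (forall p : {poly R}, \int[mu]_(t in `[0, pi]) (f t * p.[cos t]) = 0) ->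
  0 < x < pi -> f x <= 0.
Proof.
move=> cf f0 /andP[x0 x1]; rewrite leNgt; apply/negP => fx.
pose e : R := f x / 2; have e0 : 0 < e by rewrite divr_gt0.
have [dl dl0 hdl] : exists2 dl, 0 < dl & forall y, `|x - y| < dl -> e <= f y.
  have /cvgrPdist_lt /(_ _ e0) /nbhs_ballP[dl /= dl0 h] := cf x.
  exists dl => // y xy; have := h y xy; rewrite ltr_norml => /andP[_].
  by rewrite /e; lra.
pose eta : R := Num.min (dl ^+ 2 / 8) 1.
have eta0 : 0 < eta by rewrite lt_min ltr01 andbT divr_gt0// exprn_gt0.
have eta1 : eta <= 1 by rewrite ge_min lexx orbT.
have far y : 0 <= y <= pi -> dl <= `|x - y| -> eta <= `|cos y - cos x|.
  move=> /andP[y0 y1] xy; rewrite ge_min; apply/orP; left.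
  have xy2 : dl ^+ 2 <= (y - x) ^+ 2.
    by rewrite -(real_normK (num_real (y - x))) distrC lerXn2r ?nnegrE ?normr_ge0 ?(ltW dl0).
  have s0 := sqr_ge0 (y - x).
  have [yx|yx] := leP x y.
    have h := cosB_ge (ltW x0) yx y1; rewrite distrC ger0_norm; lra.
  have h := cosB_ge y0 (ltW yx) (ltW x1).
  have E : (x - y) ^+ 2 = (y - x) ^+ 2 by ring.
  by rewrite E in h; rewrite ger0_norm; lra.
have eta20 : 0 < eta / 2 by rewrite divr_gt0.
have [dl1 dl10 hdl1] : exists2 dl1, 0 < dl1 &
    forall y, `|x - y| < dl1 -> `|cos y - cos x| <= eta / 2.
  have /cvgrPdist_lt /(_ _ eta20) /nbhs_ballP[dl1 /= dl10 h] := @continuous_cos R x.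
  by exists dl1 => // y xy; rewrite distrC ltW// h.
pose dl2 : R := Num.min (Num.min dl dl1) (Num.min x (pi - x)) / 2.
have dl20 : 0 < dl2 by rewrite divr_gt0// !lt_min dl0 dl10 x0 subr_gt0 x1.
have [dl2a dl2b dl2c dl2d] : [/\ dl2 < dl, dl2 < dl1, dl2 < x & dl2 < pi - x].
  have h2 : dl2 + dl2 = Num.min (Num.min dl dl1) (Num.min x (pi - x)).
    by rewrite /dl2; lra.
  have : Num.min (Num.min dl dl1) (Num.min x (pi - x)) <= Num.min (Num.min dl dl1) (Num.min x (pi - x)) by [].
  rewrite -{1}h2 !le_min => /andP[/andP[? ?] /andP[? ?]].
  by split; lra.
have [c _ hc] : exists2 c, c \in `[0, pi]%R & forall t, t \in `[0, pi]%R -> f c <= f t.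
  by apply: EVT_min; [lra|exact: continuous_subspaceT].
pose F : R := `|f c|.
have fF t : 0 <= t <= pi -> - F <= f t.
  move=> t01; apply: (@le_trans _ _ (f c)); last by apply: hc; rewrite in_itv.
  by rewrite lerNl /F -normrN ler_norm.
have F0 : 0 <= F by exact: normr_ge0.
pose q : R := 1 - eta ^+ 2 / 4; pose r : R := 1 - eta ^+ 2 / 16.
have eta2 : 0 < eta ^+ 2 <= 1 by rewrite exprn_gt0//= expr_le1// ltW.
have q0 : 0 <= q by rewrite /q; lra.
have qr : q < r by rewrite /q /r; lra.
have r0 : 0 < r by lra.
pose w t : R := 1 - (cos t - cos x) ^+ 2 / 4.
have w0 t : 0 <= w t.
  have c1 : `|cos t - cos x| <= 2.
    rewrite ler_norml; have := cos_le1 t; have := cos_geN1 t.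
    by have := cos_le1 x; have := cos_geN1 x; lra.
  have : (cos t - cos x) ^+ 2 <= 2 ^+ 2.
    by rewrite -(real_normK (num_real (cos t - cos x))) lerXn2r ?nnegrE.
  by rewrite /w; lra.
have key k : 2 * dl2 * e * r ^+ k <= pi * F * q ^+ k.
  pose p : {poly R} := (1 - 4^-1 *: ('X - (cos x)%:P) ^+ 2) ^+ k.
  have pE t : p.[cos t] = w t ^+ k.
    rewrite /p horner_exp hornerD hornerN hornerZ horner_exp hornerXsubC hornerC.
    by rewrite /w; congr (_ ^+ k); ring.
  pose g t : R := f t * p.[cos t].
  have cg : continuous g.
    by move=> t; apply: cvgM; [exact: cf|exact: continuous_horner_cos].
  have low t : 0 <= t <= pi -> - (F * q ^+ k) <= g t.
    move=> t01; rewrite /g pE.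
    have [tx|tx] := ltP `|x - t| dl.
      apply: (@le_trans _ _ 0); first by rewrite oppr_le0 mulr_ge0// exprn_ge0.
      by rewrite mulr_ge0 ?exprn_ge0// (le_trans (ltW e0))// hdl.
    have wq : w t ^+ k <= q ^+ k.
      rewrite lerXn2r ?nnegrE//.
      have : eta ^+ 2 <= `|cos t - cos x| ^+ 2.
        by rewrite lerXn2r ?nnegrE ?(ltW eta0)// far.
      by rewrite real_normK ?num_real// /q /w; lra.
    have := fF t t01; have := exprn_ge0 k (w0 t).
    nra.
  have high t : x - dl2 <= t <= x + dl2 -> e * r ^+ k <= g t.
    move=> /andP[ta tb]; rewrite /g pE.
    have xt : `|x - t| <= dl2 by rewrite ler_norml; lra.
    apply: ler_pM; rewrite ?exprn_ge0 ?(ltW e0) ?(ltW r0)//.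
      by apply: hdl; apply: le_lt_trans xt _.
    rewrite lerXn2r ?nnegrE ?(ltW r0)//.
    have : `|cos t - cos x| ^+ 2 <= (eta / 2) ^+ 2.
      by rewrite lerXn2r ?nnegrE ?(ltW eta20)// hdl1// (le_lt_trans xt).
    by rewrite real_normK ?num_real// /r /w expr_div_n; lra.
  have := f0 p; rewrite -/g.
  rewrite (@Rintegral_itv_split _ _ 0 (x - dl2) pi cg); [|lra|lra].
  rewrite (@Rintegral_itv_split _ _ (x - dl2) (x + dl2) pi cg); [|lra|lra].
  have h1 : - (F * q ^+ k) * (x - dl2 - 0) <= \int[mu]_(t in `[0, x - dl2]) g t.
    by apply: Rintegral_ge_cst => //; [lra|move=> t ?; apply: low; lra].
  have h2 : e * r ^+ k * (x + dl2 - (x - dl2)) <= \int[mu]_(t in `[x - dl2, x + dl2]) g t.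
    by apply: Rintegral_ge_cst => //; lra.
  have h3 : - (F * q ^+ k) * (pi - (x + dl2)) <= \int[mu]_(t in `[x + dl2, pi]) g t.
    by apply: Rintegral_ge_cst => //; [lra|move=> t ?; apply: low; lra].
  have Fq0 : 0 <= F * q ^+ k by rewrite mulr_ge0// exprn_ge0.
  clearbody g; move: (r ^+ k) (q ^+ k) h1 h2 h3 Fq0 => rk qk h1 h2 h3 Fq0.
  move=> E; have : 2 * dl2 * (e * rk) <= (pi - 2 * dl2) * (F * qk) by lra.
  have : 0 <= dl2 * (F * qk) by rewrite mulr_ge0// ltW.
  by move=> A B; lra.
have qr1 : `|q / r| < 1 by rewrite ger0_norm ?divr_ge0 ?(ltW r0)// ltr_pdivrMr// mul1r.
have /cvgrPdist_lt := cvg_expr qr1.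
pose z : R := 2 * dl2 * e / (pi * F + 1).
have piF : 0 <= pi * F by rewrite mulr_ge0// pi_ge0.
have z0 : 0 < z.
  by apply: divr_gt0; [apply: mulr_gt0 => //; apply: mulr_gt0|exact: ltr_wpDl].
move=> /(_ _ z0) [k _ /(_ k (leqnn k))].
rewrite sub0r normrN ger0_norm ?exprn_ge0 ?divr_ge0 ?(ltW r0)//.
rewrite expr_div_n /z ltr_pdivlMr; last by lra.
rewrite mulrAC ltr_pdivrMr ?exprn_gt0//.
have := key k; have : 0 <= q ^+ k by rewrite exprn_ge0.
by rewrite mulrDr mulr1 [q ^+ k * _]mulrC; lra.
Qed.

Lemma cos_polynomials_eq0 (f : R -> R) x : continuous f ->
  (forall p : {poly R}, \int[mu]_(t in `[0, pi]) (f t * p.[cos t]) = 0) ->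
  0 < x < pi -> f x = 0.
Proof.
move=> cf f0 x01; apply/eqP; rewrite eq_le cos_polynomials_le0//=.
have := @cos_polynomials_le0 (fun t => - f t) x; rewrite oppr_le0; apply => //.
  by move=> t; apply: cvgN; exact: cf.
move=> p; under eq_Rintegral do rewrite mulNr -mulrN -hornerN.
exact: f0.
Qed.

End uniqueness.

Section gamma_constants.
Variable R : realType.
Notation mu := (@lebesgue_measure R).

Lemma Rintegral_sinX m :
  \int[mu]_(t in `[0, pi]) sin t ^+ (2 * m) = pi * pochhammer (1 / 2) m / m`!%:R.
Proof.
have cs k : continuous (fun t : R => sin t ^+ k).
  move=> t; apply: (@continuous_comp _ _ _ sin (fun v : R => v ^+ k)).
    exact: continuous_sin.
  exact: exprn_continuous.
elim: m => [|m IHm].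
  under eq_Rintegral do rewrite expr0.
  rewrite Rintegral_cst//= lebesgue_measure_itv/= lte_fin pi_gt0/= subr0.
  by rewrite /pochhammer big_ord0 fact0 mul1r mulr1 divr1.
pose F (t : R) : R := - (cos t * sin t ^+ (2 * m).+1).
pose g (t : R) : R := (2 * m).+2%:R * sin t ^+ (2 * m.+1) - (2 * m).+1%:R * sin t ^+ (2 * m).
have dF (t : R) : is_derive t 1 F (g t).
  have hs : is_derive t 1 (fun s : R => sin s ^+ (2 * m).+1)
      ((2 * m).+1%:R * sin t ^+ (2 * m) * cos t).
    have := @is_deriveX R R sin (2 * m).+1 t 1 _ (is_derive_sin t).
    by rewrite /GRing.scale/= exprfctE.
  have h := is_deriveN (is_deriveM (is_derive_cos t) hs).
  rewrite (_ : F = - ((cos : R -> R) * (fun s : R => sin s ^+ (2 * m).+1)))//.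
  apply: is_derive_eq h _.
  rewrite /GRing.scale/= /g.
rewrite (_ : 2 * m.+1 = (2 * m).+2)%N; last by rewrite mulnS.
  have c2 : cos t * cos t = 1 - sin t * sin t.
    by rewrite -[LHS]expr2 -[in RHS]expr2 cos2sin2.
  move: {hs} (2 * m)%N => k; rewrite !exprS -[k.+2%:R]natr1.
  move: (sin t ^+ k) (k.+1%:R : R) c2; move: (cos t) (sin t) => c x s l c2.
  have -> : - (c * (l * s * c) + x * s * - x) = x * (x * s) - l * (c * c) * s by ring.
  by rewrite c2; ring.
have cg : continuous g.
  by move=> t; apply: cvgB; apply: cvgMr; exact: cs.
have := Rintegral_primitive (pi_ge0 R) dF cg.
rewrite /F sinpi sin0 !expr0n !mulr0 subrr.
have ci c k : mu.-integrable `[0, pi] (EFin \o (fun t => c * sin t ^+ k)).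
  by apply: continuous_integrable_itv => t; apply: cvgMr; exact: cs.
have si k : mu.-integrable `[0, pi] (EFin \o (fun t => sin t ^+ k)).
  exact: continuous_integrable_itv.
rewrite RintegralB// !RintegralZl//.
rewrite IHm => /eqP; rewrite subr_eq0 => /eqP E.
have k0 : (2 * m).+2%:R != 0 :> R by rewrite pnatr_eq0.
apply: (mulfI k0); rewrite E /pochhammer big_ord_recr/= factS natrM.
have f0 : m`!%:R != 0 :> R by rewrite pnatr_eq0 -lt0n fact_gt0.
move: (\prod_(i < m) _) (m`!%:R) f0 => P f f0.
have n0 : m.+1%:R != 0 :> R by rewrite pnatr_eq0.
have -> : (2 * m).+2%:R = 2 * m.+1%:R :> R by rewrite -natrM mulnS.
have -> : (2 * m).+1%:R = 2 * m%:R + 1 :> R by rewrite -natr1 natrM.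
move: (m.+1%:R) (pi : R) n0 => n p n0.
by field; rewrite f0 n0.
Qed.

Lemma powR_half (y : R) m : 0 <= y -> y `^ (m%:R + 1 / 2) = Num.sqrt y ^+ (2 * m).+1.
Proof.
move=> y0; rewrite powRD; last first.
  by apply/implyP => /eqP h; have : 0 <= m%:R :> R by []; lra.
rewrite powR_mulrn// div1r powR12_sqrt// exprSr exprM sqr_sqrtr//.
Qed.

Lemma Rintegral_half_power m :
  \int[mu]_(u in `[-1, 1]) (1 - u ^+ 2) `^ (m%:R + 1 / 2) =
  pi * pochhammer (1 / 2) m.+1 / (m.+1)`!%:R.
Proof.
rewrite -Rintegral_sinX.
pose G (u : R) : R := Num.sqrt (1 - u ^+ 2) ^+ (2 * m).+1.
have cG : continuous G.
  move=> u; apply: (@continuous_comp _ _ _ (fun u : R => Num.sqrt (1 - u ^+ 2))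
    (fun v => v ^+ (2 * m).+1)); last exact: exprn_continuous.
  apply: (@continuous_comp _ _ _ (fun u : R => 1 - u ^+ 2) Num.sqrt).
    by apply: cvgB; [exact: cvg_cst|exact: exprn_continuous].
  exact: sqrt_continuous.
transitivity (\int[mu]_(u in `[-1, 1]) G u).
  apply: eq_Rintegral => u; rewrite inE/= in_itv/= => /andP[u1 u2].
  by rewrite powR_half// subr_ge0; nra.
have dcos : derive1 (cos : R -> R) = (fun t => - sin t).
  by apply/funext => t; rewrite derive1E; exact: derive_val.
have csin : continuous (derive1 (cos : R -> R)).
  by rewrite dcos => t; apply: cvgN; exact: continuous_sin.
rewrite /Rintegral -cospi -[X in BRight X](@cos0 R).
rewrite (@integration_by_substitution_decreasing _ cos G 0 pi) ?pi_ge0//.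
- congr fine; apply: eq_integral => t; rewrite inE/= in_itv/= => /andP[t0 t1].
  congr EFin; rewrite /G /= dcos /= opprK.
  change (Num.sqrt (1 - cos t ^+ 2) ^+ (2 * m).+1 * sin t = sin t ^+ (2 * m.+1)).
  rewrite -sin2cos2 sqrtr_sqr ger0_norm ?sin_ge0_pi ?t0//.
  by rewrite -exprSr mulnS.
- by move=> x y xI yI xy; rewrite ltr_cos.
- exact: (cvgP _ (cvg_at_right_filter (csin 0))).
- exact: (cvgP _ (cvg_at_left_filter (csin pi))).
- split; first by move=> t _; exact: derivable_cos.
    by apply: cvg_at_right_filter; exact: continuous_cos.
  by apply: cvg_at_left_filter; exact: continuous_cos.
- exact: continuous_subspaceT.
Qed.

End gamma_constants.

Section gamma_half_integers.
Variable R : realType.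
Notation mu := (@lebesgue_measure R).

Let a (k : nat) : R := k.+1%:R^-1.
Let b (k : nat) : R := k.+1%:R.

Let a0 k : 0 < a k. Proof. by rewrite invr_gt0. Qed.

Let ab k : a k <= b k.
Proof.
have b1 : 1 <= b k by rewrite /b ler1n.
by apply: le_trans b1; rewrite /a invf_le1 ?ltr0n// ler1n.
Qed.

Let ab_le i j : (i <= j)%N -> a j <= a i /\ b i <= b j.
Proof.
move=> ij; split; last by rewrite /b ler_nat ltnS.
by rewrite /a lef_pV2 ?posrE ?ltr0n// ler_nat ltnS.
Qed.

Let ab_ex (x : R) : 0 < x -> exists k, a k <= x <= b k.
Proof.
move=> x0; have xV0 : 0 < x^-1 by rewrite invr_gt0.
exists (Num.truncn (x + x^-1)).
have := Num.Theory.truncnS_gt (x + x^-1).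
rewrite -/(b _) => h; apply/andP; split; last by lra.
by rewrite /a -[leRHS]invrK lef_pV2 ?posrE ?ltr0n//; move: h; rewrite /b; lra.
Qed.

Definition gauss_moment m k : R := \int[mu]_(x in `[a k, b k]) (x ^+ (2 * m) * gauss_fun x).

Let is_derive_gauss (x : R) : is_derive x 1 (@gauss_fun R) (- (2 * x) * gauss_fun x).
Proof.
have h1 : is_derive x 1 (fun x : R => - (x ^+ 2)) (- (2 * x)).
  have := @is_deriveX R R id 2 x 1 _ (is_derive_id x 1).
  rewrite /GRing.scale/= exprfctE expr1 mulr1 => h.
  exact: (is_deriveN h).
have := @is_derive1_comp R expR (fun x : R => - (x ^+ 2)) x _ _ (is_derive_expR _) h1.
by rewrite [X in is_derive _ _ _ X -> _]mulrC.
Qed.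

Let F m (x : R) : R := x ^+ (2 * m).+1 * gauss_fun x.

Let cmoment m : continuous (fun x : R => x ^+ m * gauss_fun x).
Proof.
by move=> x; apply: cvgM; [exact: exprn_continuous|exact: continuous_gauss_fun].
Qed.

Lemma gauss_momentS m k : gauss_moment m.+1 k =
  (1 / 2 + m%:R) * gauss_moment m k + (F m (a k) - F m (b k)) / 2.
Proof.
pose g (x : R) : R := (2 * m).+1%:R * (x ^+ (2 * m) * gauss_fun x)
  - 2 * (x ^+ (2 * m.+1) * gauss_fun x).
have dF (x : R) : is_derive x 1 (F m) (g x).
  have hX : is_derive x 1 (fun x : R => x ^+ (2 * m).+1) ((2 * m).+1%:R * x ^+ (2 * m)).
    have := @is_deriveX R R id (2 * m).+1 x 1 _ (is_derive_id x 1).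
    by rewrite /GRing.scale/= exprfctE mulr1.
  have h := is_deriveM hX (is_derive_gauss x).
  rewrite (_ : F m = (fun x : R => x ^+ (2 * m).+1) * (@gauss_fun R))//.
  apply: is_derive_eq h _; rewrite /GRing.scale/= /g.
  rewrite (_ : 2 * m.+1 = (2 * m).+2)%N; last by rewrite mulnS.
  move: {hX} (2 * m)%N (gauss_fun x) => k' G; rewrite !exprS.
  by ring.
have ci c l : mu.-integrable `[a k, b k] (EFin \o (fun x => c * (x ^+ l * gauss_fun x))).
  by apply: continuous_integrable_itv => x; apply: cvgMr; exact: cmoment.
have si l : mu.-integrable `[a k, b k] (EFin \o (fun x => x ^+ l * gauss_fun x)).
  exact: continuous_integrable_itv.
have cg : continuous g by move=> x; apply: cvgB; apply: cvgMr; exact: cmoment.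
have := Rintegral_primitive (ab k) dF cg.
rewrite RintegralB// !RintegralZl// -/(gauss_moment m k) -/(gauss_moment m.+1 k).
have -> : (2 * m).+1%:R = 2 * m%:R + 1 :> R by rewrite -natr1 natrM.
by move: (gauss_moment _ _) (gauss_moment _ _) (F _ _) (F _ _) => A B C D; lra.
Qed.

Let cvgFa m : F m (a k) @[k --> \oo] --> (0 : R).
Proof.
have -> : 0 = F m 0 by rewrite /F expr0n mul0r.
apply: continuous_cvg; first exact: cmoment.
exact: cvg_harmonic.
Qed.

Let cvgFb m : F m (b k) @[k --> \oo] --> (0 : R).
Proof.
apply: (@squeeze_cvgr _ _ _ _ (cst 0) (fun k => (m.+1)`!%:R * harmonic k)).
- near=> k; have b0 : 0 < b k by rewrite ltr0n.
  rewrite /F mulr_ge0 ?exprn_ge0 ?gauss_fun_ge0 ?(ltW b0)//=.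
  have N0 : 0 < (m.+1)`!%:R :> R by rewrite ltr0n fact_gt0.
  have h : (b k ^+ 2) ^+ m.+1 / (m.+1)`!%:R <= expR (b k ^+ 2).
    by apply: le_trans (expR_ge1Dxn m (sqr_ge0 _)); rewrite lerDr.
  rewrite /gauss_fun expRN -/(b k).
  rewrite ler_pdivrMr ?expR_gt0// mulrAC ler_pdivlMr//.
  rewrite -exprSr (_ : (2 * m).+2 = 2 * m.+1)%N; last by rewrite mulnS.
  by rewrite exprM mulrC -ler_pdivrMr.
- exact: cvg_cst.
- rewrite -[X in _ --> X](mulr0 (m.+1)`!%:R); apply: cvgMr; exact: cvg_harmonic.
Unshelve. all: by end_near. Qed.

Let bigcup_ab : \bigcup_k `[a k, b k]%classic = `]0, +oo[%classic.
Proof.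
apply/seteqP; split => [x [k _]|x] /=; rewrite !in_itv/= ?andbT.
  by move=> /andP[+ _]; exact: lt_le_trans.
by move=> /ab_ex[k hk]; exists k => //=; rewrite in_itv.
Qed.

Let cvg_moment m : gauss_moment m k @[k --> \oo] --> pochhammer (1 / 2) m * (Num.sqrt pi / 2).
Proof.
elim: m => [|m IHm].
  rewrite /pochhammer big_ord0 mul1r.
  have h : (\int[mu]_(x in `[a k, b k]) (gauss_fun x)%:E)%E @[k --> \oo] -->
      (\int[mu]_(x in `]0%R, +oo[) (gauss_fun x)%:E)%E.
    rewrite -bigcup_ab; apply: ge0_nondecreasing_set_cvg_integral.
    - move=> i j /ab_le[h1 h2]; apply/subsetPset => x /=; rewrite !in_itv/=.
      by move=> /andP[x1 x2]; apply/andP; split; [exact: le_trans x1|exact: le_trans h2].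
    - by move=> i; exact: measurable_itv.
    - by move=> i; apply/measurable_EFinP/measurable_funTS; exact: measurable_gauss_fun.
    - by move=> i x _; rewrite lee_fin gauss_fun_ge0.
  rewrite integral_itv_obnd_cbnd in h; last first.
    by apply/measurable_EFinP/measurable_funTS; exact: measurable_gauss_fun.
  rewrite integral0y_gauss in h.
  have h' : (fun k => fine (\int[mu]_(x in `[a k, b k]) (gauss_fun x)%:E)%E) @ \oo -->
    Num.sqrt (pi : R) / 2 by exact: fine_cvg h.
  rewrite (_ : (fun k => _) = (fun k => fine (\int[mu]_(x in `[a k, b k]) (gauss_fun x)%:E)%E))//.
  by apply/funext => k; apply: eq_Rintegral => x _; rewrite expr0 mul1r.
rewrite (_ : pochhammer (1 / 2) m.+1 * (Num.sqrt pi / 2) =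
  (1 / 2 + m%:R) * (pochhammer (1 / 2) m * (Num.sqrt pi / 2)) + 0); last first.
  by rewrite /pochhammer big_ord_recr/=; ring.
under eq_fun do rewrite gauss_momentS.
apply: cvgD; first by apply: cvgMr; exact: IHm.
have -> : 0 = (0 - 0) / 2 :> R by rewrite subrr mul0r.
by apply: cvgMl; apply: cvgB; [exact: cvgFa|exact: cvgFb].
Unshelve. all: by end_near. Qed.

Let G m (t : R) : R := Num.sqrt t ^+ (2 * m) / Num.sqrt t * expR (- t).

Let cG m (t : R) : 0 < t -> {for t, continuous (G m)}.
Proof.
move=> t0; apply: cvgM; last first.
  apply: (@continuous_comp _ _ _ -%R expR); first exact: oppr_continuous.
  exact: continuous_expR.
apply: cvgM; last first.
  by apply: cvgV; [rewrite gt_eqF ?sqrtr_gt0|exact: sqrt_continuous].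
apply: (@continuous_comp _ _ _ Num.sqrt (fun v : R => v ^+ (2 * m))).
  exact: sqrt_continuous.
exact: exprn_continuous.
Qed.

Let substitution m k :
  (\int[mu]_(t in `[(a k ^+ 2)%R, (b k ^+ 2)%R]) (G m t)%:E)%E = (2 * gauss_moment m k)%:E.
Proof.
have dX : derive1 (fun x : R => x ^+ 2) = (fun x => 2 * x).
  apply/funext => x; rewrite derive1E.
  have := @is_deriveX R R id 2 x 1 _ (is_derive_id x 1).
  by rewrite /GRing.scale/= exprfctE expr1 mulr1 => h; exact: derive_val.
have cX : continuous (derive1 (fun x : R => x ^+ 2)).
  by rewrite dX => x; apply: cvgMr; exact: cvg_id.
rewrite (@integration_by_substitution_increasing _ (fun x => x ^+ 2) (G m) (a k) (b k))//.
- transitivity (\int[mu]_(x in `[a k, b k]) (2 * (x ^+ (2 * m) * gauss_fun x))%:E)%E.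
    apply: eq_integral => x; rewrite inE/= in_itv/= => /andP[x1 _]; congr EFin.
    have x0 : 0 < x by exact: lt_le_trans x1.
    rewrite dX; change (G m (x ^+ 2) * (2 * x) = 2 * (x ^+ (2 * m) * gauss_fun x)).
    rewrite /G sqrtr_sqr gtr0_norm// /gauss_fun.
    by field; rewrite gt_eqF.
  rewrite -(@RintegralZl _ _ _ _ _ _ 2)//; last exact: continuous_integrable_itv.
  rewrite /Rintegral fineK//; apply: integrable_fin_num => //.
  by apply: continuous_integrable_itv => x; apply: cvgMr; exact: cmoment.
- move=> x y; rewrite !in_itv/= => /andP[x1 _] /andP[y1 _] xy.
  by rewrite ltrXn2r ?nnegrE ?(le_trans (ltW (a0 k)))//.
- exact: (cvgP _ (cvg_at_right_filter (cX _))).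
- exact: (cvgP _ (cvg_at_left_filter (cX _))).
- split; first by move=> x _; exact: exprn_derivable.
    by apply: cvg_at_right_filter; exact: exprn_continuous.
  by apply: cvg_at_left_filter; exact: exprn_continuous.
- apply: continuous_in_subspaceT => t; rewrite inE/= in_itv/= => /andP[t1 _].
  by apply: cG; apply: lt_le_trans t1; rewrite exprn_gt0.
Qed.

Lemma Gamma_half m : Gamma (m%:R + 1 / 2) = pochhammer (1 / 2) m * Num.sqrt (pi : R).
Proof.
have cup : \bigcup_k `[(a k ^+ 2), (b k ^+ 2)]%classic = `]0, +oo[%classic.
  apply/seteqP; split => [x [k _]|x] /=; rewrite !in_itv/= ?andbT.
    by move=> /andP[+ _]; apply: lt_le_trans; rewrite exprn_gt0.
  move=> x0; have /ab_ex[k /andP[k1 k2]] : 0 < Num.sqrt x by rewrite sqrtr_gt0.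
  exists k => //=; rewrite in_itv/= -(sqr_sqrtr (ltW x0)).
  by rewrite !lerXn2r ?nnegrE ?sqrtr_ge0 ?(ltW (a0 k))// /b ler0n.
have h : (\int[mu]_(t in `[(a k ^+ 2)%R, (b k ^+ 2)%R]) (G m t)%:E)%E @[k --> \oo] -->
    (\int[mu]_(x in `]0%R, +oo[) (G m x)%:E)%E.
  rewrite -cup; apply: ge0_nondecreasing_set_cvg_integral.
  - move=> i j /ab_le[h1 h2]; apply/subsetPset => x /=; rewrite !in_itv/=.
    move=> /andP[x1 x2]; apply/andP; split; [apply: le_trans x1|apply: (le_trans x2)].
      by rewrite lerXn2r ?nnegrE ?(ltW (a0 _)).
    by rewrite lerXn2r ?nnegrE ?ler0n.
  - by move=> i; exact: measurable_itv.
  - move=> i; apply/measurable_EFinP; apply: subspace_continuous_measurable_fun => //.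
    apply: continuous_in_subspaceT => t; rewrite inE/= in_itv/= => /andP[t1 _].
    by apply: cG; apply: lt_le_trans t1; rewrite exprn_gt0.
  - by move=> i x _; rewrite lee_fin mulr_ge0 ?expR_ge0// divr_ge0 ?sqrtr_ge0.
have h2 : (2 * gauss_moment m k)%:E @[k --> \oo] -->
    (2 * (pochhammer (1 / 2) m * (Num.sqrt (pi : R) / 2)))%:E.
  by apply: cvg_EFin; [exact: nearW|apply: cvgMr; exact: cvg_moment].
have h1 : (2 * gauss_moment m k)%:E @[k --> \oo] --> (\int[mu]_(x in `]0%R, +oo[) (G m x)%:E)%E.
  by under eq_fun do rewrite -substitution; exact: h.
have E := cvg_unique (@ereal_hausdorff R) h1 h2.
rewrite /Gamma; transitivity (\int[mu]_(x in `]0%R, +oo[) G m x).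
  apply: eq_Rintegral => t; rewrite inE/= in_itv/= andbT => t0.
  rewrite /G; congr (_ * _).
  rewrite powRD; last by apply/implyP => _; rewrite gt_eqF.
  rewrite powR_half ?(ltW t0)// powR_inv1 ?(ltW t0)//.
  rewrite -{2}(sqr_sqrtr (ltW t0)) exprSr.
  have s0 : 0 < Num.sqrt t by rewrite sqrtr_gt0.
  by move: (Num.sqrt t ^+ (2 * m)) (Num.sqrt t) s0 => X s s0; field; rewrite gt_eqF.
by rewrite /Rintegral E /=; field.
Qed.

End gamma_half_integers.

Section polynomial_span.
Variable R : realType.
Implicit Types p q : {poly R}.

Lemma antiderivative_poly p : exists q, q^`() = p.
Proof.
exists (\poly_(i < (size p).+1) (p`_i.-1 / i%:R)); apply/polyP => i.
rewrite coef_deriv coef_poly ltnS.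
have [ip|ip] := ltnP i (size p); last by rewrite mul0rn nth_default.
by rewrite -[LHS]mulr_natr divfK// pnatr_eq0.
Qed.

Lemma antiderivativen_poly k p : exists q, q^`(k) = p.
Proof.
elim: k p => [|k IHk] p; first by exists p; rewrite derivn0.
have [q qp] := antiderivative_poly p; have [s sq] := IHk q.
by exists s; rewrite derivnS sq.
Qed.

Lemma chebT_ind (P : {poly R} -> Prop) : P 0 ->
  (forall c M q, P q -> P (c *: chebT R M + q)) -> forall q, P q.
Proof.
move=> P0 PS q; have [m] := ubnP (size q); elim: m q => // m IHm q; rewrite ltnS => qm.
have [/eqP|q0] := posnP (size q); first by rewrite size_poly_eq0 => /eqP->.
have [M qM] : exists M, size q = M.+1 by exists (size q).-1; rewrite prednK.
pose l := lead_coef (chebT R M).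
have l0 : l != 0 by rewrite lead_coef_eq0 -size_poly_eq0 size_chebT.
rewrite -(subrK ((q`_M / l) *: chebT R M) q) addrC; apply: (PS); apply: IHm.
apply: (leq_trans _ qm); rewrite qM ltnS; apply/leq_sizeP => j.
rewrite leq_eqVlt coefB coefZ => /orP[/eqP <-|Mj].
  have -> : (chebT R M)`_M = l by rewrite /l lead_coefE size_chebT.
  by rewrite divfK// subrr.
rewrite [q`_j]nth_default ?qM// [(chebT R M)`_j]nth_default ?size_chebT//.
by rewrite mulr0 subrr.
Qed.

End polynomial_span.

Section mean_series.
Variables (R : realType) (i n : nat).
Notation mu := (@lebesgue_measure R).
Notation T := (measurableTypeR R).
Notation muT := (lebesgue_tuple R i.+3).
Notation D := (torus R i.+3).
Let N : R := cos_E (nseq i.+3 0) n.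

Let w M (t : R) : R := (chebT R M)^`(i.+2).[cos t] * sin t.

Let cw M : continuous (w M).
Proof.
move=> t; apply: cvgM; last exact: continuous_sin.
exact: continuous_horner_cos.
Qed.

Lemma bspline_mean_chebT M :
  \int[mu]_(x in `[0, pi]) (bspline_mean (fun t : i.+3.-tuple T => cos_E t n) x * w M x) =
  if (M < i.+2)%N then 0 else
  2 ^+ i.+1 * ((2 * pi) ^+ i.+3 * N * kap R i.+2 (M - i.+2) n).
Proof.
pose k (t : i.+3.-tuple T) : R := if (M < i.+2)%N then 0 else
  2 ^+ i.+1 * cos_F (thead t) (behead t) (M - i.+2).
have mk : measurable_fun setT k.
  rewrite /k; case: (M < i.+2)%N; first exact: measurable_cst.
  apply: measurable_funM; first exact: measurable_cst.
  exact: (tame_cos_F R i.+2 _).1.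
rewrite (@bspline_mean_swap R i _ _ k) //; last 2 first.
- exact: tame_cos_E.
- apply: filterS (ae_distinct_knots R i.+3) => t dt /dt {}dt.
  have dx : distinct_knots i.+2 (fun j => cos (nth 0 t j)).
    by move=> a b ia ib; exact: (dt a b).
  rewrite (@bspline_moment R i (chebT R M) _ dx); last by move=> j; rewrite cos_geN1 cos_le1.
  rewrite /k; case: ltnP => Mi.
    rewrite (divided_difference_poly dx); last by rewrite size_chebT; exact: ltnW.
    by rewrite nth_default// size_chebT.
  have st : size (behead t) = i.+2 by rewrite size_behead size_tuple.
  have tE : (t : seq R) = thead t :: behead t by rewrite {1}(tuple_eta t).
  have := @dd_chebT R (thead t) (behead t) (M - i.+2).
  rewrite -tE st subnK// => /(_ dx) /(_ _)/= h.
  have /h : (0 < M)%N by apply: leq_trans Mi.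
  move=> {}h; apply: (@mulfI _ 2) => //.
  by rewrite h exprS mulrA.
rewrite /k; case: ifP => _.
  under eq_Rintegral do rewrite mul0r.
  by rewrite Rintegral_cst ?mul0r//; exact: measurable_torus.
under eq_Rintegral do rewrite -mulrA.
rewrite RintegralZl//; [|exact: measurable_torus|]; last first.
  by apply: tame_integrable; apply: tameM; [exact: tame_cos_F|exact: tame_cos_E].
by rewrite Rintegral_cos_F_cos_E.
Qed.

Lemma tseries_chebT M :
  \int[mu]_(x in `[0, pi]) (tseries i n x * w M x) =
  if (M < i.+2)%N then 0 else kap R i.+2 (M - i.+2) n / 2.
Proof.
pose e k : R := if (n + 2 * k + i.+2 == M)%N then 1 / 2 else 0.
pose L : R := \sum_(k < M.+1) binom_coef R i k * e k.
have cS K : continuous (fun x => series (tseries_term i n x) K).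
  exact: continuous_series_tseries.
have SE K : \int[mu]_(x in `[0, pi]) (series (tseries_term i n x) K * w M x) =
    \sum_(k < K) binom_coef R i k * e k.
  have ci k : mu.-integrable `[0, pi] (EFin \o (fun x : R =>
      binom_coef R i k * (tpower_coef i.+1 (n + 2 * k + i.+2) x * w M x))).
    apply: continuous_integrable_itv => x; apply: cvgMr; apply: cvgM; last exact: cw.
    by apply: continuous_tpower_coef; rewrite addnS ltnS leq_addl.
  transitivity (\int[mu]_(x in `[0, pi]) \sum_(k < K)
      (binom_coef R i k * (tpower_coef i.+1 (n + 2 * k + i.+2) x * w M x))).
    apply: eq_Rintegral => x _; rewrite /series/= big_mkord mulr_suml.
    by apply: eq_bigr => k _; rewrite /tseries_term mulrA.
  rewrite Rintegral_sum//; apply: eq_bigr => k _.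
  rewrite RintegralZl//; last first.
    apply: continuous_integrable_itv => x; apply: cvgM; last exact: cw.
    by apply: continuous_tpower_coef; rewrite addnS ltnS leq_addl.
  congr (_ * _); under eq_Rintegral do rewrite /w mulrA.
  by rewrite tpower_coef_chebT// addnS ltnS leq_addl.
have LK K : (M.+1 <= K)%N -> \sum_(k < K) binom_coef R i k * e k = L.
  move=> MK; rewrite -(subnKC MK) big_split_ord/= [X in _ + X]big1 ?addr0// => k _.
  rewrite /e ifN ?mulr0//; apply/negP => /eqP; lia.
have c0 : continuous (fun x => tseries i n x * w M x).
  by move=> x; apply: cvgM; [exact: continuous_tseries|exact: cw].
have tsL : \int[mu]_(x in `[0, pi]) (tseries i n x * w M x) = L.
  have [W hW] : exists W, forall x, 0 <= x <= pi -> `|w M x| <= W.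
    have [c _ hc] : exists2 c, c \in `[0, pi]%R & forall t, t \in `[0, pi]%R ->
        `|w M t| <= `|w M c|.
      apply: EVT_max; first exact: pi_ge0.
      apply: continuous_subspaceT => x; apply: cvg_norm; exact: cw.
    by exists `|w M c| => x x01; apply: hc; rewrite in_itv.
  have W0 : 0 <= W by apply: le_trans (hW 0 _); rewrite ?lexx ?pi_ge0.
  apply/eqP; rewrite -subr_eq0 -normr_le0; apply/ler_addgt0Pl => z z0; rewrite addr0.
  have [K hK] := exists_inv_le (i.+3%:R * W * pi) z0.
  pose K' := maxn K M.+1.
  rewrite -(LK K') ?leq_maxr// -SE -RintegralB//; last 2 first.
  - by apply: continuous_integrable_itv; exact: c0.
  - apply: continuous_integrable_itv => x; apply: cvgM; [exact: cS|exact: cw].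
  apply: (@le_trans _ _ (i.+3%:R / K'.+1%:R * W * (pi - 0))).
    apply: Rintegral_norm_le; rewrite ?pi_ge0//.
      move=> x; apply: cvgB; first exact: c0.
      by apply: cvgM; [exact: cS|exact: cw].
    move=> x x01; rewrite -mulrBl normrM.
    by apply: ler_pM => //; [exact: tseries_dist|exact: hW].
  apply: le_trans hK; rewrite subr0 !(mulrAC _ (K'.+1%:R^-1)).
  apply: ler_wpM2l; first by rewrite !mulr_ge0// pi_ge0.
  by rewrite lef_pV2 ?posrE ?ltr0n// ler_nat ltnS leq_maxl.
rewrite tsL /L; case: ltnP => Mi.
  rewrite big1// => k _; rewrite /e ifN ?mulr0//; apply/negP => /eqP; lia.
have [[k hk]|hk] := pselect (exists k, M - i.+2 = n + 2 * k)%N.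
  have kM : (k < M.+1)%N by lia.
  rewrite hk kap_even.
  rewrite (bigD1 (Ordinal kM))//= big1 ?addr0.
    rewrite /e ifT; last by apply/eqP; lia.
    by rewrite /binom_coef; lra.
  move=> j jk; rewrite /e ifN ?mulr0//; apply/negP => /eqP E.
  by move/eqP: jk; apply; apply: val_inj => /=; lia.
rewrite kap_odd; last by move=> k E; apply: hk; exists k.
rewrite mul0r big1// => k _; rewrite /e ifN ?mulr0//.
by apply/negP => /eqP E; apply: hk; exists k; lia.
Qed.

End mean_series.

Section mean_value.
Variables (R : realType) (i n : nat).
Notation mu := (@lebesgue_measure R).
Notation T := (measurableTypeR R).
Let N : R := cos_E (nseq i.+3 0) n.
Let C : R := (2 * pi) ^+ i.+3 * N * 2 ^+ i.+2.
Let mean := bspline_mean (fun t : i.+3.-tuple T => cos_E t n).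
Let gap (x : R) : R := mean x - C * tseries i n x.

Let cmean : continuous mean.
Proof. by apply: continuous_bspline_mean; exact: tame_cos_E. Qed.

Let cgap : continuous gap.
Proof.
move=> x; apply: cvgB; first exact: cmean.
by apply: cvgMr; exact: continuous_tseries.
Qed.

Let cgapM (F : R -> R) (p : {poly R}) : continuous F ->
  continuous (fun x => F x * (p.[cos x] * sin x)).
Proof.
move=> cF x; apply: cvgM; first exact: cF.
by apply: cvgM; [exact: continuous_horner_cos|exact: continuous_sin].
Qed.

Let gap_derivn q :
  \int[mu]_(x in `[0, pi]) (gap x * (q^`(i.+2).[cos x] * sin x)) = 0.
Proof.
have ci c (F : R -> R) (p : {poly R}) : continuous F -> mu.-integrable `[0, pi]
    (EFin \o (fun x => c * (F x * (p.[cos x] * sin x)))).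
  by move=> cF; apply: continuous_integrable_itv => x; apply: cvgMr; exact: cgapM.
have ci1 (F : R -> R) (p : {poly R}) : continuous F -> mu.-integrable `[0, pi]
    (EFin \o (fun x => F x * (p.[cos x] * sin x))).
  by move=> cF; apply: continuous_integrable_itv; exact: cgapM.
elim/chebT_ind: q => [|c M q IHq].
  under eq_Rintegral do rewrite linear0 horner0 mul0r mulr0.
  by rewrite Rintegral_cst// mul0r.
transitivity (\int[mu]_(x in `[0, pi])
    (c * (gap x * ((chebT R M)^`(i.+2).[cos x] * sin x)) +
     gap x * (q^`(i.+2).[cos x] * sin x))).
  apply: eq_Rintegral => x _; rewrite derivnD derivnZ hornerD hornerZ.
  by move: (gap x) => g; ring.
rewrite RintegralD//; [|exact: ci|exact: ci1].
rewrite IHq addr0 RintegralZl//; last exact: ci1.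
suff -> : \int[mu]_(x in `[0, pi]) (gap x * ((chebT R M)^`(i.+2).[cos x] * sin x)) = 0.
  by rewrite mulr0.
under eq_Rintegral do rewrite mulrBl -mulrA.
rewrite RintegralB//; [|exact: ci1|apply: ci; exact: continuous_tseries].
rewrite RintegralZl//; last by apply: ci1; exact: continuous_tseries.
rewrite /mean bspline_mean_chebT tseries_chebT -/N; case: ifP => _.
  by rewrite mulr0 subrr.
rewrite /C [2 ^+ i.+2]exprSr.
by move: (kap _ _ _ _) (_ ^+ i.+3) (2 ^+ i.+1) => a b c'; field.
Qed.

Lemma bspline_meanE (x : R) : 0 <= x <= pi -> mean x = C * tseries i n x.
Proof.
move=> x01; suff : gap x = 0 by move/eqP; rewrite subr_eq0 => /eqP.
have inner (y : R) : 0 < y < pi -> gap y = 0.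
  move=> y01; have : gap y * sin y = 0.
    apply: (@cos_polynomials_eq0 R (fun x => gap x * sin x)) => //.
      by move=> z; apply: cvgM; [exact: cgap|exact: continuous_sin].
    move=> p; have [q <-] := antiderivativen_poly i.+2 p.
    rewrite -[RHS](gap_derivn q); apply: eq_Rintegral => z _.
    by rewrite -mulrA [sin z * _]mulrC.
  move/eqP; rewrite mulf_eq0 => /orP[/eqP//|/eqP s0].
  by have := @sin_gt0_pi R y y01; rewrite s0 ltxx.
(* The identity extends to the two ends of the interval by continuity. *)
apply/eqP; rewrite -normr_le0; apply/ler_addgt0Pl => e e0; rewrite addr0.
have /cvgrPdist_lt /(_ _ e0) /nbhs_ballP[dl /= dl0 h] := @cgap x.
have pi0 := pi_gt0 R.
have [y y01 xy] : exists2 y, 0 < y < pi & `|x - y| < dl.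
  have [xl|xl] := ltP x (pi / 2).
    pose z : R := Num.min (dl / 2) (pi / 4).
    have z1 : z <= dl / 2 by rewrite ge_min lexx.
    have z2 : z <= pi / 4 by rewrite ge_min lexx orbT.
    have z0 : 0 < z by rewrite lt_min !divr_gt0.
    exists (x + z); first by lra.
    by rewrite opprD addrA subrr sub0r normrN gtr0_norm//; lra.
  pose z : R := Num.min (dl / 2) (pi / 4).
  have z1 : z <= dl / 2 by rewrite ge_min lexx.
  have z2 : z <= pi / 4 by rewrite ge_min lexx orbT.
  have z0 : 0 < z by rewrite lt_min !divr_gt0.
  exists (x - z); first by lra.
  by rewrite opprB addrC subrK gtr0_norm//; lra.
by have := h y xy; rewrite (inner y)// subr0 => /ltW.
Qed.

Lemma tseries_sin0 (x : R) : sin x = 0 -> tseries i n x = 0.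
Proof.
move=> s0; rewrite /tseries (_ : tseries_term i n x = cst 0).
  rewrite (_ : series _ = cst 0); first exact: lim_cst.
  by apply/funext => k; rewrite /series/= big1.
apply/funext => k; rewrite /tseries_term.
have := tpower_coefE i.+1 (n + 2 * k) x; rewrite s0 expr0n mulr0 mul0r => /eqP.
by rewrite mulf_eq0 expf_eq0 pnatr_eq0 andbF/= => /eqP ->; rewrite mulr0.
Qed.

End mean_value.

Section final.
Variables (R : realType) (i n : nat).

Lemma half_power_constant :
  \int[@lebesgue_measure R]_(u in `[-1, 1]) (1 - u ^+ 2) `^ (i.+3%:R - 3 / 2) =
  pi * pochhammer (1 / 2) i.+2 / (i.+2)`!%:R.
Proof.
rewrite -Rintegral_half_power; apply: eq_Rintegral => u _; congr (_ `^ _).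
by rewrite -[i.+3]addn2 natrD; field.
Qed.

Lemma Gamma_product : Gamma (1 / 2) * Gamma (i.+3%:R - 1 / 2) =
  pi * pochhammer (1 / 2) i.+2 :> R.
Proof.
have -> : i.+3%:R - 1 / 2 = i.+2%:R + 1 / 2 :> R by rewrite -natr1; field.
have -> : Gamma (1 / 2) = Num.sqrt pi :> R.
  by have := @Gamma_half R 0; rewrite mulr0n add0r /pochhammer big_ord0 [1 * Num.sqrt _]mul1r.
by rewrite Gamma_half mulrCA -expr2 sqr_sqrtr ?pi_ge0// mulrC.
Qed.

Definition gegen_term (u : R) k : R :=
  pochhammer (i.+3%:R - 1) k / k`!%:R *
  (gegenbauer (i.+3%:R - 1) (n + 2 * k) u / gegenbauer (i.+3%:R - 1) (n + 2 * k) 1).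

Let K : R := (pi * pochhammer (1 / 2) i.+2)^-1.

Let K0 : K != 0.
Proof.
rewrite invr_eq0 mulf_neq0 ?gt_eqF ?pi_gt0//.
by rewrite pochhammer_gt0.
Qed.

Lemma gegen_termE x k : 0 < x < pi ->
  gegen_term (cos x) k = 2 ^+ i.+2 / (K * sin x ^+ (2 * i.+1).+1) * tseries_term i n x k.
Proof.
move=> x01; have s0 : 0 < sin x by exact: sin_gt0_pi.
have i3 : i.+3%:R - 1 = i.+2%:R :> R by rewrite -natr1 addrK.
rewrite /gegen_term i3 !gegenbauerE -/(gegen_nrm _ _ _) -/(binom_coef R i k).
rewrite /tseries_term [RHS]mulrCA; congr (_ * _).
have sX : sin x ^+ (2 * i.+1).+1 != 0 by rewrite expf_neq0// gt_eqF.
have h := tpower_coefE i.+1 (n + 2 * k) x; rewrite -/K in h.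
have Ks : K * sin x ^+ (2 * i.+1).+1 != 0 by rewrite mulf_neq0// K0.
apply: (mulfI Ks); rewrite -h; move: (K * sin x ^+ _) Ks => Z Z0.
by rewrite [RHS]mulrA [Z * (_ / Z)]mulrC divfK.
Qed.

Lemma gegen_series x : 0 < x < pi ->
  cvgn (series (gegen_term (cos x))) /\
  limn (series (gegen_term (cos x))) =
    2 ^+ i.+2 / (K * sin x ^+ (2 * i.+1).+1) * tseries i n x.
Proof.
move=> x01; set L : R := 2 ^+ i.+2 / _.
have -> : gegen_term (cos x) = L *: tseries_term i n x.
  by apply/funext => k; rewrite gegen_termE.
split; first by apply: is_cvg_seriesZ; exact: cvg_tseries.
by rewrite lim_seriesZ//; exact: cvg_tseries.
Qed.

Local Open Scope complex_scope.

Lemma m_integrandE x t : m_integrand R i.+3 n (cos x) t =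
  (torus_bspline x t * cos_E t n / cos_E (nseq i.+3 0) n)%:C.
Proof.
rewrite /m_integrand l1_exp_sumE -/(torus_bspline x t).
have -> : ((l1_card i.+3 n)%:R : R[i]) = (cos_E (nseq i.+3 (0 : R)) n)%:C.
  by rewrite -l1_cardE rmorph_nat.
by move: (torus_bspline x t) (cos_E t n) (cos_E _ n) => B E N; rewrite !rmorphM/= fmorphV mulrA.
Qed.

End final.

Section integrals.
Variables (R : realType) (i n : nat) (x : R).
Notation muT := (lebesgue_tuple R i.+3).
Notation D := (torus R i.+3).
Let N : R := cos_E (nseq i.+3 0) n.

Let ReE : (fun t => complex.Re (m_integrand R i.+3 n (cos x) t)) =
  (fun t => torus_bspline x t * cos_E t n * N^-1).
Proof. by apply/funext => t; rewrite m_integrandE. Qed.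

Let ImE : (fun t => complex.Im (m_integrand R i.+3 n (cos x) t)) = (fun=> 0).
Proof. by apply/funext => t; rewrite m_integrandE. Qed.

Let integrable_ME := torus_bsplineM_integrable x (tame_cos_E R i.+3 n).

Lemma m_integrand_integrable : complex_integrable muT D (m_integrand R i.+3 n (cos x)).
Proof.
split.
  rewrite (_ : (fun t => _) = (fun t => (torus_bspline x t * cos_E t n)%:E * (N^-1)%:E)%E).
    by apply: integrableZr => //; exact: measurable_torus.
  by apply/funext => t; rewrite -EFinM; congr EFin; exact: (congr1 (@^~ t) ReE).
rewrite (_ : (fun t => _) = cst 0%E).
  by apply: integrable0; exact: measurable_torus.
by apply/funext => t; congr EFin; exact: (congr1 (@^~ t) ImE).
Qed.

Local Open Scope complex_scope.

Lemma bspline_coefE : 0 <= x <= pi ->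
  bspline_coef R i.+3 n (cos x) = (2 ^+ i.+2 * tseries i n x)%:C.
Proof.
move=> x01; have N0 : N != 0 by rewrite gt_eqF// cos_E_zero_gt0.
have p0 : (2 * pi) ^+ i.+3 != 0 :> R by rewrite expf_neq0// mulf_neq0// gt_eqF// pi_gt0.
rewrite /bspline_coef /complex_integral ReE ImE.
rewrite Rintegral_cst ?mul0r; last exact: measurable_torus.
rewrite RintegralZr//; last exact: measurable_torus.
rewrite -/(bspline_mean (fun t => cos_E t n) x) bspline_meanE// -/N -[_ +i* 0]/(_%:C).
rewrite -rmorphM/=; congr _%:C.
move: (_ ^+ i.+3) (2 ^+ i.+2) (tseries _ _ _) p0 => p q s p0.
by field; rewrite p0 N0.
Qed.

End integrals.

Local Open Scope complex_scope.

Theorem proposition3p6 (R : realType) (d n : nat) (hd : (2 < d)%N) :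
  let c : R :=
    (\int[@lebesgue_measure R]_(u in `[-1, 1]) (1 - u ^+ 2) `^ (d%:R - 3 / 2))^-1 in
  let term (u : R) (k : nat) : R :=
    pochhammer (d%:R - 1) k / k`!%:R
      * (gegenbauer (d%:R - 1) (n + 2 * k) u
         / gegenbauer (d%:R - 1) (n + 2 * k) 1) in
  c^-1 = Gamma (1 / 2) * Gamma (d%:R - 1 / 2) / (d.-1)`!%:R /\
  forall u : R, -1 <= u <= 1 ->
    [/\ complex_integrable (lebesgue_tuple R d) (torus R d) (m_integrand R d n u),
        -1 < u < 1 -> cvgn (series (term u))
      & bspline_coef R d n u =
          (if (u == -1) || (u == 1) then 0
           else (1 - u ^+ 2) `^ (d%:R - 3 / 2) * (c / (d.-1)`!%:R)
                  * limn (series (term u)))%:C].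
Proof.
case: d hd => [|[|[|i]]]// _ c term.
have cE : c = (pi * pochhammer (1 / 2) i.+2 / (i.+2)`!%:R)^-1.
  by rewrite /c half_power_constant.
split; first by rewrite cE invrK Gamma_product.
move=> u u1.
have [x x01 ux] : exists2 x : R, 0 <= x <= pi & u = cos x.
  by exists (acos u); rewrite ?acosK ?in_itv// acos_ge0// acos_lepi.
rewrite {u u1}ux.
have inner : -1 < cos x < 1 -> 0 < x < pi.
  move=> /andP[h1 h2]; have /andP[xl xr] := x01.
  rewrite !lt_neqAle xl xr !andbT; apply/andP; split; apply/eqP => E.
    by move: h2; rewrite -E cos0 ltxx.
  by move: h1; rewrite E cospi ltxx.
have termE : term = gegen_term i n by [].
split; first exact: m_integrand_integrable.
  by rewrite termE => /inner x0; exact: (gegen_series i n x0).1.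
rewrite bspline_coefE//; congr _%:C.
case: ifPn => [/orP[] /eqP cx|].
- rewrite tseries_sin0 ?mulr0//; apply/eqP; rewrite -sqrf_eq0 sin2cos2 cx.
  by rewrite sqrrN expr1n subrr.
- rewrite tseries_sin0 ?mulr0//; apply/eqP; rewrite -sqrf_eq0 sin2cos2 cx.
  by rewrite expr1n subrr.
rewrite negb_or => /andP[c1 c2].
have /inner x0 : -1 < cos x < 1.
  by rewrite !lt_neqAle eq_sym c1 c2 cos_geN1 cos_le1.
have s0 : 0 < sin x by exact: sin_gt0_pi.
rewrite termE (gegen_series i n x0).2 cE.
have -> : i.+3%:R - 3 / 2 = i.+1%:R + 1 / 2 :> R.
  by rewrite -[i.+3]addn2 natrD; field.
rewrite powR_half; last by rewrite -sin2cos2 sqr_ge0.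
rewrite -sin2cos2 sqrtr_sqr gtr0_norm// [i.+3.-1]/=.
have f0 : (i.+2)`!%:R != 0 :> R by rewrite pnatr_eq0 -lt0n fact_gt0.
have P0 : pi * pochhammer (1 / 2) i.+2 != 0 :> R.
  by rewrite mulf_neq0 ?gt_eqF ?pi_gt0// pochhammer_gt0.
have sX : sin x ^+ (2 * i.+1).+1 != 0 by rewrite expf_neq0// gt_eqF.
move: (_ ^+ (2 * i.+1).+1) (pi * _) ((i.+2)`!%:R) (2 ^+ i.+2) f0 P0 sX => S P f q f0 P0 S0.
by field; rewrite f0 P0 S0.
Qed.
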